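(* Let $N\geq 3$, $u_0=0$ and $u_1\in L^2(\mathbb{R}^N)\cap L^{1,1}(\mathbb{R}^N)$. Let $u=u(x,t)$ be the unique solution of the Cauchy problem \[ \partial_t^2u+\tfrac{1}{4}L^2u+\tfrac{\pi^2}{4}u+L\,\partial_tu=0\ \ (x\in\mathbb{R}^N,\ t>0),\qquad u(x,0)=u_0(x)=0,\quad \partial_tu(x,0)=u_1(x), \] where $L=\log(-\Delta+I)$. Then there exists $t_0>0$ depending only on $N$ such that, for all $t\geq t_0$, \[ \left\|u(\cdot, t) - \left(\int_{\mathbb{R}^N }u_1(x)\, dx\right)\mathcal{F}^{-1}\left(\frac{4(1+|\xi|^2)^{-\frac{t}{2}}}{\pi} \sin\Big(t\sqrt{\log(1 + |\xi|^2)}\Big)\right)\right\|_{L^2(\mathbb{R}^N)} \leq I_0\,t^{-\frac{N-2}{4}}, \] where $I_0 = \|u_1\|_{L^2(\mathbb{R}^N)} + \|u_1\|_{1,1}$.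
   Context: Fourier transform: $\hat f(\xi)=\mathcal F(f)(\xi)=\int_{\mathbb{R}^N}e^{-ix\cdot\xi}f(x)\,dx$ for $f\in L^1(\mathbb{R}^N)$, extended to $L^2(\mathbb{R}^N)$ as usual; $\mathcal F^{-1}$ is its inverse (from the variable $\xi$ to $x$). Weighted space: $L^{1,1}(\mathbb{R}^N)=\{f\in L^1(\mathbb{R}^N):\|f\|_{1,1}:=\int_{\mathbb{R}^N}(1+|x|)|f(x)|\,dx<\infty\}$. The operator $L=\log(-\Delta+I):D(L)\subset L^2(\mathbb{R}^N)\to L^2(\mathbb{R}^N)$ has domain $D(L)=\{f\in L^2(\mathbb{R}^N):\int_{\mathbb{R}^N}\log^2(1+|\xi|^2)|\hat f(\xi)|^2d\xi<\infty\}$ and is defined by $\widehat{Lf}(\xi)=\log(1+|\xi|^2)\hat f(\xi)$. The solution of the Cauchy problem is the unique mild solution $u\in C([0,\infty);D(L))\cap C^1([0,\infty);L^2(\mathbb{R}^N))$; equivalently, its spatial Fourier transform $\hat u(\xi,t)$ solves, for a.e. $\xi\in\mathbb{R}^N$, the ODE $\partial_t^2\hat u+\frac14\log^2(1+|\xi|^2)\hat u+\frac{\pi^2}{4}\hat u+\log(1+|\xi|^2)\partial_t\hat u=0$ for $t>0$, with $\hat u(\xi,0)=0$, $\partial_t\hat u(\xi,0)=\hat u_1(\xi)$. *)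

(* Defs.v *)
From HB Require Import structures.
From mathcomp Require Import all_boot all_order all_algebra.
From mathcomp Require Import all_classical all_reals all_analysis.
From mathcomp Require Import complex.

Set Implicit Arguments.
Unset Strict Implicit.
Unset Printing Implicit Defensive.

Import Order.TTheory GRing.Theory Num.Theory.
Import ComplexField.Normc.
Import numFieldNormedType.Exports.

Local Open Scope classical_set_scope.
Local Open Scope ring_scope.
Local Open Scope complex_scope.

Notation Rn R n := (n.-tuple (measurableTypeR R)).

Section lebesgue_Rn.
Context (R : realType).

Definition rn_cons n (p : measurableTypeR R * Rn R n) : Rn R n.+1 :=
  [tuple of p.1 :: p.2].

Lemma measurable_rn_cons n : measurable_fun [set: _] (@rn_cons n).
Proof. exact: (measurable_cons (f := fst) (g := snd)). Qed.

Section step.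
Context (n : nat) (mu : {sigma_finite_measure set (Rn R n) -> \bar R}).

Definition cons_measure : set (Rn R n.+1) -> \bar R :=
  pushforward (@lebesgue_measure R \x mu)%E (@rn_cons n).

Let cm0 : cons_measure set0 = 0%E.
Proof. by rewrite /cons_measure /pushforward preimage_set0 measure0. Qed.

Let cm_ge0 A : (0 <= cons_measure A)%E.
Proof. by rewrite /cons_measure /pushforward measure_ge0. Qed.

Let cm_sigma_additive : semi_sigma_additive cons_measure.
Proof.
move=> F mF tF mUF; rewrite /cons_measure /pushforward preimage_bigcup.
apply: measure_semi_sigma_additive.
- by move=> k; rewrite -[X in measurable X]setTI; exact: measurable_rn_cons.
- apply/trivIsetP => /= i j _ _ ij; rewrite -preimage_setI.
  by move/trivIsetP : tF => /(_ _ _ _ _ ij) ->//; rewrite preimage_set0.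
- rewrite -preimage_bigcup -[X in measurable X]setTI.
  exact: measurable_rn_cons.
Qed.

HB.instance Definition _ := isMeasure.Build _ _ _ cons_measure
  cm0 cm_ge0 cm_sigma_additive.

Let cm_sigma_finite : sigma_finite [set: Rn R n.+1] cons_measure.
Proof.
have /sigma_finiteP[F [TF ndF Foo]] := sigma_finiteT (@lebesgue_measure R).
have /sigma_finiteP[G [TG ndG Goo]] := sigma_finiteT mu.
pose uncons (x : Rn R n.+1) : measurableTypeR R * Rn R n :=
  (tnth x ord0, [tuple of behead x]).
have unconsK : cancel (@rn_cons n) uncons.
  by move=> [a x]; congr pair => //; apply: val_inj.
have muncons : measurable_fun [set: _] uncons.
  apply/measurable_fun_pairP; split; first exact: measurable_tnth.
  exact: measurable_behead.
exists (fun k => uncons @^-1` (F k `*` G k)).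
  rewrite -preimage_bigcup (_ : \bigcup_k _ = setT) ?preimage_setT//.
  rewrite -setXTT TF TG predeqE => -[x y]; split; last first.
    by move=> [/= [k _ Fkx] [l _ Gly]]; exists (maxn k l) => //; split;
      [move: x Fkx; exact/subsetPset/ndF/leq_maxl
      |move: y Gly; exact/subsetPset/ndG/leq_maxr].
  by move=> [k _ []/= ? ?]; split; exists k.
move=> k; have [mF Fk] := Foo k; have [mG Gk] := Goo k; split.
  by rewrite -[X in measurable X]setTI; apply: muncons => //; exact: measurableX.
rewrite /cons_measure /pushforward -comp_preimage.
rewrite (_ : uncons \o _ = id) ?preimage_id//.
  by rewrite product_measure1E// lte_mul_pinfty// ge0_fin_numE.
by apply/funext => p /=; rewrite unconsK.
Qed.

HB.instance Definition _ :=
  Measure_isSigmaFinite.Build _ _ _ cons_measure cm_sigma_finite.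

End step.

Fixpoint leb n : {sigma_finite_measure set (Rn R n) -> \bar R} :=
  match n with
  | 0 => @dirac _ (Rn R 0) [tuple] R
  | m.+1 => @cons_measure m (leb m)
  end.

Lemma leb_box n (A : 'I_n -> set (measurableTypeR R)) :
  (forall i, measurable (A i)) ->
  leb n [set x | forall i, A i (tnth x i)] =
  (\prod_(i < n) lebesgue_measure (A i))%E.
Proof.
elim: n A => [|n IHn] A mA.
  by rewrite big_ord0 /= diracE mem_set// => -[].
rewrite big_ord_recl -IHn//= /cons_measure /pushforward.
set B := [set x : Rn R n | _].
have mB : measurable B.
  rewrite (_ : B = \bigcap_(i in [set: 'I_n])
      ((@tnth _ _)^~ i @^-1` A (lift ord0 i))); last first.
    by apply/seteqP; split => x /= Bx i; [move=> _|]; exact: Bx.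
  apply: fin_bigcap_measurable => // i _; rewrite -[X in measurable X]setTI.
  exact: measurable_tnth.
rewrite -product_measure1E//; congr ((_ \x _)%E _).
apply/seteqP; split => -[a x] /=.
  by move=> h; split => [|i]; [exact: (h ord0)|rewrite -(tnthS a); exact: h].
move=> [Aa Bx] i; case: (unliftP ord0 i) => [j|] ->//.
by rewrite tnthS; exact: Bx.
Qed.

End lebesgue_Rn.

Section L2_theory.
Context (R : realType) (N : nat).
Notation V := (Rn R N).
Notation mu := (leb R N).
Implicit Types (f g : V -> R[i]) (x xi : V).

Definition dotp x xi : R := \sum_(i < N) (tnth x i : R) * (tnth xi i : R).

Definition enorm x : R := Num.sqrt (dotp x x).

Definition cmeasurable f :=
  measurable_fun [set: V] (fun x => complex.Re (f x)) /\
  measurable_fun [set: V] (fun x => complex.Im (f x)).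

Definition cintegral f : R[i] :=
  (\int[mu]_x complex.Re (f x)) +i* (\int[mu]_x complex.Im (f x)).

Definition L1norm f : \bar R := 'N[mu]_1[(fun x => (normc (f x))%:E)]%E.

Definition L2norm f : \bar R := 'N[mu]_2%:E[(fun x => (normc (f x))%:E)]%E.

Definition L11norm f : \bar R :=
  (\int[mu]_x ((1 + enorm x) * normc (f x))%:E)%E.

Definition inL1 f := cmeasurable f /\ (L1norm f < +oo)%E.

Definition inL2 f := cmeasurable f /\ (L2norm f < +oo)%E.

Definition inL11 f := inL1 f /\ (L11norm f < +oo)%E.

Definition fourierL1 f : V -> R[i] :=
  fun xi => cintegral (fun x => (cos (dotp x xi) -i* sin (dotp x xi)) * f x).

(* [g] is the value at [f] of the continuous extension to L^2 of [fourierL1]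
   restricted to the dense subspace L^1 `&` L^2. *)
Definition is_fourierL2 f g :=
  [/\ inL2 f, inL2 g & exists h : nat -> V -> R[i],
    [/\ forall k, inL1 (h k) /\ inL2 (h k),
        L2norm (h k \- f) @[k --> \oo] --> 0%E &
        L2norm (fourierL1 (h k) \- g) @[k --> \oo] --> 0%E]].

(* By Plancherel's theorem, both are representatives of uniquely determined
   classes of L^2 when their argument is in L^2; the default value [cst 0]
   is only used outside L^2. *)
Definition fourier f : V -> R[i] := xget (cst 0) [set g | is_fourierL2 f g].

Definition fourier_inv g : V -> R[i] := xget (cst 0) [set f | is_fourierL2 f g].

Definition Lsymbol xi : R := ln (1 + enorm xi ^+ 2).

Definition inDL f :=
  inL2 f /\
  (\int[mu]_xi (Lsymbol xi ^+ 2 * normc (fourier f xi) ^+ 2)%:E < +oo)%E.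

Definition opL f : V -> R[i] :=
  fourier_inv (fun xi => (Lsymbol xi)%:C * fourier f xi).

Definition DLnorm f : \bar R := (L2norm f + L2norm (opL f))%E.

End L2_theory.

Section halfline.
Context (R : realType) (V : lmodType R[i]) (nrm : V -> \bar R).
Implicit Types (f : R -> V) (t : R).

(* One-sided at t = 0, and independent of the values at negative times. *)
Definition continuous_halfline f := forall t, 0 <= t ->
  nrm (f s - f t) @[s --> within [set s | 0 <= s] (nbhs t)] --> 0%E.

Definition has_deriv_halfline f t (d : V) :=
  nrm ((s - t)^-1%:C *: (f s - f t) - d)
    @[s --> within [set s | 0 <= s] t^'] --> 0%E.

End halfline.

Section cauchy_problem.
Context (R : realType) (N : nat).
Notation V := (Rn R N).
Notation F := (V -> R[i]^o).

Definition C0_DL (u : R -> F) :=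
  (forall t, 0 <= t -> inDL (u t)) /\
  continuous_halfline (@DLnorm R N) u.

Definition C1_L2 (u : R -> F) := exists u' : R -> F,
  [/\ forall t, 0 <= t -> inL2 (u t) /\ inL2 (u' t),
      forall t, 0 <= t -> has_deriv_halfline (@L2norm R N) u t (u' t) &
      continuous_halfline (@L2norm R N) u'].

Definition ode_solution (a : R) (y0 y1 : R[i]) (y : R -> R[i]) :=
  let nrm (z : R[i]^o) := (normc z)%:E in
  exists y' y'' : R -> R[i],
  [/\ y 0 = y0, y' 0 = y1,
      forall t : R, 0 <= t -> has_deriv_halfline nrm y t (y' t) &
      forall t : R, 0 < t -> has_deriv_halfline nrm y' t (y'' t) /\
        y'' t + (4^-1 * a ^+ 2)%:C * y t + (pi ^+ 2 / 4)%:C * y t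
          + a%:C * y' t = 0].

(* Each [fourier (u t)] is only determined up to a null set that may depend on
   [t]: [v] is the choice of representatives for which the equation can be
   read at fixed frequency. *)
Definition is_solution (u0 u1 : F) (u : R -> F) :=
  [/\ C0_DL u, C1_L2 u & exists v : R -> F,
    (forall t, 0 <= t ->
      {ae leb R N, forall xi, v t xi = fourier (u t) xi}) /\
    {ae leb R N, forall xi,
      ode_solution (Lsymbol xi) (fourier u0 xi) (fourier u1 xi) (v ^~ xi)}].

Definition profile (t : R) : F := fun xi =>
  (4 * (1 + enorm xi ^+ 2) `^ (- (t / 2)) / pi
     * sin (t * Num.sqrt (ln (1 + enorm xi ^+ 2))))%:C.

End cauchy_problem.

(* Main.v *)
(** On the Fourier side the equation is a damped oscillator at each frequency:
    with a = log(1+|xi|^2) its solution is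
      (2/pi) e^(-a t/2) sin(pi t/2) u1^(xi),
    and |u1^| is bounded by a multiple of the L^1 norm m of u1.  The subtracted
    profile is bounded by the same weight e^(-a t/2) = (1+|xi|^2)^(-t/2), and
    e^(-a t) <= prod_i (1 + t xi_i^2 / N)^(-1), whose integral is
    (pi sqrt(N/t))^N.  By Plancherel both terms are separately of size
    O(m t^(-N/4)) in L^2, and the extra factor t^(-1/2) absorbs the constants
    once t is large.

    Plancherel's formula on the line is Abel summation: integrating |f^|^2
    against e^(-e|xi|) gives the double integral of f(x) conj f(y) against the
    Poisson kernel, which differs from 2 pi |f|_2^2 by half the double integral
    of |f(x)-f(y)|^2 against that kernel.  The latter tends to 0 with e for
    indicators of open sets, hence for simple functions and for L^2.  Fubini
    then gives the formula on R^N, and an L^2 limit gives the transform on L^2. *)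
From HB Require Import structures.
Require Import Defs.
From mathcomp Require Import all_boot all_order all_algebra.
From mathcomp Require Import all_classical all_reals all_analysis.
From mathcomp Require Import measurable_realfun complex ring lra.

Set Implicit Arguments.
Unset Strict Implicit.
Unset Printing Implicit Defensive.

Import Order.TTheory GRing.Theory Num.Theory.
Import numFieldNormedType.Exports.
Import ComplexField.Normc.
Local Open Scope classical_set_scope.
Local Open Scope ring_scope.
Local Open Scope complex_scope.

(** * Abel and Poisson kernels *)

(** Integrals are real, so a complex function is carried as a pair of real ones. Plancherel's
    formula is stated for such pairs and for an abstract phase, which lets it pass to products and
    to image measures, hence to [Rn] by induction on the dimension. The defect on the line comes
    from the polarisation a(x)^2 + a(y)^2 = 2 a(x) a(y) + (a(x) - a(y))^2. It is quadratic in a and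
    at most 8 pi |a|^2 for every e, so that its vanishing is a closed property in L^2 and can be
    tested on indicators. Norms are handled through their squares, with (a + b)^2 <= 2 a^2 + 2 b^2
    as triangle inequality. The transform on L^2 thus gets bounds with lossy constants, and each
    loss goes into a number K depending only on N. The threshold is N + K: the summand N makes the
    exponent t / N at least 1 in Bernoulli's inequality, and K pays for the constants. [fourier_inv]
    is a choice with default 0. Its bound is proved by cases: a genuine preimage obeys Plancherel,
    and 0 obeys any bound. *)

Lemma fin_addeI (R : realType) (x a b : \bar R) :
  x \is a fin_num -> (x + a = x + b)%E -> a = b.
Proof.
move=> xfin xab; apply/le_anti.
by rewrite -(leeD2lE _ _ xfin) xab lexx -(leeD2lE _ _ xfin) xab lexx.
Qed.

Section abel_kernel.
Context {R : realType}.
Local Notation mu := (@lebesgue_measure R).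
Implicit Types (e z x y : R).

(** The fundamental theorem of calculus is applied on half-lines, so integrals over the line are
    folded at 0. *)
Lemma ge0_integralT_reflect (f : R -> R) :
  measurable_fun [set: R] f -> (forall x, 0 <= f x) ->
  (\int[mu]_x (f x)%:E = \int[mu]_(x in `[0%R, +oo[) (f x)%:E
                       + \int[mu]_(x in `[0%R, +oo[) (f (- x)%R)%:E)%E.
Proof.
move=> mf f0.
have mfN : measurable_fun [set: R] (fun x : R => f (- x)).
  by apply: measurableT_comp => //; exact: oppr_measurable.
rewrite (@ge0_integration_by_substitution0 _ (fun x => (f (- x)%R)%:E)); last 2 first.
- exact/measurable_EFinP.
- by move=> r; rewrite lee_fin.
under [X in (_ + X)%E]eq_integral do rewrite opprK.
rewrite addeC -[X in (X + _)%E]integral_itv_bndo_bndc; last first.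
  exact/measurable_EFinP/measurable_funTS.
rewrite -ge0_integral_setU//=; last 3 first.
- exact/measurable_EFinP/measurable_funTS.
- by move=> x _; rewrite lee_fin.
- apply/disj_setPS => x /= []; rewrite !in_itv/= andbT => x0.
  by rewrite leNgt x0.
by rewrite -setCitvr setUC setUv.
Qed.

Lemma is_derive_continuous (f F : R -> R) :
  (forall x : R, is_derive x 1 F (f x)) -> continuous F.
Proof.
move=> dF x; apply: differentiable_continuous.
by apply/derivable1_diffP; case: (dF x).
Qed.

(** The limit of F at -oo is written through F(-x), so that both halves are treated at +oo. *)
Lemma ge0_integralT_FTC (f F : R -> R) (l1 l2 : R) :
  (forall x, 0 <= f x) -> continuous f ->
  (forall x : R, is_derive x 1 F (f x)) ->
  F x @[x --> +oo] --> l1 -> F (- x) @[x --> +oo] --> l2 ->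
  (\int[mu]_x (f x)%:E = (l1 - l2)%:E)%E.
Proof.
move=> f0 cf dF Fl1 Fl2.
have cF := is_derive_continuous dF.
rewrite ge0_integralT_reflect//; last exact: continuous_measurable_fun.
rewrite (@ge0_continuous_FTC2y _ f F 0 l1)//; last 3 first.
- exact: continuous_subspaceT.
- exact/cvg_at_right_filter/cF.
- by move=> x _; rewrite derive1E; case: (dF x).
have dG x : is_derive x 1 (fun x => - F (- x)) (f (- x)).
  have dFN : is_derive (- x) 1 F (f (- x)) by [].
  have := is_deriveN (@is_derive1_comp _ F -%R x _ _ dFN _).
  by move=> /(_ _ _); rewrite mulrN1 opprK; apply.
rewrite (@ge0_continuous_FTC2y _ (f \o -%R) (fun x => - F (- x)) 0 (- l2)).
- by rewrite oppr0 -!EFinB -EFinD; congr EFin; ring.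
- by move=> x _ /=.
- apply: continuous_subspaceT => x; apply: continuous_comp; [exact: opp_continuous|exact: cf].
- exact: cvgN.
- by move=> x _; case: (dG x).
- apply: cvg_at_right_filter; apply: cvgN.
  by apply: continuous_comp; [exact: opp_continuous|exact: cF].
- by move=> x _; rewrite derive1E; case: (dG x).
Qed.

Definition abel (e x : R) : R := expR (- (e * `|x|)).

(** The Fourier transform of [abel e] ([integral_abel_cos]); its mass is 2 pi ([integral_poisson])
    and concentrates at the origin as e tends to 0. *)
Definition poisson (e z : R) : R := 2 * e / (e ^+ 2 + z ^+ 2).

Lemma abel_ge0 e x : 0 <= abel e x. Proof. exact: expR_ge0. Qed.

Lemma abel_continuous e : continuous (abel e).
Proof.
move=> x; apply: continuous_comp; last exact: continuous_expR.
apply: cvgN; apply: cvgM; [exact: cvg_cst|exact: norm_continuous].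
Qed.

Lemma poisson_ge0 e z : 0 <= e -> 0 <= poisson e z.
Proof. by move=> e0; rewrite divr_ge0 ?mulr_ge0 ?addr_ge0 ?sqr_ge0. Qed.

Lemma poissonN e z : poisson e (- z) = poisson e z.
Proof. by rewrite /poisson sqrrN. Qed.

Lemma poisson_continuous e : 0 < e -> continuous (poisson e).
Proof.
move=> e0 z; apply: cvgM; first exact: cvg_cst.
apply: cvgV; first by rewrite gt_eqF// ltr_wpDr ?sqr_ge0 ?exprn_gt0.
by apply: cvgD; [exact: cvg_cst|exact: exprn_continuous].
Qed.

Lemma cvgy_affine x e : 0 < e -> (y - x) / e @[y --> +oo] --> +oo.
Proof.
move=> e0; apply/cvgryPge => A; near=> y.
rewrite ler_pdivlMr// lerBrDr; near: y.
by apply: nbhs_pinfty_ge; exact: num_real.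
Unshelve. all: by end_near. Qed.

(** The primitive 2 atan((y - x) / e) increases from -pi to pi. *)
Lemma integral_poisson e x : 0 < e ->
  (\int[mu]_y (poisson e (x - y))%:E = (2 * pi)%:E)%E.
Proof.
move=> e0.
have atany z : 2 * atan ((y - z) / e) @[y --> +oo] --> pi.
  rewrite [X in _ --> X](_ : _ = 2 * (pi / 2)); last by field.
  by apply: cvgMr; apply: cvg_comp (cvgy_affine _ e0) (@cvgy_atan R).
have datan y : is_derive y 1 (fun y => 2 * atan ((y - x) / e)) (poisson e (x - y)).
  have daff : is_derive y 1 (fun y => (y - x) / e) e^-1.
    by apply: is_derive_eq; rewrite /GRing.scale /=; ring.
  have := @is_derive1_comp _ atan (fun y => (y - x) / e) y _ _ (is_derive1_atan _) daff.
  move=> h; apply: (is_derive_eq (is_deriveZ _ h)).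
  rewrite /poisson /GRing.scale /=; field.
  by rewrite !gt_eqF// ltr_pwDl ?sqr_ge0 ?exprn_gt0.
rewrite (ge0_integralT_FTC _ _ datan (atany x) (l2 := - pi)).
- by congr EFin; ring.
- by move=> y; rewrite poisson_ge0// ltW.
- move=> y; apply: (@continuous_comp _ _ _ (fun y => x - y) (poisson e)).
    by apply: cvgB; [exact: cvg_cst|].
  exact: poisson_continuous.
(* Since atan is odd, the limit at -oo is the one at +oo for the reflected centre -x. *)
- under eq_fun do rewrite -opprD mulNr atanN mulrN.
  by apply: cvgN; have := atany (- x); under eq_fun do rewrite opprK.
Qed.

(* The improper integral of [abel * cos] is obtained from the nonnegative
   integrand [abel * (1 + cos)], for which the fundamental theorem of calculus
   on a half-line applies. *)
Lemma integral_abel_cosD1 e z : 0 < e ->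
  (\int[mu]_(x in `[0%R, +oo[) (expR (- (e * x)) * (1 + cos (z * x)))%:E =
   (e^-1 + e / (e ^+ 2 + z ^+ 2))%:E)%E.
Proof.
move=> e0; have den0 : e ^+ 2 + z ^+ 2 != 0.
  by rewrite gt_eqF// ltr_wpDr ?sqr_ge0 ?exprn_gt0.
(* The constant of integration is the one for which F tends to 0 at infinity; the integral is then
   -F(0). *)
pose F x := expR (- (e * x)) * ((z * sin (z * x) - e * cos (z * x)) / (e ^+ 2 + z ^+ 2) - e^-1).
have dF x : is_derive x 1 F (expR (- (e * x)) * (1 + cos (z * x))).
  have dE : is_derive x 1 (fun x => expR (- (e * x))) (- e * expR (- (e * x))).
    have daff : is_derive x 1 (fun x => - (e * x)) (- e).
      by apply: is_derive_eq; rewrite /GRing.scale /=; ring.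
    by apply: is_derive_eq (@is_derive1_comp _ expR _ x _ _ (is_derive_expR _) daff) _; rewrite mulrC.
  have dlin : is_derive x 1 (fun x => z * x) z.
    by apply: is_derive_eq; rewrite /GRing.scale /= mulr1.
  have dS : is_derive x 1 (fun x => sin (z * x)) (z * cos (z * x)).
    by apply: is_derive_eq (@is_derive1_comp _ sin _ x _ _ (is_derive_sin _) dlin) _; rewrite mulrC.
  have dC : is_derive x 1 (fun x => cos (z * x)) (- z * sin (z * x)).
    by apply: is_derive_eq (@is_derive1_comp _ cos _ x _ _ (is_derive_cos _) dlin) _; ring.
  apply: is_derive_eq.
  by rewrite /GRing.scale /=; field; rewrite den0 gt_eqF.
have cF := is_derive_continuous dF.
rewrite (@ge0_continuous_FTC2y _ _ F 0 0).
- congr EFin; rewrite /F !mulr0 oppr0 expR0 cos0 sin0; field.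
  by rewrite den0 gt_eqF.
- by move=> x _; rewrite mulr_ge0 ?expR_ge0// -lerBlDl sub0r cos_geN1.
- apply: continuous_subspaceT => x; apply: cvgM.
    apply: (@continuous_comp _ _ _ (fun x => - (e * x)) expR); last exact: continuous_expR.
    by apply: cvgN; apply: cvgMr.
  apply: cvgD; first exact: cvg_cst.
  by apply: (@continuous_comp _ _ _ (fun x => z * x) cos); [exact: cvgMr|exact: continuous_cos].
- pose C := (`|z| + e) / (e ^+ 2 + z ^+ 2) + e^-1.
  have C0 : 0 <= C by rewrite addr_ge0 ?divr_ge0 ?addr_ge0 ?sqr_ge0 ?invr_ge0 ?normr_ge0// ltW.
  have FC x : `|F x| <= expR (- (e * x)) * C.
    rewrite /F normrM gtr0_norm ?expR_gt0// ler_wpM2l ?expR_ge0//.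
    rewrite (le_trans (ler_normB _ _))// lerD//; last by rewrite gtr0_norm ?invr_gt0.
    rewrite normrM ler_pM//; last by rewrite ger0_norm// invr_ge0 addr_ge0 ?sqr_ge0.
    rewrite (le_trans (ler_normB _ _))// lerD// normrM ?(gtr0_norm e0).
      by rewrite ler_piMr// ler_norml sin_geN1 sin_le1.
    by rewrite ler_piMr ?(ltW e0)// ler_norml cos_geN1 cos_le1.
  have e_cvg : expR (- (e * x)) * C @[x --> +oo] --> 0.
    rewrite -[X in _ --> X](mul0r C); apply: cvgMl.
    apply: (@cvg_comp _ _ _ (fun x => e * x) (fun x => expR (- x))); last exact: cvgr_expR.
    by apply: gt0_cvgMry.
  apply/norm_cvg0P; apply: (squeeze_cvgr _ (cvg_cst 0) e_cvg).
  by near=> x; rewrite normr_ge0 FC.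
- by move=> x _; case: (dF x).
- exact/cvg_at_right_filter/cF.
- by move=> x _; rewrite derive1E; case: (dF x).
Unshelve. all: by end_near. Qed.

(** The case z = 0 of the previous formula, where 1 + cos is the constant 2. *)
Lemma integral_abel_half e : 0 < e ->
  (\int[mu]_(x in `[0%R, +oo[) (expR (- (e * x)))%:E = (e^-1)%:E)%E.
Proof.
move=> e0; have := integral_abel_cosD1 0 e0.
under eq_integral do rewrite mul0r cos0 mulrC EFinM.
rewrite ge0_integralZl//; last first.
- apply/measurable_EFinP/measurable_funTS; apply: continuous_measurable_fun.
  move=> x; apply: (@continuous_comp _ _ _ (fun x => - (e * x)) expR); last exact: continuous_expR.
  by apply: cvgN; apply: cvgMr.
rewrite (_ : e^-1 + _ = 2 * e^-1); last by field; rewrite gt_eqF.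
move=> /(congr1 (fun y : \bar R => (2^-1 : R)%:E * y)%E); rewrite EFinM !muleA -!EFinM.
have -> : 2^-1 * (1 + 1) = 1 :> R by rewrite mulVf.
by rewrite mul1e mul1r.
Qed.

Lemma measurable_abel e : measurable_fun [set: R] (abel e).
Proof. exact: continuous_measurable_fun (@abel_continuous e). Qed.

Lemma integral_abel e : 0 < e -> (\int[mu]_x (abel e x)%:E = (2 / e)%:E)%E.
Proof.
move=> e0; rewrite ge0_integralT_reflect; last 2 first.
- exact: measurable_abel.
- exact: abel_ge0.
under [X in (_ + X)%E]eq_integral do rewrite /abel normrN.
have -> : (\int[mu]_(x in `[0%R, +oo[) (abel e x)%:E = (e^-1)%:E)%E.
  rewrite -integral_abel_half//; apply: eq_integral => x.
  by rewrite inE/= in_itv/= andbT => x0; rewrite /abel ger0_norm.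
by rewrite -EFinD; congr EFin; ring.
Qed.

Lemma integrable_abel e : 0 < e -> mu.-integrable [set: R] (EFin \o abel e).
Proof.
move=> e0; apply/integrableP; split.
  by apply/measurable_EFinP; exact: measurable_abel.
under eq_integral do rewrite /= ger0_norm ?abel_ge0//.
by rewrite integral_abel// ltry.
Qed.

Lemma integrable_abelM e (f : R -> R) : 0 < e -> measurable_fun [set: R] f ->
  (forall x, `|f x| <= 1) ->
  mu.-integrable [set: R] (fun x => (abel e x * f x)%:E).
Proof.
move=> e0 mf f1; apply: le_integrable (integrable_abel e0) => //.
  by apply/measurable_EFinP/measurable_funM => //; exact: measurable_abel.
by move=> x _ /=; rewrite lee_fin normrM ler_piMr.
Qed.

Lemma measurable_cosM z : measurable_fun [set: R] (fun x => cos (z * x)).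
Proof.
apply: continuous_measurable_fun => x.
by apply: (@continuous_comp _ _ _ (fun x => z * x) cos); [exact: cvgMr|exact: continuous_cos].
Qed.

Lemma measurable_sinM z : measurable_fun [set: R] (fun x => sin (z * x)).
Proof.
apply: continuous_measurable_fun => x.
by apply: (@continuous_comp _ _ _ (fun x => z * x) sin); [exact: cvgMr|exact: continuous_sin].
Qed.

Lemma norm_cos_le1 x : `|cos x| <= 1. Proof. by rewrite ler_norml cos_geN1 cos_le1. Qed.

Lemma norm_sin_le1 x : `|sin x| <= 1. Proof. by rewrite ler_norml sin_geN1 sin_le1. Qed.

(** Subtract the finite integral of the weight from that of the weight times 1 + cos. *)
Lemma integral_abel_cos e z : 0 < e ->
  (\int[mu]_x (abel e x * cos (z * x))%:E = (poisson e z)%:E)%E.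
Proof.
move=> e0; have den0 : e ^+ 2 + z ^+ 2 != 0.
  by rewrite gt_eqF// ltr_wpDr ?sqr_ge0 ?exprn_gt0.
have i1 : (\int[mu]_x (abel e x * (1 + cos (z * x)))%:E = (2 / e + poisson e z)%:E)%E.
  rewrite ge0_integralT_reflect; last 2 first.
  - apply: measurable_funM; first exact: measurable_abel.
    by apply: measurable_funD => //; exact: measurable_cosM.
  - by move=> x; rewrite mulr_ge0 ?abel_ge0// -lerBlDl sub0r cos_geN1.
  under [X in (_ + X)%E]eq_integral do rewrite /abel normrN mulrN cosN.
  have -> : (\int[mu]_(x in `[0%R, +oo[) (abel e x * (1 + cos (z * x)))%:E =
      (e^-1 + e / (e ^+ 2 + z ^+ 2))%:E)%E.
    rewrite -(integral_abel_cosD1 z e0); apply: eq_integral => x.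
    by rewrite inE/= in_itv/= andbT => x0; rewrite /abel ger0_norm.
  by rewrite -EFinD /poisson; congr EFin; field; rewrite den0 gt_eqF.
have icos := integrable_abelM e0 (measurable_cosM z) (fun x => norm_cos_le1 _).
move: i1; under eq_integral do rewrite mulrDr mulr1 EFinD.
rewrite integralD//; last exact: integrable_abel.
by rewrite integral_abel// EFinD => /fin_addeI; exact.
Qed.

(** Oddness in a nonnegative form: folding at 0 pairs 1 + sin with 1 - sin, so [abel * (1 + sin)]
    has the same integral as [abel]. *)
Lemma integral_abel_sin e z : 0 < e ->
  (\int[mu]_x (abel e x * sin (z * x))%:E = 0)%E.
Proof.
move=> e0.
have msin := measurable_sinM z; have mabel := measurable_abel e.
have sin0 x : 0 <= 1 + sin (z * x) by rewrite -lerBlDl sub0r sin_geN1.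
have sin1 x : 0 <= 1 - sin (z * x) by rewrite subr_ge0 sin_le1.
have i1 : (\int[mu]_x (abel e x * (1 + sin (z * x)))%:E = (2 / e)%:E)%E.
  rewrite ge0_integralT_reflect; last 2 first.
  - by apply: measurable_funM => //; exact: measurable_funD.
  - by move=> x; rewrite mulr_ge0 ?abel_ge0.
  under [X in (_ + X)%E]eq_integral do rewrite /abel normrN mulrN sinN.
  rewrite -ge0_integralD//; last 3 first.
  - by move=> x _; rewrite lee_fin mulr_ge0// abel_ge0.
  - by apply/measurable_EFinP/measurable_funTS/measurable_funM => //; exact: measurable_funD.
  - by apply/measurable_EFinP/measurable_funTS/measurable_funM => //; exact: measurable_funB.
  rewrite -integral_abel// ge0_integralT_reflect//; last exact: abel_ge0.
  under [X in (_ + X)%E]eq_integral do rewrite /abel normrN.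
  rewrite -ge0_integralD//; last 3 first.
  - by move=> x _; rewrite lee_fin abel_ge0.
  - exact/measurable_EFinP/measurable_funTS.
  - exact/measurable_EFinP/measurable_funTS.
  by apply: eq_integral => x _; rewrite -!EFinD /abel; congr EFin; ring.
have isin := integrable_abelM e0 msin (fun x => norm_sin_le1 _).
move: i1; under eq_integral do rewrite mulrDr mulr1 EFinD.
rewrite integralD//; last exact: integrable_abel.
by rewrite integral_abel// -[X in _ = X -> _]adde0 => /fin_addeI; exact.
Qed.
End abel_kernel.

(** * Oscillatory integrals and Abel summation *)

Section integral_extras.
Context {R : realType}.

Lemma EFin_Rintegral d (T : measurableType d) (mu : {measure set T -> \bar R}) (f : T -> R) :
  mu.-integrable [set: T] (EFin \o f) ->
  ((\int[mu]_x f x)%:E = \int[mu]_x (f x)%:E)%E.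
Proof. by move=> intf; rewrite /Rintegral fineK// integrable_fin_num. Qed.

(** The integrals of the positive and negative parts are measurable by Tonelli; their difference is
    passed through [fine], which also gives a value where a slice is not integrable. *)
Lemma measurable_Rintegral d1 d2 (S : measurableType d1) (T : measurableType d2)
    (mu : {sigma_finite_measure set T -> \bar R}) (phi : S * T -> R) :
  measurable_fun [set: S * T] phi ->
  measurable_fun [set: S] (fun s => \int[mu]_x phi (s, x)).
Proof.
move=> mphi; apply: (measurableT_comp (fine_measurable measurableT)).
have mE : measurable_fun [set: S * T] (EFin \o phi) by exact/measurable_EFinP.
rewrite [X in measurable_fun _ X](_ : _ = fubini_F mu (EFin \o phi)^\+%E \- fubini_F mu (EFin \o phi)^\-%E)%E.
  by apply: emeasurable_funB; apply: measurable_fun_fubini_tonelli_F => //;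
    [exact: measurable_funepos|exact: measurable_funeneg].
apply/funext => s; rewrite integralE /fubini_F.
by congr (_ - _)%E; apply: eq_integral => x _; rewrite ?funeposE ?funenegE.
Qed.

Section tensor.
Context d1 d2 (T1 : measurableType d1) (T2 : measurableType d2).
Variables (m1 : {sigma_finite_measure set T1 -> \bar R}) (m2 : {sigma_finite_measure set T2 -> \bar R}).
Variables (u : T1 -> R) (v : T2 -> R).
Hypotheses (iu : m1.-integrable [set: T1] (EFin \o u)) (iv : m2.-integrable [set: T2] (EFin \o v)).

Lemma integrable_tensor :
  (m1 \x m2)%E.-integrable [set: T1 * T2] (fun p => (u p.1 * v p.2)%:E).
Proof.
have /measurable_int/measurable_EFinP mu := iu.
have /measurable_int/measurable_EFinP mv := iv.
apply/integrable12ltyP.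
  apply/measurable_EFinP; apply: measurable_funM; exact: measurableT_comp.
under eq_integral.
  move=> x _; under eq_integral do rewrite /= normrM EFinM.
  rewrite ge0_integralZl//; last by apply/measurable_EFinP; exact: measurableT_comp.
  over.
have /integrableP[_ iv'] := iv; have /integrableP[_ iu'] := iu.
rewrite ge0_integralZr//; last 2 first.
- by apply/measurable_EFinP; exact: measurableT_comp.
- exact: integral_ge0.
by rewrite lte_mul_pinfty ?integral_ge0// ge0_fin_numE ?integral_ge0.
Qed.

Lemma integral_tensor :
  (\int[m1 \x m2]_p (u p.1 * v p.2)%:E = ((\int[m1]_x u x)%R * (\int[m2]_x v x)%R)%:E)%E.
Proof.
rewrite -integral12_prod_meas1; last exact: integrable_tensor.
rewrite /fubini_F /=.
under eq_integral.
  move=> x _; under eq_integral do rewrite EFinM.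
  rewrite integralZl// -EFin_Rintegral//; over.
by rewrite integralZr// -EFin_Rintegral// -EFinM.
Qed.

End tensor.

End integral_extras.

Section product_sigma_finite.
Context {R : realType} d1 d2 (T1 : measurableType d1) (T2 : measurableType d2).
Variables (m1 : {sigma_finite_measure set T1 -> \bar R}) (m2 : {sigma_finite_measure set T2 -> \bar R}).

Lemma sigma_finite_prod : sigma_finite [set: T1 * T2] (m1 \x m2)%E.
Proof.
have /sigma_finiteP[F [TF ndF Fy]] := sigma_finiteT m1.
have /sigma_finiteP[G [TG ndG Gy]] := sigma_finiteT m2.
exists (fun n => F n `*` G n) => [|n].
  apply/seteqP; split => // -[x y] _.
  have [k _ Fx] : (\bigcup_k F k) x by rewrite -TF.
  have [l _ Gy'] : (\bigcup_k G k) y by rewrite -TG.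
  exists (maxn k l) => //; split => /=.
  - by move: x Fx; exact/subsetPset/ndF/leq_maxl.
  - by move: y Gy'; exact/subsetPset/ndG/leq_maxr.
have [mF Fn] := Fy n; have [mG Gn] := Gy n; split; first exact: measurableX.
by rewrite product_measure1E// lte_mul_pinfty// ge0_fin_numE.
Qed.

(* An alias of the product measure whose sigma-finiteness can be inferred. *)
Definition prodm : set (T1 * T2) -> \bar R := (m1 \x m2)%E.

HB.instance Definition _ := Measure.on prodm.
HB.instance Definition _ := Measure_isSigmaFinite.Build _ _ _ prodm sigma_finite_prod.

End product_sigma_finite.

Lemma integrable_rot d (T : measurableType d) (R : realType) (mu : {measure set T -> \bar R})
    (f g phi : T -> R) : measurable_fun [set: T] phi ->
  mu.-integrable [set: T] (EFin \o f) -> mu.-integrable [set: T] (EFin \o g) ->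
  mu.-integrable [set: T] (fun x => (f x * cos (phi x) + g x * sin (phi x))%:E).
Proof.
move=> mphi intf intg.
apply: (@eq_integrable _ _ _ mu _ measurableT
  ((fun x => (f x * cos (phi x))%:E) \+ (fun x => (g x * sin (phi x))%:E))%E) => //.
have mcos : measurable_fun [set: T] (fun x => cos (phi x)).
  by apply: measurableT_comp => //; apply: continuous_measurable_fun; exact: continuous_cos.
have msin : measurable_fun [set: T] (fun x => sin (phi x)).
  by apply: measurableT_comp => //; apply: continuous_measurable_fun; exact: continuous_sin.
apply: integrableD => //.
- apply: le_integrable (intf) => //.
    by apply/measurable_EFinP/measurable_funM => //; apply/measurable_EFinP; case/integrableP: intf.
  by move=> x _ /=; rewrite lee_fin normrM ler_piMr// norm_cos_le1.
- apply: le_integrable (intg) => //.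
    by apply/measurable_EFinP/measurable_funM => //; apply/measurable_EFinP; case/integrableP: intg.
  by move=> x _ /=; rewrite lee_fin normrM ler_piMr// norm_sin_le1.
Qed.

(** * Oscillatory transforms for an abstract phase *)

Section phase_transform.
Context {R : realType} d (T : measurableType d).
Variables (mu : {sigma_finite_measure set T -> \bar R}) (theta : T -> T -> R).
Implicit Types (f g : T -> R) (xi : T).

(* For h = f + i g, the real part of the integral of [exp (- i theta) h] is
   [phase_int f g] and its imaginary part is [phase_int g (\- f)]. *)
Definition phase_int f g xi := \int[mu]_x (f x * cos (theta x xi) + g x * sin (theta x xi)).

(** The squared L^2 norm of f + i g, possibly infinite. *)
Definition sqint f g := (\int[mu]_x (f x ^+ 2 + g x ^+ 2)%:E)%E.

(** An equality of extended reals: it contains the finiteness of the norm of the transform. *)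
Definition plancherel (c : R) := forall f g,
  mu.-integrable [set: T] (EFin \o f) -> mu.-integrable [set: T] (EFin \o g) ->
  (sqint f g < +oo)%E ->
  sqint (phase_int f g) (phase_int g (\- f)) = (c%:E * sqint f g)%E.

Hypothesis mtheta : measurable_fun [set: T * T] (fun p => theta p.1 p.2).

Lemma measurable_theta xi : measurable_fun [set: T] (theta ^~ xi).
Proof.
exact: (@measurableT_comp _ _ _ _ _ _ (fun p : T * T => theta p.1 p.2) _
  (pair ^~ xi) mtheta (measurable_pair2 _)).
Qed.

Lemma integrable_phase f g xi :
  mu.-integrable [set: T] (EFin \o f) -> mu.-integrable [set: T] (EFin \o g) ->
  mu.-integrable [set: T] (fun x => (f x * cos (theta x xi) + g x * sin (theta x xi))%:E).
Proof. by move=> intf intg; apply: integrable_rot => //; exact: measurable_theta. Qed.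

Lemma measurable_phase_int f g : measurable_fun [set: T] f -> measurable_fun [set: T] g ->
  measurable_fun [set: T] (phase_int f g).
Proof.
move=> mf mg.
pose phi (p : T * T) := f p.2 * cos (theta p.2 p.1) + g p.2 * sin (theta p.2 p.1).
apply: (@measurable_Rintegral _ _ _ _ _ mu phi).
have mth : measurable_fun [set: T * T] (fun p => theta p.2 p.1).
  exact: (@measurableT_comp _ _ _ _ _ _ (fun p : T * T => theta p.1 p.2) _ unstable.swap mtheta (@measurable_swap _ _ _ _)).
apply: measurable_funD; apply: measurable_funM.
- exact: measurableT_comp.
- by apply: measurableT_comp mth => //; apply: continuous_measurable_fun; exact: continuous_cos.
- exact: measurableT_comp.
- by apply: measurableT_comp mth => //; apply: continuous_measurable_fun; exact: continuous_sin.
Qed.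

End phase_transform.

Section abel_identity.
Context {R : realType}.
Local Notation mu := (@lebesgue_measure R).
Local Notation theta := (fun x y : R => x * y).
Implicit Types (a b : R -> R) (e : R).

Lemma measurable_mul2 : measurable_fun [set: R * R] (fun p : R * R => p.1 * p.2).
Proof. by apply: measurable_funM. Qed.

Lemma integrable_absD a b :
  mu.-integrable [set: R] (EFin \o a) -> mu.-integrable [set: R] (EFin \o b) ->
  mu.-integrable [set: R] (fun x => (`|a x| + `|b x|)%:E).
Proof.
move=> inta intb; apply: (@eq_integrable _ _ _ mu _ measurableT
  ((abse \o (EFin \o a)) \+ (abse \o (EFin \o b)))%E) => //.
by apply: integrableD => //; exact: integrable_abse.
Qed.

(* Insert the two integral representations [phase_int] in the left-hand side
   and integrate first in the frequency: the even weight [abel] kills the sine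
   terms and turns the cosine terms into [poisson]. *)
Lemma integral_abel_phase a b e : 0 < e ->
  mu.-integrable [set: R] (EFin \o a) -> mu.-integrable [set: R] (EFin \o b) ->
  (prodm mu mu).-integrable [set: R * R]
    (fun p => ((a p.1 * a p.2 + b p.1 * b p.2) * poisson e (p.1 - p.2))%:E) /\
  (\int[mu]_xi (abel e xi * (phase_int mu theta a b xi ^+ 2
                             + phase_int mu theta b (\- a) xi ^+ 2))%:E =
   \int[prodm mu mu]_p ((a p.1 * a p.2 + b p.1 * b p.2) * poisson e (p.1 - p.2))%:E)%E.
Proof.
move=> e0 inta intb.
have /measurable_int/measurable_EFinP ma := inta.
have /measurable_int/measurable_EFinP mb := intb.
have intna : mu.-integrable [set: R] (EFin \o (\- a)).
  apply: (@eq_integrable _ _ _ mu _ measurableT (-%E \o (EFin \o a))) => //.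
  exact: integrableN.
(* With A = a + i b, [c1] and [c2] are the real and imaginary parts of A(x) times the conjugate of
   A(y). [Psi] is the real part of that product times exp(-i (x - y) xi), damped by [abel]. *)
pose c1 (p : R * R) := a p.1 * a p.2 + b p.1 * b p.2.
pose c2 (p : R * R) := b p.1 * a p.2 - a p.1 * b p.2.
pose Psi (q : (R * R) * R) := (c1 q.1 * cos ((q.1.1 - q.1.2) * q.2)
  + c2 q.1 * sin ((q.1.1 - q.1.2) * q.2)) * abel e q.2.
(* Domination for Fubini: |c1| + |c2| is at most h(x) h(y). *)
pose h x : R := `|a x| + `|b x|.
have inth : mu.-integrable [set: R] (EFin \o h) by exact: integrable_absD.
have mc1 : measurable_fun [set: R * R] c1.
  by apply: measurable_funD; apply: measurable_funM; apply: measurableT_comp.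
have mc2 : measurable_fun [set: R * R] c2.
  by apply: measurable_funB; apply: measurable_funM; apply: measurableT_comp.
have mPsi : measurable_fun [set: (R * R) * R] Psi.
  have marg : measurable_fun [set: (R * R) * R] (fun q => (q.1.1 - q.1.2) * q.2).
    apply: measurable_funM => //; apply: measurable_funB => //.
      by apply: (@measurableT_comp _ _ _ _ _ _ fst).
    by apply: (@measurableT_comp _ _ _ _ _ _ snd).
  apply: measurable_funM; last by apply: measurableT_comp => //; exact: measurable_abel.
  apply: measurable_funD; apply: measurable_funM.
  - exact: (measurableT_comp mc1).
  - by apply: measurableT_comp marg; apply: continuous_measurable_fun; exact: continuous_cos.
  - exact: (measurableT_comp mc2).
  - by apply: measurableT_comp marg; apply: continuous_measurable_fun; exact: continuous_sin.
have iPsi : (prodm mu mu \x mu)%E.-integrable [set: (R * R) * R] (EFin \o Psi).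
  have ihh : (prodm mu mu).-integrable [set: R * R]
      (EFin \o (fun p : R * R => h p.1 * h p.2)) by exact: integrable_tensor.
  have := @integrable_tensor _ _ _ _ _ (prodm mu mu) mu _ _ ihh (integrable_abel e0).
  apply: le_integrable => //; first exact/measurable_EFinP.
  move=> q _ /=; rewrite lee_fin !normrM (ger0_norm (abel_ge0 _ _)).
  rewrite ler_wpM2r ?abel_ge0// (le_trans (ler_normD _ _))// !normrM.
  rewrite (@le_trans _ _ (`|c1 q.1| + `|c2 q.1|))//.
    by rewrite lerD// ler_piMr// ?norm_cos_le1 ?norm_sin_le1.
  rewrite (@le_trans _ _ ((`|a q.1.1| * `|a q.1.2| + `|b q.1.1| * `|b q.1.2|)
     + (`|b q.1.1| * `|a q.1.2| + `|a q.1.1| * `|b q.1.2|)))//.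
    by rewrite lerD// -!normrM ?ler_normD ?ler_normB.
  have h0 x : 0 <= h x by rewrite addr_ge0.
  rewrite !(ger0_norm (h0 _)) le_eqVlt; apply/orP; left; apply/eqP.
  by rewrite /h; ring.
have EPsi p : fubini_F mu (EFin \o Psi) p = (c1 p * poisson e (p.1 - p.2))%:E.
  rewrite /fubini_F /=.
  under eq_integral.
    move=> xi _.
    rewrite (_ : Psi (p, xi) = c1 p * (abel e xi * cos ((p.1 - p.2) * xi))
      + c2 p * (abel e xi * sin ((p.1 - p.2) * xi))); last by rewrite /Psi /=; ring.
    rewrite EFinD (EFinM (c1 p)) (EFinM (c2 p)); over.
  have icos := integrable_abelM e0 (measurable_cosM (p.1 - p.2)) (fun x => norm_cos_le1 _).
  have isin := integrable_abelM e0 (measurable_sinM (p.1 - p.2)) (fun x => norm_sin_le1 _).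
  rewrite integralD//; [|exact: integrableZl|exact: integrableZl].
  rewrite !integralZl// integral_abel_cos// integral_abel_sin//.
  by rewrite mule0 adde0 -EFinM.
split.
  have <- : fubini_F mu (EFin \o Psi) = (fun p => (c1 p * poisson e (p.1 - p.2))%:E).
    exact/funext.
  exact: integrable_fubini_F.
transitivity (\int[mu]_xi fubini_G (prodm mu mu) (EFin \o Psi) xi)%E; last first.
  rewrite integral21_prod_meas1// -integral12_prod_meas1//.
  by apply: eq_integral => p _; exact: EPsi.
apply: eq_integral => xi _; rewrite /fubini_G /=.
(* Real and imaginary parts of exp(-i x xi) A(x); for fixed xi the variables x and y then
   separate. *)
pose al x := a x * cos (x * xi) + b x * sin (x * xi).
pose be x := b x * cos (x * xi) + (\- a) x * sin (x * xi).
have ial : mu.-integrable [set: R] (EFin \o al).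
  exact: (@integrable_phase _ _ _ mu (fun x y : R => x * y) measurable_mul2 a b xi inta intb).
have ibe : mu.-integrable [set: R] (EFin \o be).
  exact: (@integrable_phase _ _ _ mu (fun x y : R => x * y) measurable_mul2 b (\- a) xi intb intna).
under eq_integral.
  move=> p _.
  rewrite (_ : Psi (p, xi) = abel e xi * (al p.1 * al p.2 + be p.1 * be p.2)); last first.
    rewrite /Psi /al /be /c1 /c2 /= mulrBl cosB sinB; ring.
  rewrite EFinM EFinD; over.
rewrite integralZl//; last by apply: integrableD => //; exact: integrable_tensor.
rewrite integralD//; [|exact: integrable_tensor|exact: integrable_tensor].
by rewrite !integral_tensor// -EFinD -EFinM !expr2.
Qed.

End abel_identity.

(** * The defect in Plancherel's formula on the line *)

Section ereal_limits.
Context {R : realType}.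

Lemma ge0_cvge0P (I : Type) (F : set_system I) {FF : Filter F} (u : I -> \bar R) :
  (forall i, 0 <= u i)%E ->
  (u i @[i --> F] --> 0)%E <->
  (forall e : R, 0 < e -> \forall i \near F, (u i <= e%:E)%E).
Proof.
move=> u0; split => [/fine_cvgP[ufin /cvgr0Pnorm_le uc] e e0|H].
  near=> i; have ui : u i \is a fin_num by near: i.
  rewrite -(fineK ui) lee_fin (le_trans (ler_norm _))//.
  by near: i; exact: uc.
apply/fine_cvgP; split.
  near=> i; rewrite ge0_fin_numE// (@le_lt_trans _ _ 1%:E) ?ltry//.
  by near: i; exact: H.
apply/cvgr0Pnorm_le => e e0; near=> i.
have ui : (u i <= e%:E)%E by near: i; exact: H.
have uif : u i \is a fin_num by rewrite ge0_fin_numE// (le_lt_trans ui) ?ltry.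
by rewrite ger0_norm ?fine_ge0// -lee_fin fineK.
Unshelve. all: by end_near. Qed.

End ereal_limits.

Lemma sqint_ge0 d (T : measurableType d) (R : realType)
  (mu : {sigma_finite_measure set T -> \bar R}) (f g : T -> R) : (0 <= sqint mu f g)%E.
Proof. by apply: integral_ge0 => x _; rewrite lee_fin addr_ge0 ?sqr_ge0. Qed.

Lemma ge0_integrable d (T : measurableType d) (R : realType)
    (mu : {measure set T -> \bar R}) (f : T -> R) :
  measurable_fun [set: T] f -> (forall x, 0 <= f x) ->
  (\int[mu]_x (f x)%:E < +oo)%E -> mu.-integrable [set: T] (EFin \o f).
Proof.
move=> mf f0 fy; apply/integrableP; split; first exact/measurable_EFinP.
by under eq_integral do rewrite /= ger0_norm//.
Qed.

Section poisson_defect.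
Context {R : realType}.
Local Notation mu := (@lebesgue_measure R).
Implicit Types (a b f g : R -> R) (e : R).

Definition sqn a := (\int[mu]_x (a x ^+ 2)%:E)%E.

(** A quadratic seminorm in a. By [abel_parseval], the defects of a and b add up to twice the gap
    between 2 pi times the squared norm of a + i b and its Abel-damped energy. *)
Definition defect e a :=
  (\int[prodm mu mu]_p ((a p.1 - a p.2) ^+ 2 * poisson e (p.1 - p.2))%:E)%E.

Lemma measurable_poissonB e : 0 < e ->
  measurable_fun [set: R * R] (fun p : R * R => poisson e (p.1 - p.2)).
Proof.
move=> e0; apply: (@measurableT_comp _ _ _ _ _ _ (poisson e)).
  exact: continuous_measurable_fun (poisson_continuous e0).
exact: measurable_funB.
Qed.

Lemma measurable_defect e a : 0 < e -> measurable_fun [set: R] a ->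
  measurable_fun [set: R * R]
    (fun p : R * R => (a p.1 - a p.2) ^+ 2 * poisson e (p.1 - p.2)).
Proof.
move=> e0 ma; apply: measurable_funM; last exact: measurable_poissonB.
apply: measurable_funX; apply: measurable_funB; exact: measurableT_comp.
Qed.

Lemma defect_ge0 e a : 0 <= e -> (0 <= defect e a)%E.
Proof.
by move=> e0; apply: integral_ge0 => p _; rewrite lee_fin mulr_ge0 ?sqr_ge0 ?poisson_ge0.
Qed.

Lemma integral_poisson_fst e f : 0 < e -> measurable_fun [set: R] f -> (forall x, 0 <= f x) ->
  (\int[prodm mu mu]_p (f p.1 * poisson e (p.1 - p.2))%:E
   = (2 * pi)%:E * \int[mu]_x (f x)%:E)%E.
Proof.
move=> e0 mf f0; rewrite fubini_tonelli1//=; last 2 first.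
- apply/measurable_EFinP/measurable_funM; last exact: measurable_poissonB.
  exact: measurableT_comp.
- by move=> p; rewrite lee_fin mulr_ge0 ?f0 ?poisson_ge0// ltW.
rewrite /fubini_F /=.
under eq_integral.
  move=> x _; under eq_integral do rewrite EFinM.
  rewrite ge0_integralZl//; first rewrite integral_poisson// muleC; first over.
  - apply/measurable_EFinP; apply: (@measurableT_comp _ _ _ _ _ _ (poisson e)).
      exact: continuous_measurable_fun (poisson_continuous e0).
    exact: measurable_funB.
  - by move=> y _; rewrite lee_fin poisson_ge0// ltW.
  - by rewrite lee_fin.
rewrite ge0_integralZl//; first exact/measurable_EFinP.
- by move=> x _; rewrite lee_fin.
- by rewrite lee_fin mulr_ge0 ?pi_ge0.
Qed.

Lemma integral_poisson_snd e f : 0 < e -> measurable_fun [set: R] f -> (forall x, 0 <= f x) ->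
  (\int[prodm mu mu]_p (f p.2 * poisson e (p.1 - p.2))%:E
   = (2 * pi)%:E * \int[mu]_x (f x)%:E)%E.
Proof.
move=> e0 mf f0; rewrite -(integral_poisson_fst e0 mf f0) fubini_tonelli2; last 2 first.
- apply/measurable_EFinP/measurable_funM; last exact: measurable_poissonB.
  exact: measurableT_comp.
- by move=> p; rewrite lee_fin mulr_ge0 ?f0 ?poisson_ge0// ltW.
rewrite fubini_tonelli1; last 2 first.
- apply/measurable_EFinP/measurable_funM; last exact: measurable_poissonB.
  exact: measurableT_comp.
- by move=> p; rewrite lee_fin mulr_ge0 ?f0 ?poisson_ge0// ltW.
apply: eq_integral => y _; rewrite /fubini_G /fubini_F/=.
by apply: eq_integral => x _; rewrite -[in LHS]poissonN opprB.
Qed.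

(** The hypothesis bears on increments, so that one lemma serves sums, differences and
    approximation. *)
Lemma defect_le e f g (u v : R -> R) :
  0 < e -> measurable_fun [set: R] f -> measurable_fun [set: R] u -> measurable_fun [set: R] v ->
  (forall x y, (f x - f y) ^+ 2 <= 2 * (u x - u y) ^+ 2 + 2 * (v x - v y) ^+ 2) ->
  (defect e f <= 2%:E * defect e u + 2%:E * defect e v)%E.
Proof.
move=> e0 mf mu_ mv fuv; have P0 z := @poisson_ge0 _ _ z (ltW e0).
rewrite /defect -!ge0_integralZl//.
- rewrite -ge0_integralD//.
  + apply: ge0_le_integral => //.
    * by move=> p _; rewrite lee_fin mulr_ge0 ?sqr_ge0.
    * by apply/measurable_EFinP; exact: measurable_defect.
    * by apply: emeasurable_funD; apply/measurable_EFinP; apply: measurable_funM => //; exact: measurable_defect.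
    * move=> p _; rewrite -!EFinM -EFinD lee_fin.
      move: (poisson _ _) (P0 (p.1 - p.2)) => w w0.
      by have := ler_wpM2r w0 (fuv p.1 p.2); rewrite mulrDl -!(mulrA 2).
  + by move=> p _; rewrite -EFinM lee_fin mulr_ge0// mulr_ge0 ?sqr_ge0.
  + by apply/measurable_EFinP; apply: measurable_funM => //; exact: measurable_defect.
  + by move=> p _; rewrite -EFinM lee_fin mulr_ge0// mulr_ge0 ?sqr_ge0.
  + by apply/measurable_EFinP; apply: measurable_funM => //; exact: measurable_defect.
- by apply/measurable_EFinP; exact: measurable_defect.
- by move=> p _; rewrite lee_fin mulr_ge0 ?sqr_ge0.
- by apply/measurable_EFinP; exact: measurable_defect.
- by move=> p _; rewrite lee_fin mulr_ge0 ?sqr_ge0.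
Qed.

Lemma sq_subr_le (x y : R) : (x - y) ^+ 2 <= 2 * x ^+ 2 + 2 * y ^+ 2.
Proof. by rewrite -subr_ge0 (_ : _ - _ = (x + y) ^+ 2) ?sqr_ge0//; ring. Qed.

(** The squared increment is at most 2 f(x)^2 + 2 f(y)^2, and integrating the kernel in the other
    variable gives 2 pi for each term. The bound does not depend on e. *)
Lemma defect_le_sqn e f : 0 < e -> measurable_fun [set: R] f ->
  (defect e f <= (8 * pi)%:E * sqn f)%E.
Proof.
move=> e0 mf; have P0 z := @poisson_ge0 _ _ z (ltW e0).
have mf2 : measurable_fun [set: R] (fun x => 2 * f x ^+ 2).
  by apply: measurable_funM => //; exact: measurable_funX.
have f20 x : 0 <= 2 * f x ^+ 2 by rewrite mulr_ge0 ?sqr_ge0.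
apply: (@le_trans _ _ (\int[prodm mu mu]_p ((2 * f p.1 ^+ 2) * poisson e (p.1 - p.2)
   + (2 * f p.2 ^+ 2) * poisson e (p.1 - p.2))%:E)%E).
  apply: ge0_le_integral => //.
  - by move=> p _; rewrite lee_fin mulr_ge0 ?sqr_ge0.
  - by apply/measurable_EFinP; exact: measurable_defect.
  - apply/measurable_EFinP; rewrite /=; under eq_fun do rewrite -mulrDl.
    apply: measurable_funM; last exact: measurable_poissonB.
    by apply: measurable_funD; apply: (@measurableT_comp _ _ _ _ _ _ (fun x => 2 * f x ^+ 2)).
  - by move=> p _; rewrite lee_fin -mulrDl ler_wpM2r// sq_subr_le.
under eq_integral do rewrite EFinD.
rewrite ge0_integralD//; last 4 first.
- by move=> p _; rewrite lee_fin mulr_ge0.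
- apply/measurable_EFinP/measurable_funM; last exact: measurable_poissonB.
  exact: (@measurableT_comp _ _ _ _ _ _ (fun x => 2 * f x ^+ 2)).
- by move=> p _; rewrite lee_fin mulr_ge0.
- apply/measurable_EFinP/measurable_funM; last exact: measurable_poissonB.
  exact: (@measurableT_comp _ _ _ _ _ _ (fun x => 2 * f x ^+ 2)).
rewrite (integral_poisson_fst e0 mf2 f20) (integral_poisson_snd e0 mf2 f20).
under eq_integral do rewrite EFinM.
rewrite ge0_integralZl//; last 2 first.
- by apply/measurable_EFinP; exact: measurable_funX.
- by move=> x _; rewrite lee_fin sqr_ge0.
rewrite -/(sqn f) muleA -EFinM -ge0_muleDl ?lee_fin ?mulr_ge0 ?pi_ge0//.
by rewrite -EFinD (_ : _ + _ = 8 * pi)//; ring.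
Qed.

(** Integrate the polarisation identity against the Poisson kernel: the squares give 2 pi times the
    norm each, the cross term is the damped energy. Finiteness of the norm makes the squares
    integrable, and the increments are a combination of them and the cross term. *)
Lemma abel_parseval a b e : 0 < e ->
  mu.-integrable [set: R] (EFin \o a) -> mu.-integrable [set: R] (EFin \o b) ->
  (sqint mu a b < +oo)%E ->
  let theta x y : R := x * y in
  (2%:E * (\int[mu]_xi (abel e xi * (phase_int mu theta a b xi ^+ 2
                             + phase_int mu theta b (\- a) xi ^+ 2))%:E)
   + (defect e a + defect e b) = (4 * pi)%:E * sqint mu a b)%E.
Proof.
move=> e0 inta intb ab2 theta; have P0 z := @poisson_ge0 _ _ z (ltW e0).
have /measurable_int/measurable_EFinP ma := inta.
have /measurable_int/measurable_EFinP mb := intb.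
have [iPhi ->] := integral_abel_phase e0 inta intb.
set Phi := (X in (\int[prodm mu mu]_p X p)%E).
pose s x := a x ^+ 2 + b x ^+ 2.
have ms : measurable_fun [set: R] s.
  by apply: measurable_funD; exact: measurable_funX.
have s0 x : 0 <= s x by rewrite addr_ge0 ?sqr_ge0.
have ms1 : measurable_fun [set: R * R] (fun p : R * R => s p.1 * poisson e (p.1 - p.2)).
  by apply: measurable_funM; [exact: measurableT_comp|exact: measurable_poissonB].
have ms2 : measurable_fun [set: R * R] (fun p : R * R => s p.2 * poisson e (p.1 - p.2)).
  by apply: measurable_funM; [exact: measurableT_comp|exact: measurable_poissonB].
have I1 := integral_poisson_fst e0 ms s0.
have I2 := integral_poisson_snd e0 ms s0.
have mda := measurable_defect e0 ma; have mdb := measurable_defect e0 mb.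
have ID : (defect e a + defect e b = \int[prodm mu mu]_p
    (((a p.1 - a p.2) ^+ 2 + (b p.1 - b p.2) ^+ 2) * poisson e (p.1 - p.2))%:E)%E.
  rewrite -ge0_integralD//.
  - by apply: eq_integral => p _; rewrite -EFinD mulrDl.
  - by move=> p _; rewrite lee_fin mulr_ge0 ?sqr_ge0.
  - exact/measurable_EFinP.
  - by move=> p _; rewrite lee_fin mulr_ge0 ?sqr_ge0.
  - exact/measurable_EFinP.
have fin_sq : sqint mu a b \is a fin_num.
  by rewrite ge0_fin_numE ?sqint_ge0.
have iG1 : (prodm mu mu).-integrable [set: R * R] (fun p => (s p.1 * poisson e (p.1 - p.2))%:E).
  apply: (@ge0_integrable _ _ _ (prodm mu mu) _ ms1) => [p|]; first by rewrite mulr_ge0.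
  by rewrite I1 lte_mul_pinfty// lee_fin mulr_ge0 ?pi_ge0.
have iG2 : (prodm mu mu).-integrable [set: R * R] (fun p => (s p.2 * poisson e (p.1 - p.2))%:E).
  apply: (@ge0_integrable _ _ _ (prodm mu mu) _ ms2) => [p|]; first by rewrite mulr_ge0.
  by rewrite I2 lte_mul_pinfty// lee_fin mulr_ge0 ?pi_ge0.
have iDelta : (prodm mu mu).-integrable [set: R * R] (fun p =>
    (((a p.1 - a p.2) ^+ 2 + (b p.1 - b p.2) ^+ 2) * poisson e (p.1 - p.2))%:E).
  have -> : (fun p : R * R => (((a p.1 - a p.2) ^+ 2 + (b p.1 - b p.2) ^+ 2) * poisson e (p.1 - p.2))%:E)
      = (fun p : R * R => (s p.1 * poisson e (p.1 - p.2))%:E + (s p.2 * poisson e (p.1 - p.2))%:E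
           - 2%:E * Phi p)%E.
    apply/funext => p; rewrite /Phi -EFinM -EFinN -!EFinD; congr EFin; rewrite /s; ring.
  apply: integrableB => //; [exact: integrableD|exact: integrableZl].
rewrite ID -integralZl// -integralD//; last exact: integrableZl.
transitivity (\int[prodm mu mu]_p ((s p.1 * poisson e (p.1 - p.2))%:E
     + (s p.2 * poisson e (p.1 - p.2))%:E))%E.
  by apply: eq_integral => p _; rewrite /Phi -!EFinD; congr EFin; rewrite /s; ring.
rewrite integralD// I1 I2 -ge0_muleDl ?lee_fin ?mulr_ge0 ?pi_ge0//.
by rewrite -EFinD (_ : _ + _ = 4 * pi)//; ring.
Qed.

(** Away from the origin the kernel is O(e). Comparing with [poisson 1] instead of a constant keeps
    the bound integrable in z. *)
Lemma poisson_le e (r z : R) : 0 < e -> 0 < r -> r ^+ 2 <= z ^+ 2 ->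
  poisson e z <= e * (1 + r ^- 2) * poisson 1 z.
Proof.
move=> e0 r0 rz; have r20 : 0 < r ^+ 2 by rewrite exprn_gt0.
have e20 : 0 < e ^+ 2 by rewrite exprn_gt0.
have key : 1 + z ^+ 2 <= (1 + r ^- 2) * (e ^+ 2 + z ^+ 2).
  have h : 1 <= r ^- 2 * z ^+ 2 by rewrite mulrC ler_pdivlMr// mul1r.
  have h2 : 0 <= r ^- 2 * e ^+ 2 by rewrite mulr_ge0 ?invr_ge0 ?sqr_ge0.
  by rewrite mulrDl mul1r mulrDr; lra.
have z10 : 0 < 1 + z ^+ 2 by rewrite ltr_wpDr ?sqr_ge0.
rewrite /poisson expr1n mulr1 ler_pdivrMr ?ltr_wpDr ?sqr_ge0//.
rewrite [leRHS](_ : _ = 2 * e * (((1 + r ^- 2) * (e ^+ 2 + z ^+ 2)) / (1 + z ^+ 2))).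
  by rewrite ler_peMr ?mulr_ge0 ?(ltW e0)// ler_pdivlMr// mul1r.
by field; rewrite !gt_eqF.
Qed.

Local Opaque poisson.

(** The parameter runs through 1/(n+1) so that convergence theorems for sequences of functions
    apply. *)
Definition vanishing a := (defect (n.+1%:R^-1) a @[n --> \oo] --> 0)%E.

Lemma vanishingP a :
  vanishing a <-> forall d : R, 0 < d -> \forall n \near \oo, (defect (n.+1%:R^-1) a <= d%:E)%E.
Proof. by apply: ge0_cvge0P => n; exact: defect_ge0. Qed.

Lemma vanishing_le f (u v : R -> R) :
  measurable_fun [set: R] f -> measurable_fun [set: R] u -> measurable_fun [set: R] v ->
  (forall x y, (f x - f y) ^+ 2 <= 2 * (u x - u y) ^+ 2 + 2 * (v x - v y) ^+ 2) ->
  vanishing u -> vanishing v -> vanishing f.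
Proof.
move=> mf mu_ mv fuv /vanishingP vu /vanishingP vv; apply/vanishingP => d d0.
have d4 : 0 < d / 4 by rewrite divr_gt0.
near=> n.
have e0 : 0 < n.+1%:R^-1 :> R by rewrite invr_gt0.
apply: (@le_trans _ _ (2%:E * defect n.+1%:R^-1 u + 2%:E * defect n.+1%:R^-1 v)%E).
  exact: defect_le.
rewrite (_ : d%:E = 2%:E * (d / 4)%:E + 2%:E * (d / 4)%:E)%E.
  by apply: leeD; rewrite lee_pmul2l//; near: n; [exact: vu|exact: vv].
by rewrite -!EFinM -EFinD; congr EFin; field.
Unshelve. all: by end_near. Qed.

Lemma vanishingZ f c : measurable_fun [set: R] f -> vanishing f -> vanishing (fun x => c * f x).
Proof.
move=> mf /vanishingP vf; apply/vanishingP => d d0.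
(* One is added to c^2 so that the factor can be divided out when c = 0 as well. *)
have c0 : 0 < c ^+ 2 + 1 by rewrite ltr_wpDl ?sqr_ge0.
near=> n; have e0 : 0 < n.+1%:R^-1 :> R by rewrite invr_gt0.
rewrite (@le_trans _ _ ((c ^+ 2 + 1)%:E * defect n.+1%:R^-1 f)%E)//; last first.
  rewrite -lee_pdivlMl// -EFinM; near: n; apply: vf.
  by rewrite mulr_gt0 ?invr_gt0.
rewrite /defect -ge0_integralZl//; last 3 first.
- by apply/measurable_EFinP; exact: measurable_defect.
- by move=> p _; rewrite lee_fin mulr_ge0 ?sqr_ge0 ?poisson_ge0.
- by rewrite lee_fin ltW.
apply: ge0_le_integral => //.
- by move=> p _; rewrite lee_fin mulr_ge0 ?sqr_ge0 ?poisson_ge0.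
- have mcf : measurable_fun [set: R] (fun x => c * f x) by exact: measurable_funM.
  by apply/measurable_EFinP; exact: (measurable_defect e0 mcf).
- by apply/measurable_EFinP; apply: measurable_funM => //; exact: measurable_defect.
move=> p _; rewrite -EFinM lee_fin -mulrBr exprMn [leRHS]mulrA.
by rewrite ler_wpM2r ?poisson_ge0// ler_wpM2r ?sqr_ge0// lerDl.
Unshelve. all: by end_near. Qed.

(** Closedness in L^2: the defect of f - g is controlled for all e at once by [defect_le_sqn], that
    of g tends to 0. *)
Lemma vanishing_approx f : measurable_fun [set: R] f ->
  (forall d : R, 0 < d -> exists g, [/\ measurable_fun [set: R] g, vanishing g &
     (sqn (f \- g)%R <= d%:E)%E]) ->
  vanishing f.
Proof.
move=> mf H; apply/vanishingP => d d0.
have d1 : 0 < d / 4 by rewrite divr_gt0.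
(* After the factor 2 of [defect_le] and the factor 8 pi of [defect_le_sqn], each of the two terms
   is at most d / 2. *)
have d2 : 0 < d / 4 / (8 * pi) by rewrite divr_gt0// mulr_gt0 ?pi_gt0.
have [g [mg /vanishingP vg fg]] := H _ d2.
near=> n; have e0 : 0 < n.+1%:R^-1 :> R by rewrite invr_gt0.
have mfg : measurable_fun [set: R] (f \- g) by exact: measurable_funB.
apply: (@le_trans _ _ (2%:E * defect n.+1%:R^-1 g + 2%:E * defect n.+1%:R^-1 (f \- g)%R)%E).
  apply: defect_le => // x y.
  rewrite -subr_ge0 (_ : _ - _ = (g x - g y - ((f x - g x) - (f y - g y))) ^+ 2) ?sqr_ge0//=.
  by ring.
rewrite (_ : d%:E = 2%:E * (d / 4)%:E + 2%:E * (d / 4)%:E)%E; last first.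
  by rewrite -!EFinM -EFinD; congr EFin; field.
apply: leeD; rewrite lee_pmul2l//; first by near: n; exact: vg.
apply: (@le_trans _ _ ((8 * pi)%:E * sqn (f \- g)%R)%E); first exact: defect_le_sqn.
by rewrite -lee_pdivlMl ?mulr_gt0 ?pi_gt0// -EFinM mulrC.
Unshelve. all: by end_near. Qed.

(* Points of an open set are at positive distance from its complement, where
   the Poisson kernel is [O(e)]. *)
Lemma vanishing_open U : open U -> (mu U < +oo)%E -> vanishing (\1_U).
Proof.
move=> oU Uy; have mU : measurable U by exact: open_measurable.
have m1U : measurable_fun [set: R] (\1_U : R -> R) by exact: measurable_indic.
pose e_ n : R := n.+1%:R^-1; have e0 n : 0 < e_ n by rewrite invr_gt0.
(* The Poisson mass that lies outside U when the kernel is centred at x. *)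
pose T_ n x := (\int[mu]_y (\1_(~` U) y * poisson (e_ n) (x - y))%:E)%E.
have m1UC : measurable_fun [set: R] (\1_(~` U) : R -> R).
  by apply: measurable_indic; exact: measurableC.
have mint n : measurable_fun [set: R * R]
    (fun p : R * R => \1_U p.1 * (\1_(~` U) p.2 * poisson (e_ n) (p.1 - p.2)) : R).
  apply: measurable_funM; first exact: measurableT_comp.
  by apply: measurable_funM; [exact: measurableT_comp|exact: measurable_poissonB].
have int0 n (p : R * R) : 0 <= \1_U p.1 * (\1_(~` U) p.2 * poisson (e_ n) (p.1 - p.2)) :> R.
  by rewrite mulr_ge0// mulr_ge0// poisson_ge0// ltW.
have mintS n : measurable_fun [set: R * R]
    (fun p : R * R => \1_U p.2 * (\1_(~` U) p.1 * poisson (e_ n) (p.1 - p.2)) : R).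
  apply: measurable_funM; first exact: measurableT_comp.
  by apply: measurable_funM; [exact: measurableT_comp|exact: measurable_poissonB].
have intS0 n (p : R * R) : 0 <= \1_U p.2 * (\1_(~` U) p.1 * poisson (e_ n) (p.1 - p.2)) :> R.
  by rewrite mulr_ge0// mulr_ge0// poisson_ge0// ltW.
have mPx n x : measurable_fun [set: R] (fun y => \1_(~` U) y * poisson (e_ n) (x - y)).
  apply: measurable_funM => //; apply: (@measurableT_comp _ _ _ _ _ _ (poisson (e_ n))).
    exact: continuous_measurable_fun (poisson_continuous (e0 n)).
  exact: measurable_funB.
have Px0 n x y : 0 <= \1_(~` U) y * poisson (e_ n) (x - y).
  by rewrite mulr_ge0// poisson_ge0// ltW.
(* The squared increment of the indicator is 1 exactly when one of the two points is in U and the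
   other is not. The two cases have the same integral, the kernel being even. *)
have defE n : (defect (e_ n) (\1_U) = 2%:E * \int[mu]_x ((\1_U x)%:E * T_ n x))%E.
  have E1 : (\int[prodm mu mu]_p (\1_U p.1 * (\1_(~` U) p.2 * poisson (e_ n) (p.1 - p.2)))%:E
     = \int[mu]_x ((\1_U x)%:E * T_ n x))%E.
    rewrite fubini_tonelli1; last 2 first.
    - apply/measurable_EFinP; first [exact: mint|exact: mintS|exact: mPx].
    - by move=> p; rewrite lee_fin.
    apply: eq_integral => x _; rewrite /fubini_F /=.
    under eq_integral do rewrite EFinM.
    rewrite ge0_integralZl//; first by apply/measurable_EFinP; exact: mPx.
    by move=> y _; rewrite lee_fin.
  have E2 : (\int[prodm mu mu]_p (\1_U p.2 * (\1_(~` U) p.1 * poisson (e_ n) (p.1 - p.2)))%:E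
     = \int[mu]_x ((\1_U x)%:E * T_ n x))%E.
    rewrite fubini_tonelli2; last 2 first.
    - apply/measurable_EFinP; first [exact: mint|exact: mintS|exact: mPx].
    - by move=> p; rewrite lee_fin.
    apply: eq_integral => x _; rewrite /fubini_G /=.
    under eq_integral do rewrite EFinM -poissonN opprB.
    rewrite ge0_integralZl//; first by apply/measurable_EFinP; exact: mPx.
    by move=> y _; rewrite lee_fin.
  rewrite -[2%:E]/((1 + 1)%:E) EFinD ge0_muleDl ?lee_fin// mul1e -[in X in (X + _)%E]E1 -E2.
  rewrite -ge0_integralD//; last 4 first.
  - by move=> p _; rewrite lee_fin.
  - apply/measurable_EFinP; first [exact: mint|exact: mintS|exact: mPx].
  - by move=> p _; rewrite lee_fin.
  - apply/measurable_EFinP; first [exact: mint|exact: mintS|exact: mPx].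
  apply: eq_integral => p _; rewrite -EFinD; congr EFin.
  rewrite !indicE !in_setC; case: (p.1 \in U); case: (p.2 \in U) => /=; ring.
(* This yields the dominating function 2 pi on U, integrable because U has finite measure. *)
have Tfin n x : (T_ n x <= (2 * pi)%:E)%E.
  rewrite -(integral_poisson x (e0 n)); apply: ge0_le_integral => //.
  - by move=> y _; rewrite lee_fin.
  - apply/measurable_EFinP; first [exact: mint|exact: mintS|exact: mPx].
  - apply/measurable_EFinP; apply: (@measurableT_comp _ _ _ _ _ _ (poisson (e_ n))).
      exact: continuous_measurable_fun (poisson_continuous (e0 n)).
    exact: measurable_funB.
  - move=> y _; rewrite lee_fin ler_piMl ?poisson_ge0//; exact: ltW.
have T0 n x : (0 <= T_ n x)%E by apply: integral_ge0 => y _; rewrite lee_fin.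
have Tcvg x : U x -> (T_ n x @[n --> \oo] --> 0)%E.
  move=> Ux; apply/ge0_cvge0P => // d d0.
  have /nbhs_ballP[r /= r0 rU] : nbhs x U by exact: open_nbhs_nbhs.
  (* The constant of [poisson_le] times the mass of [poisson 1]; r is the radius of a ball around x
     inside U. *)
  pose C := (1 + r^-2) * (2 * pi).
  have C0 : 0 < C by rewrite mulr_gt0 ?mulr_gt0 ?pi_gt0// ltr_pwDl// invr_ge0 sqr_ge0.
  have r20 : 0 <= 1 + r ^- 2 by rewrite addr_ge0// invr_ge0 sqr_ge0.
  near=> n; apply: (@le_trans _ _ (e_ n * C)%:E); last first.
    rewrite lee_fin -ler_pdivlMr// ltW//; near: n.
    by apply: near_infty_natSinv_lt (PosNum (_ : 0 < d / C)); rewrite divr_gt0.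
  rewrite /C mulrA EFinM -(integral_poisson x ltr01) -ge0_integralZl//; last 3 first.
  - apply/measurable_EFinP; apply: (@measurableT_comp _ _ _ _ _ _ (poisson 1)).
      exact: continuous_measurable_fun (poisson_continuous _).
    exact: measurable_funB.
  - by move=> y _; rewrite lee_fin poisson_ge0.
  - by rewrite lee_fin mulr_ge0// ltW.
  apply: ge0_le_integral => //.
  - by move=> y _; rewrite lee_fin.
  - apply/measurable_EFinP; first [exact: mint|exact: mintS|exact: mPx].
  - apply/measurable_EFinP; apply: measurable_funM => //.
    apply: (@measurableT_comp _ _ _ _ _ _ (poisson 1)).
      exact: continuous_measurable_fun (poisson_continuous _).
    exact: measurable_funB.
  move=> y _; rewrite -EFinM lee_fin indicE in_setC.
  case: (boolP (y \in U)) => yU /=; rewrite ?mul0r ?mul1r.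
    by rewrite mulr_ge0 ?poisson_ge0// mulr_ge0// ltW.
  have rxy : r ^+ 2 <= (x - y) ^+ 2.
    rewrite -(real_normK (num_real (x - y))) ler_sqr ?nnegrE ?normr_ge0 ?(ltW r0)//.
    rewrite leNgt; apply: contra yU => xyr; rewrite inE; exact: rU.
  exact: poisson_le.
rewrite /vanishing.
rewrite (_ : (fun n => _) = (fun n => 2%:E * \int[mu]_x ((\1_U x)%:E * T_ n x))%E); last exact/funext.
rewrite -[X in _ --> X](mule0 2%:E); apply: cvgeZl => //.
have [|||||_ _] := @dominated_convergence _ _ _ mu _ measurableT (fun n x => (\1_U x)%:E * T_ n x)%E
    (cst 0%E) (fun x => (\1_U x * (2 * pi))%:E).
- move=> n; apply: emeasurable_funM; first exact/measurable_EFinP.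
  have mpos : measurable_fun [set: R * R]
      (fun p : R * R => (\1_(~` U) p.2 * poisson (e_ n) (p.1 - p.2) : R)%:E).
    apply/measurable_EFinP; apply: measurable_funM; [exact: measurableT_comp|exact: measurable_poissonB].
  apply: (@measurable_fun_fubini_tonelli_F _ _ _ _ _ mu _ mpos) => p.
  by rewrite lee_fin mulr_ge0// poisson_ge0// ltW.
- exact: measurable_cst.
- apply: aeW => x _; rewrite indicE; case: (boolP (x \in U)) => xU /=.
    by under eq_fun do rewrite mul1e; apply: Tcvg; rewrite inE in xU.
  by under eq_fun do rewrite mul0e; exact: cvg_cst.
- apply: ge0_integrable.
  + exact: measurable_funM.
  + by move=> x; rewrite mulr_ge0// mulr_ge0// pi_ge0.
  + under eq_integral do rewrite mulrC EFinM.
    rewrite ge0_integralZl ?lee_fin ?mulr_ge0 ?pi_ge0//; last exact/measurable_EFinP.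
    rewrite integral_indic// setIT lte_mul_pinfty// lee_fin mulr_ge0 ?pi_ge0//.
- apply: aeW => x n _; rewrite EFinM abseM !gee0_abs ?lee_fin//.
  by rewrite lee_wpmul2l// lee_fin.
by rewrite integral0.
Unshelve. all: by end_near. Qed.

Lemma vanishing0 : vanishing (cst 0).
Proof.
rewrite /vanishing; under eq_fun do rewrite /defect.
have -> : (fun n : nat => \int[prodm mu mu]_p ((cst 0 p.1 - cst 0 p.2 : R) ^+ 2
     * poisson n.+1%:R^-1 (p.1 - p.2))%:E)%E = cst 0%E.
  by apply/funext => n; apply: integral0_eq => p _; rewrite subr0 expr0n mul0r.
exact: cvg_cst.
Qed.

Lemma vanishingD f g : measurable_fun [set: R] f -> measurable_fun [set: R] g ->
  vanishing f -> vanishing g -> vanishing (f \+ g).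
Proof.
move=> mf mg; apply: vanishing_le => //; first exact: measurable_funD.
move=> x y; rewrite -subr_ge0 /=.
by rewrite [leRHS](_ : _ = ((f x - f y) - (g x - g y)) ^+ 2) ?sqr_ge0//; ring.
Qed.

Lemma vanishingB f g : measurable_fun [set: R] f -> measurable_fun [set: R] g ->
  vanishing f -> vanishing g -> vanishing (f \- g).
Proof.
move=> mf mg; apply: vanishing_le => //; first exact: measurable_funB.
move=> x y; rewrite -subr_ge0 /=.
by rewrite [leRHS](_ : _ = ((f x - f y) + (g x - g y)) ^+ 2) ?sqr_ge0//; ring.
Qed.

(** Outer regularity gives an open U containing A with U \ A of small measure, and that measure is
    the squared L^2 distance of the two indicators. *)
Lemma vanishing_indic A : measurable A -> (mu A < +oo)%E -> vanishing (\1_A).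
Proof.
move=> mA Ay; apply: vanishing_approx; first exact: measurable_indic.
move=> d d0; have [U [oU AU UA]] := lebesgue_regularity_outer mA Ay d0.
have mU : measurable U by exact: open_measurable.
exists \1_U; split; first exact: measurable_indic.
  apply: vanishing_open => //.
  rewrite -(setDUK AU) (le_lt_trans (measureU2 _ _ _))//; first exact: measurableD.
  by rewrite lte_add_pinfty// (lt_trans UA)// ltry.
rewrite /sqn (_ : (fun x => _) = (fun x => (\1_(U `\` A) x)%:E)).
  by rewrite integral_indic ?setIT ?ltW//; exact: measurableD.
apply/funext => x; congr EFin; rewrite /= !indicE in_setD.
have [xA|xA] := boolP (x \in A); have [xU|xU] := boolP (x \in U) => //=.
- by rewrite subrr expr0n.
- by move: xU; rewrite (mem_set (AU _ (set_mem xA))).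
- by rewrite sub0r sqrrN expr1n.
- by rewrite subrr expr0n.
Qed.

(** Chebyshev: y^2 times the measure of the level set is at most the squared norm of f. For y = 0
    the level set may have infinite measure, but the function is zero. *)
Lemma vanishing_level f y : measurable_fun [set: R] f -> (sqn f < +oo)%E ->
  vanishing (fun x => y * \1_(f @^-1` [set y]) x).
Proof.
move=> mf fy; have mA : measurable (f @^-1` [set y]) by rewrite -[X in measurable X]setTI; exact: mf.
have [->|y0] := eqVneq y 0.
  rewrite (_ : (fun x => _) = cst 0); first exact: vanishing0.
  by apply/funext => x; rewrite mul0r.
apply: vanishingZ; first exact: measurable_indic.
apply: vanishing_indic => //.
have y20 : 0 < y ^+ 2 by rewrite exprn_even_gt0.
suff : ((y ^+ 2)%:E * mu (f @^-1` [set y]) < +oo)%E.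
  by case: (mu _) => [r| |]; rewrite ?ltry// gt0_muley// lte_fin.
apply: le_lt_trans fy; rewrite -(setIT (f @^-1` [set y])) -integral_indic//.
rewrite -ge0_integralZl ?lee_fin ?sqr_ge0//; last first.
  by apply/measurable_EFinP; exact: measurable_indic.
apply: ge0_le_integral => //.
- by move=> x _; rewrite -EFinM lee_fin mulr_ge0 ?sqr_ge0.
- by apply/measurable_EFinP; apply: measurable_funM => //; exact: measurable_indic.
- by apply/measurable_EFinP; exact: measurable_funX.
move=> x _; rewrite -EFinM lee_fin indicE; case: (boolP (x \in _)) => [|_].
  by rewrite inE/= => <-; rewrite mulr1.
by rewrite mulr0 sqr_ge0.
Qed.

Import HBNNSimple.

Lemma vanishing_nnsfun (f : {nnsfun measurableTypeR R >-> R}) :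
  (sqn f < +oo)%E -> vanishing f.
Proof.
move=> fy; have mf : measurable_fun [set: R] f by exact: (@measurable_funP _ _ _ _ setT f).
(* The decomposition of f along its range is generalised to an arbitrary list of values, so as to
   induct on the list. *)
pose g (s : seq R) x := \sum_(y <- s) y * \1_(f @^-1` [set y]) x.
have mA y : measurable (f @^-1` [set y]) by rewrite -[X in measurable X]setTI; exact: mf.
have mt y : measurable_fun [set: R] (fun x => y * \1_(f @^-1` [set y]) x).
  by apply: measurable_funM => //; apply: measurable_indic; exact: mA.
have -> : f = g (finmap.enum_fset (fset_set (range f))) :> (R -> R).
  apply/funext => x; rewrite /g fimfunE fsbig_finite//.
elim: (finmap.enum_fset _) => [|y s IHs].
  rewrite (_ : g [::] = cst 0); first exact: vanishing0.
  by apply/funext => x; rewrite /g big_nil.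
rewrite (_ : g (y :: s) = (fun x => y * \1_(f @^-1` [set y]) x) \+ g s); last first.
  by apply/funext => x; rewrite /g big_cons.
apply: vanishingD => //; first by apply: measurable_sum => z; exact: mt.
exact: vanishing_level.
Qed.

(** Simple functions g n increase to f, and (f - g n)^2 <= f^2 gives convergence in L^2 by
    domination. *)
Lemma vanishing_ge0 f : measurable_fun [set: R] f -> (forall x, 0 <= f x) ->
  (sqn f < +oo)%E -> vanishing f.
Proof.
move=> mf f0 fy; apply: vanishing_approx => // d d0.
have mfE : measurable_fun [set: R] (EFin \o f) by exact/measurable_EFinP.
pose g := nnsfun_approx (@measurableT _ (measurableTypeR R)) mfE.
have gle n x : g n x <= f x.
  rewrite -lee_fin /g nnsfun_approxE; apply: (le_approx _ (D := setT)) => //.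
  by move=> t _; rewrite /= lee_fin.
have mg n : measurable_fun [set: R] (g n) by exact: (@measurable_funP _ _ _ _ setT (g n)).
have g0 n x : 0 <= g n x by [].
have gcvg x : g n x @[n --> \oo] --> f x.
  have : (EFin \o (g ^~ x)) @ \oo --> (EFin \o f) x.
    by apply: cvg_nnsfun_approx => // t _; rewrite /= lee_fin.
  by move=> /fine_cvg.
have /ge0_cvge0P : (sqn (f \- g n)%R @[n --> \oo] --> 0)%E.
  rewrite -[X in _ --> X](integral0 mu [set: R]).
  have [|||||_ _] := @dominated_convergence _ _ _ mu _ measurableT
    (fun n x => ((f x - g n x) ^+ 2)%:E) (cst 0%E) (fun x => (f x ^+ 2)%:E).
  - by move=> n; apply/measurable_EFinP/measurable_funX; exact: measurable_funB.
  - exact: measurable_cst.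
  - apply: aeW => x _; apply: cvg_EFin; first exact: nearW.
    rewrite [X in _ --> X](_ : _ = (f x - f x) ^+ 2); last by rewrite subrr expr0n.
    rewrite /comp /= expr2; under eq_fun do rewrite expr2.
    by apply: cvgM; apply: cvgB; [exact: cvg_cst|exact: gcvg|exact: cvg_cst|exact: gcvg].
  - apply: ge0_integrable => //; first exact: measurable_funX.
    by move=> x; rewrite sqr_ge0.
  - apply: aeW => x n _; rewrite gee0_abs ?lee_fin ?sqr_ge0//.
    by rewrite ler_sqr ?nnegrE ?subr_ge0// lerBlDr lerDl.
  by apply.
have sq0 n : (0 <= sqn (f \- g n)%R)%E by apply: integral_ge0 => x _; rewrite lee_fin sqr_ge0.
move=> /(_ sq0 d d0) [n _ /(_ n (leqnn n)) fgn].
exists (g n); split => //; apply: vanishing_nnsfun.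
apply: le_lt_trans fy; apply: ge0_le_integral => //.
- by move=> x _; rewrite lee_fin sqr_ge0.
- by apply/measurable_EFinP; exact: measurable_funX.
- by apply/measurable_EFinP; exact: measurable_funX.
- by move=> x _; rewrite lee_fin ler_sqr ?nnegrE.
Qed.

Lemma vanishing_sqn f : measurable_fun [set: R] f -> (sqn f < +oo)%E -> vanishing f.
Proof.
move=> mf fy.
have -> : f = f^\+ \- f^\-.
  apply/funext => x; rewrite /= /funrpos /funrneg.
  by case: (leP (f x) 0) => f0; case: (leP (- f x) 0) => f0'; lra.
have mfp : measurable_fun [set: R] f^\+ by exact: measurable_funrpos.
have mfn : measurable_fun [set: R] f^\- by exact: measurable_funrneg.
apply: vanishingB => //; apply: vanishing_ge0 => //.
- apply: le_lt_trans fy; apply: ge0_le_integral => //.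
  + by move=> x _; rewrite lee_fin sqr_ge0.
  + by apply/measurable_EFinP; exact: measurable_funX.
  + by apply/measurable_EFinP; exact: measurable_funX.
  + move=> x _; rewrite lee_fin -(real_normK (num_real (f x))) ler_sqr ?nnegrE ?funrpos_ge0//.
    by rewrite /funrpos ge_max ler_norm normr_ge0.
- apply: le_lt_trans fy; apply: ge0_le_integral => //.
  + by move=> x _; rewrite lee_fin sqr_ge0.
  + by apply/measurable_EFinP; exact: measurable_funX.
  + by apply/measurable_EFinP; exact: measurable_funX.
  + move=> x _; rewrite lee_fin -(real_normK (num_real (f x))) ler_sqr ?nnegrE ?funrneg_ge0//.
    by rewrite /funrneg ge_max -normrN ler_norm normr_ge0.
Qed.

End poisson_defect.

(** * Plancherel's formula on R^n *)

Section sqint_theory.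
Context d (T : measurableType d) (R : realType).
Variable mu : {sigma_finite_measure set T -> \bar R}.
Implicit Types f g : T -> R.

Lemma measurable_sq2 f g : measurable_fun [set: T] f -> measurable_fun [set: T] g ->
  measurable_fun [set: T] (fun x => f x ^+ 2 + g x ^+ 2).
Proof. by move=> mf mg; apply: measurable_funD; exact: measurable_funX. Qed.

End sqint_theory.

Section plancherel_line.
Context {R : realType}.
Local Notation mu := (@lebesgue_measure R).

(** The limit of [abel_parseval] along e = 1/(n+1). The damped energies converge by monotone
    convergence, to a limit not known in advance to be finite, and the defects vanish. *)
Lemma plancherel_line : plancherel mu (fun x y : R => x * y) (2 * pi).
Proof.
move=> a b inta intb ab2.
have /measurable_int/measurable_EFinP ma := inta.
have /measurable_int/measurable_EFinP mb := intb.
pose e_ n : R := n.+1%:R^-1; have e0 n : 0 < e_ n by rewrite invr_gt0.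
have sqa : (sqn a < +oo)%E.
  apply: le_lt_trans ab2; apply: ge0_le_integral => //.
  - by move=> x _; rewrite lee_fin sqr_ge0.
  - by apply/measurable_EFinP; exact: measurable_funX.
  - by apply/measurable_EFinP; exact: measurable_sq2.
  - by move=> x _; rewrite lee_fin lerDl sqr_ge0.
have sqb : (sqn b < +oo)%E.
  apply: le_lt_trans ab2; apply: ge0_le_integral => //.
  - by move=> x _; rewrite lee_fin sqr_ge0.
  - by apply/measurable_EFinP; exact: measurable_funX.
  - by apply/measurable_EFinP; exact: measurable_sq2.
  - by move=> x _; rewrite lee_fin lerDr sqr_ge0.
pose s xi := phase_int mu (fun x y : R => x * y) a b xi ^+ 2
             + phase_int mu (fun x y : R => x * y) b (\- a) xi ^+ 2.
have ms : measurable_fun [set: R] s.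
  have mph := @measurable_phase_int _ _ _ mu (fun x y : R => x * y) measurable_mul2.
  by apply: measurable_sq2; apply: mph => //; exact: measurable_funN.
have s0 xi : 0 <= s xi by rewrite addr_ge0 ?sqr_ge0.
pose J n := (\int[mu]_xi (abel (e_ n) xi * s xi)%:E)%E.
have cJ : J n @[n --> \oo] --> (\int[mu]_xi (s xi)%:E)%E.
  rewrite [X in _ --> X](_ : _ = \int[mu]_xi limn (fun n => (abel (e_ n) xi * s xi)%:E))%E.
    apply: cvg_monotone_convergence => //.
    - move=> n; apply/measurable_EFinP; apply: measurable_funM => //; exact: measurable_abel.
    - by move=> n xi _; rewrite lee_fin mulr_ge0 ?abel_ge0.
    - move=> xi _ m n mn; rewrite lee_fin ler_wpM2r// ler_expR lerN2 ler_wpM2r//.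
      by rewrite lef_pV2 ?posrE// ler_nat.
  apply: eq_integral => xi _; apply/esym/cvg_lim => //; apply: cvg_EFin; first exact: nearW.
  rewrite -[X in _ --> X]mul1r; apply: cvgMl.
  rewrite -expR0; apply: (@cvg_comp _ _ _ (fun n => - (e_ n * `|xi|)) expR _ (nbhs 0)); last exact: continuous_expR.
  rewrite -oppr0; apply: cvgN; rewrite -(mul0r `|xi|); apply: cvgMl.
  exact: cvg_harmonic.
have va := vanishing_sqn ma sqa; have vb := vanishing_sqn mb sqb.
have c1 : (2%:E * J n + (defect (e_ n) a + defect (e_ n) b) @[n --> \oo]
    --> 2%:E * \int[mu]_xi (s xi)%:E + (0 + 0))%E.
  apply: cvgeD => //; last by apply: cvgeD.
    by rewrite adde0 fin_num_adde_defl.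
  exact: cvgeZl.
have c2 : (2%:E * J n + (defect (e_ n) a + defect (e_ n) b) @[n --> \oo]
    --> (4 * pi)%:E * sqint mu a b)%E.
  under eq_fun do rewrite abel_parseval//; exact: cvg_cst.
have E : (2%:E * \int[mu]_xi (s xi)%:E = (4 * pi)%:E * sqint mu a b)%E.
  by have := cvg_unique (@ereal_hausdorff R) c1 c2; rewrite !adde0; apply.
transitivity ((2^-1 : R)%:E * (2%:E * \int[mu]_xi (s xi)%:E))%E.
  by rewrite muleA -EFinM mulVf// mul1e.
by rewrite E muleA -EFinM (_ : 2^-1 * _ = 2 * pi)//; field.
Qed.

End plancherel_line.

Section Rintegral_extras.
Context {R : realType}.

(** Negation swaps the positive and negative parts; if one of their integrals is infinite, [fine]
    returns 0 on both sides. *)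
Lemma RintegralN d (T : measurableType d) (mu : {measure set T -> \bar R}) (f : T -> R) :
  \int[mu]_x (- f x) = - \int[mu]_x f x.
Proof.
rewrite /Rintegral integralE [in RHS]integralE.
rewrite (_ : (fun x => (- f x)%:E)^\+%E = (fun x => (f x)%:E)^\-%E); last first.
  by apply/funext => x; rewrite funeposE funenegE.
rewrite (_ : (fun x => (- f x)%:E)^\-%E = (fun x => (f x)%:E)^\+%E); last first.
  by apply/funext => x; rewrite funeposE funenegE EFinN oppeK.
have : (0 <= \int[mu]_x (fun x => (f x)%:E)^\+ x)%E by exact: integral_ge0.
have : (0 <= \int[mu]_x (fun x => (f x)%:E)^\- x)%E by exact: integral_ge0.
by case: integral => [r| |]; case: integral => [s| |] //= _ _; rewrite ?oppr0// opprB.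
Qed.

Context d1 d2 (T1 : measurableType d1) (T2 : measurableType d2).
Variables (m1 : {sigma_finite_measure set T1 -> \bar R}) (m2 : {sigma_finite_measure set T2 -> \bar R}).
Variable h : T1 * T2 -> R.
Hypothesis ih : (prodm m1 m2).-integrable [set: T1 * T2] (EFin \o h).

Let mh : measurable_fun [set: T1 * T2] h.
Proof. by have /measurable_int/measurable_EFinP := ih. Qed.

Lemma integrable_Rintegral :
  m1.-integrable [set: T1] (fun x => (\int[m2]_y h (x, y))%:E).
Proof.
apply: le_integrable (integrable_fubini_F ih) => //.
  by apply/measurable_EFinP; exact: measurable_Rintegral.
by move=> x _; rewrite /fubini_F /Rintegral; case: integral => [r| |] //=; rewrite normr0 leey.
Qed.

Lemma Rintegral_prod : \int[prodm m1 m2]_p h p = \int[m1]_x \int[m2]_y h (x, y).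
Proof.
apply: EFin_inj; rewrite EFin_Rintegral// -(integral12_prod_meas1 ih).
rewrite EFin_Rintegral; last exact: integrable_Rintegral.
(* The real and the extended integral of a slice agree where the slice is integrable, which is
   almost everywhere. *)
apply: ae_eq_integral => //.
- exact: (measurable_fubini_F ih).
- by apply/measurable_EFinP; exact: measurable_Rintegral.
have := ae_integrable1 ih; apply: filterS => x ihx _.
by rewrite EFin_Rintegral.
Qed.

End Rintegral_extras.

Lemma phase_intN d (T : measurableType d) (R : realType)
    (mu : {sigma_finite_measure set T -> \bar R}) (theta : T -> T -> R) (f g : T -> R) xi :
  phase_int mu theta (\- f) (\- g) xi = - phase_int mu theta f g xi.
Proof.
by rewrite /phase_int -RintegralN; apply: eq_Rintegral => x _; rewrite !mulNr opprD.
Qed.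

Section plancherel_prod.
Context {R : realType} d1 d2 (T1 : measurableType d1) (T2 : measurableType d2).
Variables (m1 : {sigma_finite_measure set T1 -> \bar R}) (m2 : {sigma_finite_measure set T2 -> \bar R}).
Variables (theta1 : T1 -> T1 -> R) (theta2 : T2 -> T2 -> R).
Hypothesis mtheta1 : measurable_fun [set: T1 * T1] (fun p => theta1 p.1 p.2).
Hypothesis mtheta2 : measurable_fun [set: T2 * T2] (fun p => theta2 p.1 p.2).

Definition phase_add (p q : T1 * T2) : R := theta1 p.1 q.1 + theta2 p.2 q.2.

Lemma measurable_phase_add :
  measurable_fun [set: (T1 * T2) * (T1 * T2)] (fun p => phase_add p.1 p.2).
Proof.
apply: measurable_funD.
- apply: (@measurableT_comp _ _ _ _ _ _ (fun p : T1 * T1 => theta1 p.1 p.2) _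
    (fun p : (T1 * T2) * (T1 * T2) => (p.1.1, p.2.1)) mtheta1).
  by apply: measurable_fun_pair; exact: measurableT_comp.
- apply: (@measurableT_comp _ _ _ _ _ _ (fun p : T2 * T2 => theta2 p.1 p.2) _
    (fun p : (T1 * T2) * (T1 * T2) => (p.1.2, p.2.2)) mtheta2).
  by apply: measurable_fun_pair; exact: measurableT_comp.
Qed.

Implicit Types f g : T1 * T2 -> R.

(** Real part of the transform of f + i g in the second variable alone: [p.1] is still a point,
    [p.2] is already a frequency. The imaginary part is [partial_int g (\- f)]. *)
Definition partial_int f g (p : T1 * T2) :=
  phase_int m2 theta2 (fun y => f (p.1, y)) (fun y => g (p.1, y)) p.2.

Lemma partial_intN f g p : partial_int (\- f) (\- g) p = - partial_int f g p.
Proof. exact: phase_intN. Qed.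

Lemma measurable_partial_int f g : measurable_fun [set: T1 * T2] f ->
  measurable_fun [set: T1 * T2] g -> measurable_fun [set: T1 * T2] (partial_int f g).
Proof.
move=> mf mg.
pose phi (q : (T1 * T2) * T2) := f (q.1.1, q.2) * cos (theta2 q.2 q.1.2)
  + g (q.1.1, q.2) * sin (theta2 q.2 q.1.2).
apply: (@measurable_Rintegral _ _ _ _ _ m2 phi).
have mp : measurable_fun [set: (T1 * T2) * T2] (fun q => (q.1.1, q.2)).
  by apply: measurable_fun_pair => //; exact: measurableT_comp.
have mth : measurable_fun [set: (T1 * T2) * T2] (fun q => theta2 q.2 q.1.2).
  apply: (@measurableT_comp _ _ _ _ _ _ (fun p : T2 * T2 => theta2 p.1 p.2) _
    (fun q : (T1 * T2) * T2 => (q.2, q.1.2)) mtheta2).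
  by apply: measurable_fun_pair => //; exact: measurableT_comp.
apply: measurable_funD; apply: measurable_funM.
- exact: (measurableT_comp mf mp).
- by apply: measurableT_comp mth => //; apply: continuous_measurable_fun; exact: continuous_cos.
- exact: (measurableT_comp mg mp).
- by apply: measurableT_comp mth => //; apply: continuous_measurable_fun; exact: continuous_sin.
Qed.

Section slices.
Variables f g : T1 * T2 -> R.
Hypotheses (intf : (prodm m1 m2).-integrable [set: T1 * T2] (EFin \o f))
           (intg : (prodm m1 m2).-integrable [set: T1 * T2] (EFin \o g)).

Let mf : measurable_fun [set: T1 * T2] f.
Proof. by have /measurable_int/measurable_EFinP := intf. Qed.
Let mg : measurable_fun [set: T1 * T2] g.
Proof. by have /measurable_int/measurable_EFinP := intg. Qed.

Lemma integrable_partial_int eta :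
  m1.-integrable [set: T1] (fun x => (partial_int f g (x, eta))%:E).
Proof.
pose h (p : T1 * T2) := f p * cos (theta2 p.2 eta) + g p * sin (theta2 p.2 eta).
apply: (@integrable_Rintegral _ _ _ _ _ m1 m2 h).
apply: integrable_rot => //; apply: (measurableT_comp (measurable_theta mtheta2 eta)).
exact: measurable_snd.
Qed.

(** The exponential of a sum of phases factors; in real form these are the addition formulas for cos
    and sin, applied on the integrable slices. *)
Lemma phase_int_prod xi : phase_int (prodm m1 m2) phase_add f g xi =
  phase_int m1 theta1 (fun x => partial_int f g (x, xi.2))
                      (fun x => partial_int g (\- f) (x, xi.2)) xi.1.
Proof.
have ih := integrable_phase measurable_phase_add xi intf intg.
rewrite {1}/phase_int Rintegral_prod//.
have mth1 : measurable_fun [set: T1] (theta1 ^~ xi.1) by exact: measurable_theta.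
have mF : measurable_fun [set: T1] (fun x => partial_int f g (x, xi.2)).
  exact: measurableT_comp (measurable_partial_int mf mg) (measurable_pair2 _).
have mG : measurable_fun [set: T1] (fun x => partial_int g (\- f) (x, xi.2)).
  apply: measurableT_comp (measurable_partial_int mg _) (measurable_pair2 _).
  exact: measurable_funN.
rewrite /Rintegral; congr fine; apply: ae_eq_integral => //.
- apply/measurable_EFinP; apply: (@measurable_Rintegral _ _ _ _ _ m2
    (fun p => f p * cos (phase_add p xi) + g p * sin (phase_add p xi))).
  by have /measurable_int/measurable_EFinP := ih.
- apply/measurable_EFinP/measurable_funD; apply: measurable_funM => //.
  + by apply: measurableT_comp mth1 => //; apply: continuous_measurable_fun; exact: continuous_cos.
  + by apply: measurableT_comp mth1 => //; apply: continuous_measurable_fun; exact: continuous_sin.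
have := ae_integrable1 intf; have := ae_integrable1 intg.
apply: filterS2 => x igx ifx _; congr EFin.
have infx : m2.-integrable [set: T2] (EFin \o (fun y => - f (x, y))).
  exact: (integrableN ifx).
set c := cos (theta1 x xi.1); set s := sin (theta1 x xi.1).
rewrite /partial_int /phase_int/= -!RintegralZr//; last 2 first.
- exact: (integrable_phase mtheta2 _ igx infx).
- exact: (integrable_phase mtheta2 _ ifx igx).
rewrite -RintegralD//; last 2 first.
- exact: (integrableZr measurableT c (integrable_phase mtheta2 xi.2 ifx igx)).
- exact: (integrableZr measurableT s (integrable_phase mtheta2 xi.2 igx infx)).
apply: eq_Rintegral => y _; rewrite /phase_add/= cosD sinD -/c -/s; ring.
Qed.

End slices.

Section sqint_fubini.
Variables f g : T1 * T2 -> R.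
Hypotheses (mf : measurable_fun [set: T1 * T2] f) (mg : measurable_fun [set: T1 * T2] g).

Let mfg : measurable_fun [set: T1 * T2] (fun p => (f p ^+ 2 + g p ^+ 2)%:E).
Proof. by apply/measurable_EFinP; exact: measurable_sq2. Qed.

Let fg0 p : (0 <= (f p ^+ 2 + g p ^+ 2)%:E)%E.
Proof. by rewrite lee_fin addr_ge0 ?sqr_ge0. Qed.

Lemma measurable_sqint1 :
  measurable_fun [set: T1] (fun x => sqint m2 (fun y => f (x, y)) (fun y => g (x, y))).
Proof. exact: (@measurable_fun_fubini_tonelli_F _ _ _ _ _ m2 _ mfg fg0). Qed.

Lemma measurable_sqint2 :
  measurable_fun [set: T2] (fun y => sqint m1 (fun x => f (x, y)) (fun x => g (x, y))).
Proof. exact: (@measurable_fun_fubini_tonelli_G _ _ _ _ _ m1 _ mfg fg0). Qed.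

Lemma integral_sqint1 :
  (\int[m1]_x sqint m2 (fun y => f (x, y)) (fun y => g (x, y)) = sqint (prodm m1 m2) f g)%E.
Proof. by rewrite [RHS](fubini_tonelli1 _ mfg fg0). Qed.

Lemma integral_sqint2 :
  (\int[m2]_y sqint m1 (fun x => f (x, y)) (fun x => g (x, y)) = sqint (prodm m1 m2) f g)%E.
Proof. by rewrite [RHS](fubini_tonelli2 _ mfg fg0). Qed.

Hypothesis fgy : (sqint (prodm m1 m2) f g < +oo)%E.

Lemma ae_sqint1 : {ae m1, forall x, (sqint m2 (fun y => f (x, y)) (fun y => g (x, y)) < +oo)%E}.
Proof.
have : m1.-integrable [set: T1] (fun x => sqint m2 (fun y => f (x, y)) (fun y => g (x, y))).
  apply/integrableP; split; first exact: measurable_sqint1.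
  by under eq_integral do rewrite gee0_abs ?sqint_ge0//; rewrite integral_sqint1.
move=> /(integrable_ae measurableT); apply: filterS => x /(_ I).
by rewrite ge0_fin_numE// sqint_ge0.
Qed.

Lemma ae_sqint2 : {ae m2, forall y, (sqint m1 (fun x => f (x, y)) (fun x => g (x, y)) < +oo)%E}.
Proof.
have : m2.-integrable [set: T2] (fun y => sqint m1 (fun x => f (x, y)) (fun x => g (x, y))).
  apply/integrableP; split; first exact: measurable_sqint2.
  by under eq_integral do rewrite gee0_abs ?sqint_ge0//; rewrite integral_sqint2.
move=> /(integrable_ae measurableT); apply: filterS => x /(_ I).
by rewrite ge0_fin_numE// sqint_ge0.
Qed.

End sqint_fubini.

(* Plancherel in the first variable at almost every frequency of the second
   one, then in the second variable at almost every point of the first one. *)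
Lemma plancherel_prod c1 c2 : 0 <= c1 -> 0 <= c2 ->
  plancherel m1 theta1 c1 -> plancherel m2 theta2 c2 ->
  plancherel (prodm m1 m2) phase_add (c1 * c2).
Proof.
move=> c10 c20 P1 P2 f g intf intg fg2.
have /measurable_int/measurable_EFinP mf := intf.
have /measurable_int/measurable_EFinP mg := intg.
have mnf : measurable_fun [set: T1 * T2] (\- f) by exact: measurable_funN.
have intnf : (prodm m1 m2).-integrable [set: T1 * T2] (EFin \o (\- f)).
  exact: (integrableN intf).
pose F := partial_int f g; pose G := partial_int g (\- f).
have mF : measurable_fun [set: T1 * T2] F by exact: measurable_partial_int.
have mG : measurable_fun [set: T1 * T2] G by exact: measurable_partial_int.
(* Partial transform in the second variable, at almost every point x of the first. *)
have FG : (sqint (prodm m1 m2) F G = c2%:E * sqint (prodm m1 m2) f g)%E.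
  rewrite -!integral_sqint1// -ge0_integralZl//; last 2 first.
  - exact: measurable_sqint1.
  - by move=> x _; exact: sqint_ge0.
  apply: ge0_ae_eq_integral => //.
  - exact: measurable_sqint1.
  - by apply: measurable_funeM; exact: measurable_sqint1.
  - by move=> x _; exact: sqint_ge0.
  - by move=> x _; rewrite mule_ge0 ?lee_fin ?sqint_ge0.
  have := ae_sqint1 mf mg fg2.
  have := ae_integrable1 intf; have := ae_integrable1 intg.
  apply: filterS3 => x igx ifx fgx _.
  by rewrite -P2.
have FGy : (sqint (prodm m1 m2) F G < +oo)%E.
  by rewrite FG lte_mul_pinfty// lee_fin.
have mph f' g' : measurable_fun [set: T1 * T2] f' -> measurable_fun [set: T1 * T2] g' ->
    measurable_fun [set: T1 * T2] (phase_int (prodm m1 m2) phase_add f' g').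
  by move=> ? ?; apply: measurable_phase_int => //; exact: measurable_phase_add.
rewrite EFinM -muleA -FG -!integral_sqint2//; last 2 first.
- exact: mph.
- exact: mph.
rewrite -ge0_integralZl//; last 2 first.
- exact: measurable_sqint2.
- by move=> x _; exact: sqint_ge0.
apply: ge0_ae_eq_integral => //.
- by apply: measurable_sqint2; exact: mph.
- by apply: measurable_funeM; exact: measurable_sqint2.
- by move=> x _; exact: sqint_ge0.
- by move=> x _; rewrite mule_ge0 ?lee_fin ?sqint_ge0.
have := ae_sqint2 mF mG FGy; apply: filterS => eta FGeta _.
rewrite -P1//; last 2 first.
- exact: integrable_partial_int.
- exact: integrable_partial_int.
apply: eq_integral => xi _; congr (_ ^+ 2 + _ ^+ 2)%:E.
  by rewrite phase_int_prod.
rewrite phase_int_prod//; congr (phase_int _ _ _ _ _).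
by apply/funext => x; rewrite partial_intN.
Qed.

End plancherel_prod.

(** * Transfer of Plancherel's formula to an image measure *)

Section plancherel_image.
Context {R : realType} d1 d2 (T1 : measurableType d1) (T2 : measurableType d2).
Variables (mu : {sigma_finite_measure set T1 -> \bar R}) (nu : {sigma_finite_measure set T2 -> \bar R}).
Variable phi : T1 -> T2.
Hypothesis mphi : measurable_fun [set: T1] phi.
Hypothesis nuE : forall A, measurable A -> nu A = mu (phi @^-1` A).

Lemma ge0_integral_image (f : T2 -> \bar R) : measurable_fun [set: T2] f ->
  (forall y, 0 <= f y)%E -> (\int[nu]_y f y = \int[mu]_x f (phi x))%E.
Proof.
move=> mf f0; rewrite (eq_measure_integral (pushforward mu phi)); last first.
  by move=> A mA _; exact: nuE.
by rewrite ge0_integral_pushforward.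
Qed.

Lemma integrable_image (f : T2 -> R) : nu.-integrable [set: T2] (EFin \o f) ->
  mu.-integrable [set: T1] (EFin \o (f \o phi)).
Proof.
move=> /integrableP[mf fy]; apply/integrableP; split; first exact: (measurableT_comp mf).
rewrite -(ge0_integral_image (f := fun y => `|(f y)%:E|%E))//.
exact: measurableT_comp.
Qed.

Lemma Rintegral_image (f : T2 -> R) : nu.-integrable [set: T2] (EFin \o f) ->
  \int[nu]_y f y = \int[mu]_x f (phi x).
Proof.
move=> intf; rewrite /Rintegral; congr fine.
rewrite (eq_measure_integral (pushforward mu phi)); last first.
  by move=> A mA _; exact: nuE.
rewrite integral_pushforward//; first by case/integrableP: intf.
exact: integrable_image.
Qed.

Variable theta : T2 -> T2 -> R.
Hypothesis mtheta : measurable_fun [set: T2 * T2] (fun p => theta p.1 p.2).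

(** Point and frequency are both transported by [phi]. It is applied to [rn_cons], through which
    [leb R n.+1] is defined as an image of a product. *)
Lemma plancherel_image c :
  plancherel mu (fun x y => theta (phi x) (phi y)) c -> plancherel nu theta c.
Proof.
move=> P f g intf intg fg2.
have /measurable_int/measurable_EFinP mf := intf.
have /measurable_int/measurable_EFinP mg := intg.
have mnf : measurable_fun [set: T2] (\- f) by exact: measurable_funN.
have intnf : nu.-integrable [set: T2] (EFin \o (\- f)) by exact: (integrableN intf).
have sqE u v : measurable_fun [set: T2] u -> measurable_fun [set: T2] v ->
    sqint nu u v = sqint mu (u \o phi) (v \o phi).
  move=> mu_ mv; rewrite /sqint ge0_integral_image//.
    by apply/measurable_EFinP; exact: measurable_sq2.
  by move=> y; rewrite lee_fin addr_ge0 ?sqr_ge0.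
rewrite sqE; [|exact: measurable_phase_int..].
rewrite (sqE f g)// -P; [|exact: integrable_image..|by rewrite -sqE].
congr sqint; apply/funext => x; rewrite /= /phase_int Rintegral_image//.
- exact: integrable_phase.
- exact: integrable_phase.
Qed.

End plancherel_image.

Section plancherel_Rn.
Context {R : realType}.

Lemma measurable_dotp n :
  measurable_fun [set: Rn R n * Rn R n] (fun p : Rn R n * Rn R n => dotp p.1 p.2).
Proof.
apply: measurable_sum => i; apply: measurable_funM.
- exact: (measurableT_comp (measurable_tnth i)).
- exact: (measurableT_comp (measurable_tnth i)).
Qed.

Lemma dotp_cons n (p q : measurableTypeR R * Rn R n) :
  dotp (rn_cons p) (rn_cons q) = p.1 * q.1 + dotp p.2 q.2.
Proof.
rewrite /dotp big_ord_recl; congr (_ + _); apply: eq_bigr => i _.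
by rewrite /rn_cons !tnthS.
Qed.

Lemma integral_leb0 (f : Rn R 0 -> \bar R) : (\int[leb R 0]_x f x = f [tuple])%E.
Proof.
rewrite (_ : f = cst (f [tuple])).
  by rewrite integral_cst//= diracE in_setT mule1.
by apply/funext => x; rewrite (tuple0 x).
Qed.

Lemma plancherel_Rn n : plancherel (leb R n) (@dotp R n) ((2 * pi) ^+ n).
Proof.
elim: n => [|n IHn].
  (* In dimension 0 the space is one point of mass 1 and the phase is 0, so the transform is the
     identity. *)
  move=> f g _ _ _; rewrite expr0 mul1e /sqint !integral_leb0 /phase_int.
  by rewrite /Rintegral !integral_leb0 /dotp big_ord0 cos0 sin0 /= !mulr0 !mulr1 !addr0.
have pi20 : 0 <= 2 * pi :> R by rewrite mulr_ge0// pi_ge0.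
have Pprod := @plancherel_prod R _ _ (measurableTypeR R) _ lebesgue_measure (leb R n)
  (fun x y => x * y) (@dotp R n) measurable_mul2 (@measurable_dotp n) _ _
  pi20 (exprn_ge0 n pi20) plancherel_line IHn.
rewrite exprS; apply: (@plancherel_image _ _ _ _ _ (prodm lebesgue_measure (leb R n)) (leb R n.+1)
  (@rn_cons R n) (@measurable_rn_cons R n)) => //.
- exact: measurable_dotp.
- rewrite (_ : (fun x y => _) = phase_add (fun x y : R => x * y) (@dotp R n)).
    exact: Pprod.
  by apply/funext => x; apply/funext => y; exact: dotp_cons.
Qed.

End plancherel_Rn.

(** * Complex square-integrable functions *)

Lemma normc_sq (R : rcfType) (z : R[i]) :
  normc z ^+ 2 = complex.Re z ^+ 2 + complex.Im z ^+ 2.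
Proof. by case: z => a b /=; rewrite sqr_sqrtr ?addr_ge0 ?sqr_ge0. Qed.

Lemma normc_nonneg (R : rcfType) (z : R[i]) : 0 <= normc z.
Proof. by case: z => a b /=; exact: sqrtr_ge0. Qed.

Lemma normc_Re (R : rcfType) (z : R[i]) : `|complex.Re z| <= normc z.
Proof.
rewrite -(@ler_sqr _ `|_|) ?nnegrE ?normc_nonneg//.
by rewrite normc_sq real_normK ?num_real// lerDl sqr_ge0.
Qed.

Lemma normc_Im (R : rcfType) (z : R[i]) : `|complex.Im z| <= normc z.
Proof.
rewrite -(@ler_sqr _ `|_|) ?nnegrE ?normc_nonneg//.
by rewrite normc_sq real_normK ?num_real// lerDr sqr_ge0.
Qed.

(** The constant 2, in place of the square root of 2, keeps the later arithmetic rational. *)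
Lemma normc_le_Re_Im (R : rcfType) (z : R[i]) (m : R) :
  `|complex.Re z| <= m -> `|complex.Im z| <= m -> normc z <= 2 * m.
Proof.
move=> zr zi; have m0 : 0 <= m by rewrite (le_trans _ zr).
rewrite -(@ler_sqr _ (normc z)) ?nnegrE ?normc_nonneg ?mulr_ge0// normc_sq.
rewrite -(real_normK (num_real (complex.Re z))) -(real_normK (num_real (complex.Im z))).
have := @ler_sqr _ `|complex.Re z| m; rewrite zr !nnegrE normr_ge0 m0 => /(_ isT isT) h1.
have := @ler_sqr _ `|complex.Im z| m; rewrite zi !nnegrE normr_ge0 m0 => /(_ isT isT) h2.
by rewrite exprMn; have := sqr_ge0 m; lra.
Qed.

Section csq_theory.
Context (R : realType) (N : nat).
Notation V := (Rn R N).
Notation mu := (leb R N).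
Implicit Types (f g h : V -> R[i]).

(** The square of [L2norm], in the form on which Plancherel's formula acts; the estimates below are
    made on it. *)
Definition csq f := sqint mu (fun x => complex.Re (f x)) (fun x => complex.Im (f x)).

Lemma csq_ge0 f : (0 <= csq f)%E. Proof. exact: sqint_ge0. Qed.

Lemma csqE f : csq f = (\int[mu]_x (normc (f x) ^+ 2)%:E)%E.
Proof. by apply: eq_integral => x _; rewrite normc_sq. Qed.

Lemma L2norm_le f (e : R) : 0 <= e -> (L2norm f <= e%:E)%E = (csq f <= (e ^+ 2)%:E)%E.
Proof.
move=> e0; have -> : L2norm f = ((csq f) `^ 2^-1)%E.
  rewrite /L2norm unlock csqE; congr (_ `^ _)%E; apply: eq_integral => x _.
  rewrite gee0_abs ?lee_fin ?normc_nonneg// poweR_EFin.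
  by rewrite -(powR_mulrn 2 (normc_nonneg _)).
rewrite poweR12_sqrt ?csq_ge0//.
have := csq_ge0 f; case: (csq f) => [r| |] //= r0; rewrite !lee_fin in r0 *.
by rewrite -{1}(ger0_norm e0) -sqrtr_sqr ler_sqrt// sqr_ge0.
Qed.

Lemma L2norm_lty f : (L2norm f < +oo)%E = (csq f < +oo)%E.
Proof.
apply/idP/idP => fy.
  have f0 : (0 <= L2norm f)%E by exact: Lnorm_ge0.
  have /fineK ffin : L2norm f \is a fin_num by rewrite ge0_fin_numE.
  have : (L2norm f <= (fine (L2norm f))%:E)%E by rewrite ffin.
  by rewrite L2norm_le ?fine_ge0// => /le_lt_trans; apply; rewrite ltry.
have /fineK ffin : csq f \is a fin_num by rewrite ge0_fin_numE// csq_ge0.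
have : (L2norm f <= (Num.sqrt (fine (csq f)))%:E)%E.
  by rewrite L2norm_le ?sqrtr_ge0// sqr_sqrtr ?fine_ge0 ?csq_ge0// ffin.
by move=> /le_lt_trans; apply; rewrite ltry.
Qed.

Lemma L2norm_cvg0 (f : nat -> V -> R[i]) :
  (L2norm (f k) @[k --> \oo] --> 0)%E <-> (csq (f k) @[k --> \oo] --> 0)%E.
Proof.
have L0 k : (0 <= L2norm (f k))%E by exact: Lnorm_ge0.
have Q0 k : (0 <= csq (f k))%E by exact: csq_ge0.
split=> [/(ge0_cvge0P L0) H|/(ge0_cvge0P Q0) H]; [apply/(ge0_cvge0P Q0)|apply/(ge0_cvge0P L0)] => e e0.
  have se0 : 0 < Num.sqrt e by rewrite sqrtr_gt0.
  apply: filterS (H _ se0) => k.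
  by rewrite L2norm_le ?(ltW se0)// sqr_sqrtr// ltW.
have se0 : 0 < e ^+ 2 by rewrite exprn_gt0.
apply: filterS (H _ se0) => k.
by rewrite L2norm_le// ltW.
Qed.

Lemma inL2E f : inL2 f <-> cmeasurable f /\ (csq f < +oo)%E.
Proof. by rewrite /inL2 L2norm_lty. Qed.

Lemma cmeasurableD f g : cmeasurable f -> cmeasurable g -> cmeasurable (f \+ g).
Proof.
move=> [mfr mfi] [mgr mgi]; split.
- rewrite (_ : (fun x => _) = (fun x => complex.Re (f x) + complex.Re (g x))).
    exact: measurable_funD.
  by apply/funext => x /=; case: (f x); case: (g x).
- rewrite (_ : (fun x => _) = (fun x => complex.Im (f x) + complex.Im (g x))).
    exact: measurable_funD.
  by apply/funext => x /=; case: (f x); case: (g x).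
Qed.

Lemma cmeasurableN f : cmeasurable f -> cmeasurable (\- f).
Proof.
move=> [mfr mfi]; split.
- rewrite (_ : (fun x => _) = (fun x => - complex.Re (f x))).
    exact: measurable_funN.
  by apply/funext => x /=; case: (f x).
- rewrite (_ : (fun x => _) = (fun x => - complex.Im (f x))).
    exact: measurable_funN.
  by apply/funext => x /=; case: (f x).
Qed.

Lemma cmeasurableB f g : cmeasurable f -> cmeasurable g -> cmeasurable (f \- g).
Proof. by move=> mf mg; apply: cmeasurableD => //; exact: cmeasurableN. Qed.

Lemma measurable_normc f : cmeasurable f -> measurable_fun [set: V] (fun x => normc (f x)).
Proof.
move=> [mr mi].
rewrite (_ : (fun x => _) = (fun x => Num.sqrt (complex.Re (f x) ^+ 2 + complex.Im (f x) ^+ 2))).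
  apply: measurableT_comp; last exact: measurable_sq2.
  apply: continuous_measurable_fun; exact: sqrt_continuous.
by apply/funext => x; case: (f x).
Qed.

Lemma measurable_normc_sq f : cmeasurable f ->
  measurable_fun [set: V] (fun x => (normc (f x) ^+ 2)%:E).
Proof. by move=> mf; apply/measurable_EFinP/measurable_funX; exact: measurable_normc. Qed.

Lemma le_csq f g (C : R) : 0 <= C -> cmeasurable f -> cmeasurable g ->
  {ae mu, forall x, normc (f x) ^+ 2 <= C * normc (g x) ^+ 2} -> (csq f <= C%:E * csq g)%E.
Proof.
move=> C0 mf mg fg; rewrite !csqE -ge0_integralZl//; last 2 first.
- exact: measurable_normc_sq.
- by move=> x _; rewrite lee_fin sqr_ge0.
apply: ae_ge0_le_integral => //.
- by move=> x _; rewrite lee_fin sqr_ge0.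
- exact: measurable_normc_sq.
- by move=> x _; rewrite -EFinM lee_fin mulr_ge0 ?sqr_ge0.
- by apply: measurable_funeM; exact: measurable_normc_sq.
- by apply: filterS fg => x h _; rewrite -EFinM lee_fin.
Qed.

Lemma normc_sqD (z w : R[i]) : normc (z + w) ^+ 2 <= 2 * normc z ^+ 2 + 2 * normc w ^+ 2.
Proof.
rewrite !normc_sq; case: z w => [a b] [c d] /=.
rewrite -subr_ge0 [leRHS](_ : _ = (a - c) ^+ 2 + (b - d) ^+ 2); last by ring.
by rewrite addr_ge0 ?sqr_ge0.
Qed.

Lemma csqD f g : cmeasurable f -> cmeasurable g ->
  (csq (f \+ g)%R <= 2%:E * csq f + 2%:E * csq g)%E.
Proof.
move=> mf mg; have mf2 := measurable_normc_sq mf; have mg2 := measurable_normc_sq mg.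
rewrite !csqE -!ge0_integralZl//; last 2 first.
- by move=> x _; rewrite lee_fin sqr_ge0.
- by move=> x _; rewrite lee_fin sqr_ge0.
rewrite -ge0_integralD//; last 4 first.
- by move=> x _; rewrite -EFinM lee_fin mulr_ge0 ?sqr_ge0.
- exact: measurable_funeM.
- by move=> x _; rewrite -EFinM lee_fin mulr_ge0 ?sqr_ge0.
- exact: measurable_funeM.
apply: ge0_le_integral => //.
- by move=> x _; rewrite lee_fin sqr_ge0.
- by apply: (@measurable_normc_sq (f \+ g)); exact: cmeasurableD.
- by apply: emeasurable_funD; exact: measurable_funeM.
- by move=> x _; rewrite -!EFinM -EFinD lee_fin normc_sqD.
Qed.

Lemma csqN f : csq (\- f) = csq f.
Proof. by rewrite !csqE; apply: eq_integral => x _ /=; rewrite normcN. Qed.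

Lemma csqB f g : cmeasurable f -> cmeasurable g ->
  (csq (f \- g)%R <= 2%:E * csq f + 2%:E * csq g)%E.
Proof. by move=> mf mg; rewrite -(csqN g); apply: csqD => //; exact: cmeasurableN. Qed.

Lemma csq_eq0 f : cmeasurable f -> csq f = 0%E -> {ae mu, forall x, f x = 0}.
Proof.
move=> mf; rewrite csqE => f0.
have := ae_eq_integral_abs mu measurableT (measurable_normc_sq mf).
rewrite (eq_integral (fun x => (normc (f x) ^+ 2)%:E)); last first.
  by move=> x _; rewrite gee0_abs ?lee_fin ?sqr_ge0.
move=> /iffLR/(_ f0); apply: filterS => x /(_ I) [] /eqP.
by rewrite sqrf_eq0 => /eqP/eq0_normc.
Qed.

End csq_theory.

(** * The Fourier transform of integrable functions *)

Section fourier_L1.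
Context (R : realType) (N : nat).
Notation V := (Rn R N).
Notation mu := (leb R N).
Implicit Types (f g h : V -> R[i]).

Lemma L1normE f : L1norm f = (\int[mu]_x (normc (f x))%:E)%E.
Proof.
rewrite /L1norm Lnorm1; apply: eq_integral => x _.
by rewrite gee0_abs// lee_fin normc_nonneg.
Qed.

Lemma inL1P f : cmeasurable f ->
  (L1norm f < +oo)%E <-> mu.-integrable [set: V] (EFin \o (fun x => normc (f x))).
Proof.
move=> mf; split=> [fy|/integrableP[_]].
  apply: ge0_integrable; first exact: measurable_normc.
    by move=> x; exact: normc_nonneg.
  by rewrite -L1normE.
by rewrite L1normE; under eq_integral do rewrite /= ger0_norm ?normc_nonneg//.
Qed.

Lemma inL1_integrable f : inL1 f ->
  mu.-integrable [set: V] (EFin \o (fun x => complex.Re (f x))) /\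
  mu.-integrable [set: V] (EFin \o (fun x => complex.Im (f x))).
Proof.
move=> [mf /(inL1P mf) fi]; have [mr mi] := mf; split.
- apply: le_integrable fi => //; first exact/measurable_EFinP.
  by move=> x _; rewrite /= lee_fin (ger0_norm (normc_nonneg _)) normc_Re.
- apply: le_integrable fi => //; first exact/measurable_EFinP.
  by move=> x _; rewrite /= lee_fin (ger0_norm (normc_nonneg _)) normc_Im.
Qed.

Lemma inL1B f g : inL1 f -> inL1 g -> inL1 (f \- g).
Proof.
move=> [mf /(inL1P mf) fi] [mg /(inL1P mg) gi]; have mfg := cmeasurableB mf mg.
split=> //; apply/inL1P => //; apply: le_integrable (integrableD _ fi gi) => //.
  by apply/measurable_EFinP; exact: measurable_normc.
move=> x _; rewrite /= lee_fin !ger0_norm ?addr_ge0 ?normc_nonneg//.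
by rewrite -(normcN (g x)) le_normcD.
Qed.

Lemma inL2B f g : inL2 f -> inL2 g -> inL2 (f \- g).
Proof.
move=> /inL2E[mf fy] /inL2E[mg gy]; apply/inL2E; split; first exact: cmeasurableB.
apply: le_lt_trans (csqB mf mg) _.
by rewrite lte_add_pinfty// lte_mul_pinfty// lee_fin.
Qed.

Lemma fourierL1E f xi : fourierL1 f xi =
  (phase_int mu (@dotp R N) (fun x => complex.Re (f x)) (fun x => complex.Im (f x)) xi) +i*
  (phase_int mu (@dotp R N) (fun x => complex.Im (f x)) (\- (fun x => complex.Re (f x))) xi).
Proof.
rewrite /fourierL1 /cintegral /phase_int; congr (_ +i* _);
  apply: eq_Rintegral => x _ /=; case: (f x) => a b /=; ring.
Qed.

Lemma cmeasurable_fourierL1 f : inL1 f -> cmeasurable (fourierL1 f).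
Proof.
move=> [[mr mi] _]; split.
- under eq_fun do rewrite fourierL1E /=.
  by apply: measurable_phase_int => //; exact: measurable_dotp.
- under eq_fun do rewrite fourierL1E /=.
  apply: measurable_phase_int => //; first exact: measurable_dotp.
  exact: measurable_funN.
Qed.

Lemma plancherel_L1L2 f : inL1 f -> inL2 f -> csq (fourierL1 f) = (((2 * pi) ^+ N)%:E * csq f)%E.
Proof.
move=> f1 /inL2E[mf fy]; have [ir ii] := inL1_integrable f1.
rewrite -(plancherel_Rn ir ii fy); apply: eq_integral => x _.
by rewrite fourierL1E.
Qed.

Lemma fourierL1B f g xi : inL1 f -> inL1 g ->
  fourierL1 (f \- g) xi = fourierL1 f xi - fourierL1 g xi.
Proof.
move=> f1 g1; have [fr fi] := inL1_integrable f1; have [gr gi] := inL1_integrable g1.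
have nR h : mu.-integrable [set: V] (EFin \o (fun x => complex.Re (h x))) ->
   mu.-integrable [set: V] (EFin \o (\- (fun x => complex.Re (h x)))).
  by move=> ih; exact: (integrableN ih).
have ph u v : mu.-integrable [set: V] (EFin \o u) -> mu.-integrable [set: V] (EFin \o v) ->
    mu.-integrable [set: V] (EFin \o (fun x => u x * cos (dotp x xi) + v x * sin (dotp x xi))).
  by move=> iu iv; apply: integrable_phase => //; exact: measurable_dotp.
rewrite !fourierL1E /phase_int.
rewrite -[RHS]/(_ +i* _); congr (_ +i* _).
- rewrite -RintegralB//; [|exact: ph..].
  by apply: eq_Rintegral => x _ /=; case: (f x) => a b; case: (g x) => c d /=; ring.
- rewrite -RintegralB//; [|by apply: ph => //; exact: nR..].
  by apply: eq_Rintegral => x _ /=; case: (f x) => a b; case: (g x) => c d /=; ring.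
Qed.

(** The factor 4 is 2 for the cosine and sine terms of each component, times 2 for the two
    components. *)
Lemma normc_fourierL1_le f xi : inL1 f -> normc (fourierL1 f xi) <= 4 * fine (L1norm f).
Proof.
move=> f1; have [ir ii] := inL1_integrable f1; have [mf fy] := f1.
have fi := (inL1P mf).1 fy.
have bnd u v : mu.-integrable [set: V] (EFin \o u) -> mu.-integrable [set: V] (EFin \o v) ->
    (forall x, `|u x| <= normc (f x)) -> (forall x, `|v x| <= normc (f x)) ->
    `|phase_int mu (@dotp R N) u v xi| <= 2 * fine (L1norm f).
  move=> iu iv uf vf; have iph := integrable_phase (@measurable_dotp R N) xi iu iv.
  apply: le_trans (le_normr_Rintegral measurableT iph) _.
  rewrite L1normE -RintegralZl//; apply: le_Rintegral => //.
  - exact: integrable_norm.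
  - exact: (integrableZl measurableT 2 fi).
  move=> x _; rewrite (le_trans (ler_normD _ _))// !normrM mulr_natl mulr2n lerD//.
  - by rewrite (le_trans _ (uf x))// ler_piMr// norm_cos_le1.
  - by rewrite (le_trans _ (vf x))// ler_piMr// norm_sin_le1.
rewrite (_ : 4 * _ = 2 * (2 * fine (L1norm f))); last by ring.
rewrite fourierL1E; apply: normc_le_Re_Im => /=; apply: bnd => //.
- by move=> x; exact: normc_Re.
- by move=> x; exact: normc_Im.
- exact: (integrableN ir).
- by move=> x; exact: normc_Im.
- by move=> x; rewrite normrN normc_Re.
Qed.

Lemma normc_cintegral_le f : inL1 f -> normc (cintegral f) <= 2 * fine (L1norm f).
Proof.
move=> f1; have [ir ii] := inL1_integrable f1; have [mf fy] := f1.
have fi := (inL1P mf).1 fy.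
apply: normc_le_Re_Im => /=; (apply: le_trans; first exact: le_normr_Rintegral);
  rewrite L1normE; apply: le_Rintegral => //; try exact: integrable_norm.
- by move=> x _; exact: normc_Re.
- by move=> x _; exact: normc_Im.
Qed.

End fourier_L1.

(** * The Fourier transform on L^2 *)

(* Riesz-Fischer for sequences with summable increments; every Cauchy sequence
   has such a subsequence. *)
Section rapidly_cauchy.
Context {R : realType}.

Lemma rapidly_cauchy_cvg (a : nat -> R) (t : R) :
  (forall j, `|a j.+1 - a j| <= t / 2 ^+ j) ->
  cvgn a /\ forall j, `|limn a - a j| <= 2 * t / 2 ^+ j.
Proof.
move=> at_; have t0 : 0 <= t by have := at_ 0%N; rewrite expr0 divr1; exact: le_trans.
have tele j m : `|a (j + m)%N - a j| <= 2 * t / 2 ^+ j.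
  (* The induction on m needs the partial geometric sum, not only its limit. *)
  suff : `|a (j + m)%N - a j| <= 2 * t / 2 ^+ j - 2 * t / 2 ^+ (j + m).
    by move=> h; apply: le_trans h _; rewrite gerBl divr_ge0 ?mulr_ge0 ?exprn_ge0.
  elim: m => [|m IHm]; first by rewrite addn0 !subrr normr0.
  rewrite addnS (_ : _ - a j = (a (j + m).+1 - a (j + m)%N) + (a (j + m)%N - a j)); last by ring.
  apply: le_trans (ler_normD _ _) _; apply: le_trans (lerD (at_ _) IHm) _.
  rewrite le_eqVlt; apply/orP; left; apply/eqP; rewrite exprS; field.
  by rewrite !expf_neq0.
have ca : cvgn a.
  apply/cauchy_cvgP/cauchy_exP => e e0.
  have d0 : 0 < e / (2 * t + 1) by rewrite divr_gt0// ltr_pwDr// mulr_ge0.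
  have [j _ /(_ j (leqnn j)) je] := near_infty_natSinv_expn_lt (PosNum d0).
  exists (a j); exists j => // n /= jn; rewrite -ball_normE /= distrC -(subnKC jn).
  apply: le_lt_trans (tele _ _) _.
  rewrite ltr_pdivlMr ?ltr_pwDr ?mulr_ge0// in je.
  by apply: le_lt_trans je; rewrite mulrC mul1r ler_wpM2l ?invr_ge0 ?exprn_ge0// lerDl.
split=> // j.
have h : `|a n - a j| @[n --> \oo] --> `|limn a - a j|.
  by apply: cvg_norm; apply: cvgB => //; exact: cvg_cst.
rewrite -(cvg_lim _ h)//; apply: limr_le; first by apply/cvg_ex; eexists; exact: h.
by exists j => // n /= jn; rewrite -(subnKC jn).
Qed.

Context d (T : measurableType d).
Variable mu : {measure set T -> \bar R}.

(** Weights 4^j against squared increments of integral at most C / 8^j leave a convergent series, so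
    S is integrable. Where S is finite, the increments are at most sqrt(S) / 2^j and the sequence
    converges geometrically. *)
Lemma rapidly_cauchy_L2 (a : nat -> T -> R) (C : R) : 0 <= C ->
  (forall j, measurable_fun [set: T] (a j)) ->
  (forall j, \int[mu]_x ((a j.+1 x - a j x) ^+ 2)%:E <= (C / 8 ^+ j)%:E)%E ->
  exists2 b : T -> R, measurable_fun [set: T] b &
    (\int[mu]_x ((a j x - b x) ^+ 2)%:E @[j --> \oo] --> 0)%E.
Proof.
move=> C0 ma aC.
pose s j x := (4 ^+ j * (a j.+1 x - a j x) ^+ 2)%:E.
have ms j : measurable_fun [set: T] (s j).
  by apply/measurable_EFinP; apply: measurable_funM => //; apply: measurable_funX; exact: measurable_funB.
have s0 j x : (0 <= s j x)%E by rewrite lee_fin mulr_ge0 ?sqr_ge0 ?exprn_ge0.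
pose S x := (\sum_(0 <= j <oo) s j x)%E.
have S0 x : (0 <= S x)%E by exact: nneseries_ge0.
have mS : measurable_fun [set: T] S by exact: ge0_emeasurable_sum.
have Sy : (\int[mu]_x S x <= (2 * C)%:E)%E.
  rewrite integral_nneseries//.
  (* The j-th integral is at most 4^j C / 8^j = 2 C / 2^(j+1), a geometric series of sum 2 C. *)
  apply: le_trans _ (epsilon_trick0 xpredT (mulr_ge0 (ler0n _ 2) C0)).
  apply: lee_nneseries => j _; first by move=> _; exact: integral_ge0.
  rewrite /s; under eq_integral do rewrite EFinM.
  rewrite ge0_integralZl//; last 2 first.
  - by apply/measurable_EFinP; apply: measurable_funX; exact: measurable_funB.
  - by move=> x _; rewrite lee_fin sqr_ge0.
  apply: (@le_trans _ _ ((4 ^+ j)%:E * (C / 8 ^+ j)%:E)%E).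
    by rewrite lee_wpmul2l ?lee_fin ?exprn_ge0.
  rewrite -EFinM lee_fin le_eqVlt; apply/orP; left; apply/eqP.
  rewrite natrX exprS (_ : 8 = 4 * 2); last by ring.
  by rewrite exprMn; field; rewrite !expf_neq0.
have term j x : (s j x <= S x)%E.
  apply: le_trans (nneseries_lim_ge j.+1 _); last by [].
  rewrite big_nat_recr//= leeDr//; exact: sume_ge0.
pose E := S @^-1` (~` [set +oo%E]).
have mE : measurable E.
  by rewrite -[E]setTI; apply: mS => //; exact: measurableC.
have cE x : E x -> cvgn (a ^~ x) /\ forall j, `|limn (a ^~ x) - a j x| <= 2 * Num.sqrt (fine (S x)) / 2 ^+ j.
  move=> Ex; apply: rapidly_cauchy_cvg => j.
  have Sfin : S x \is a fin_num by rewrite ge0_fin_numE// ltey; apply/eqP.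
  have h : 4 ^+ j * (a j.+1 x - a j x) ^+ 2 <= fine (S x).
    by rewrite -lee_fin fineK//; exact: term.
  rewrite ler_pdivlMr ?exprn_gt0//.
  rewrite -(@ler_sqr _ (_ * _)) ?nnegrE ?mulr_ge0 ?exprn_ge0 ?sqrtr_ge0//.
  rewrite sqr_sqrtr ?fine_ge0// exprMn real_normK ?num_real// -exprM mulnC exprM mulrC.
  by rewrite (_ : 2 ^+ 2 = 4) // expr2; ring.
(* The indicator of E makes the sequence converge everywhere, to 0 off E, so that the limit is
   measurable. *)
pose b x := limn (fun j => \1_E x * a j x).
have bcvg x : (\1_E x * a j x @[j --> \oo] --> b x).
  rewrite /b indicE; case: (boolP (x \in E)) => xE /=; last first.
    by under eq_fun do rewrite mul0r; exact: is_cvg_cst.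
  by under eq_fun do rewrite mul1r; rewrite inE in xE; have [] := cE _ xE.
have mb : measurable_fun [set: T] b.
  apply: (measurable_fun_cvg (fun j => _) (fun x _ => bcvg x)) => j.
  by apply: measurable_funM => //; exact: measurable_indic.
exists b => //.
have q0 j : (0 <= \int[mu]_x ((a j x - b x) ^+ 2)%:E)%E.
  by apply: integral_ge0 => x _; rewrite lee_fin sqr_ge0.
apply/(ge0_cvge0P q0) => e e0.
(* The final bound is (4 / 4^j)(2 C), at most 8 C / 2^j; the added 1 covers C = 0. *)
have d0 : 0 < e / (8 * C + 1) by rewrite divr_gt0// ltr_pwDr// mulr_ge0.
near=> j.
(* The square of the pointwise distance 2 sqrt(S) / 2^j to the limit. *)
apply: (@le_trans _ _ (\int[mu]_x ((4 / 4 ^+ j)%:E * S x))%E).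
  apply: ae_ge0_le_integral => //.
  - by move=> x _; rewrite lee_fin sqr_ge0.
  - by apply/measurable_EFinP; apply: measurable_funX; exact: measurable_funB.
  - by move=> x _; rewrite mule_ge0// lee_fin divr_ge0 ?exprn_ge0.
  - exact: measurable_funeM.
  have iS : mu.-integrable [set: T] S.
    apply/integrableP; split => //; under eq_integral do rewrite gee0_abs//.
    by apply: le_lt_trans Sy _; rewrite ltry.
  have := integrable_ae measurableT iS; apply: filterS => x /(_ I) Sfin _.
  have Ex : E x by move=> /= Sxy; rewrite Sxy in Sfin.
  have [ca /(_ j) lj] := cE _ Ex.
  rewrite -[X in (_ * X)%E](fineK Sfin) -EFinM lee_fin.
  have -> : b x = limn (a ^~ x).
    by rewrite /b indicE mem_set//; under eq_fun do rewrite mul1r.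
  rewrite -sqrrN opprB -(real_normK (num_real _)).
  apply: (@le_trans _ _ ((2 * Num.sqrt (fine (S x)) / 2 ^+ j) ^+ 2)).
    by rewrite ler_sqr ?nnegrE ?divr_ge0 ?mulr_ge0 ?exprn_ge0 ?sqrtr_ge0.
  rewrite le_eqVlt; apply/orP; left; apply/eqP.
  rewrite !exprMn sqr_sqrtr ?fine_ge0// exprVn -exprM mulnC exprM (_ : 2 ^+ 2 = 4) ?expr2; last by ring.
  by rewrite mulrAC; congr (_ * _ * _); ring.
rewrite ge0_integralZl//.
apply: (@le_trans _ _ ((4 / 4 ^+ j)%:E * (2 * C)%:E)%E).
  by rewrite lee_wpmul2l// lee_fin divr_ge0 ?exprn_ge0.
have je : 1 / 2 ^+ j < e / (8 * C + 1).
  by near: j; exact: (near_infty_natSinv_expn_lt (PosNum d0)).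
rewrite ltr_pdivlMr ?ltr_pwDr ?mulr_ge0// in je.
rewrite -EFinM lee_fin; apply/ltW; apply: le_lt_trans je.
have p0 : 0 < 1 / 2 ^+ j :> R by rewrite divr_gt0 ?exprn_gt0.
have p1 : 1 / 2 ^+ j <= 1 :> R by rewrite ler_pdivrMr ?exprn_gt0// mul1r exprn_ege1// ler1n.
rewrite (_ : 4 / 4 ^+ j * (2 * C) = (1 / 2 ^+ j) * ((1 / 2 ^+ j) * (8 * C))).
  rewrite ler_wpM2l ?(ltW p0)// (@le_trans _ _ (8 * C)) ?lerDl//.
  by rewrite ler_piMl// mulr_ge0.
by rewrite (_ : 4 = 2 * 2) ?exprMn; [field; rewrite !expf_neq0|ring].
Unshelve. all: by end_near. Qed.

End rapidly_cauchy.

Section fourier_L2.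
Context (R : realType) (N : nat).
Notation V := (Rn R N).
Notation mu := (leb R N).
Implicit Types (f g h : V -> R[i]).
Let c : R := (2 * pi) ^+ N.

Let c0 : 0 < c.
Proof. by rewrite exprn_gt0// mulr_gt0// pi_gt0. Qed.

Lemma is_fourierL2_csq f g : is_fourierL2 f g ->
  exists h : nat -> V -> R[i], [/\ forall k, inL1 (h k) /\ inL2 (h k),
    (forall e : R, 0 < e -> \forall k \near \oo, (csq (h k \- f)%R <= e%:E)%E) &
    (forall e : R, 0 < e -> \forall k \near \oo, (csq (fourierL1 (h k) \- g)%R <= e%:E)%E)].
Proof.
move=> [_ _ [h [h12 /L2norm_cvg0 hf /L2norm_cvg0 hg]]]; exists h; split=> //.
  by apply/ge0_cvge0P => // k; exact: csq_ge0.
by apply/ge0_cvge0P => // k; exact: csq_ge0.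
Qed.

(** Plancherel for a pair (f, g) up to a factor 4: pass from f to an approximant, apply the formula
    there, and pass from its transform to g. Each passage doubles the squared norm and leaves an
    error, (2 + 4 / c) times a small number in total. *)
Lemma fourierL2_csq_le f g : is_fourierL2 f g -> (csq f <= (4 / c)%:E * csq g)%E.
Proof.
move=> fg; have [/inL2E[mf _] /inL2E[mg gy] _] := fg.
have [h [h12 hf hg]] := is_fourierL2_csq fg.
apply/lee_addgt0Pr => e e0.
have K0 : 0 < 2 + 4 / c by rewrite addr_gt0// divr_gt0.
have d0 : 0 < e / (2 + 4 / c) by rewrite divr_gt0.
near \oo => k; have [h1 h2] := h12 k; have /inL2E[mh hy] := h2.
have hfk : (csq (h k \- f)%R <= (e / (2 + 4 / c))%:E)%E by near: k; exact: hf.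
have hgk : (csq (fourierL1 (h k) \- g)%R <= (e / (2 + 4 / c))%:E)%E by near: k; exact: hg.
have mfh := cmeasurable_fourierL1 h1.
have E1 : (csq f <= 2%:E * csq (h k) + 2%:E * csq (h k \- f)%R)%E.
  rewrite -[X in (csq X <= _)%E](_ : (h k \- (h k \- f)) = f).
    by apply: csqB => //; exact: cmeasurableB.
  by apply/funext => x /=; rewrite subKr.
have E2 : (csq (fourierL1 (h k)) <= 2%:E * csq g + 2%:E * csq (fourierL1 (h k) \- g)%R)%E.
  rewrite -[X in (csq X <= _)%E](_ : (g \+ (fourierL1 (h k) \- g)) = fourierL1 (h k)).
    by apply: csqD => //; exact: cmeasurableB.
  by apply/funext => x /=; rewrite addrC subrK.
have E3 : csq (h k) = ((c^-1)%:E * csq (fourierL1 (h k)))%E.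
  by rewrite plancherel_L1L2// muleA -EFinM mulVf ?mul1e// gt_eqF.
apply: le_trans E1 _; rewrite E3.
apply: (@le_trans _ _ (2%:E * ((c^-1)%:E * (2%:E * csq g + 2%:E * (e / (2 + 4 / c))%:E))
    + 2%:E * (e / (2 + 4 / c))%:E)%E).
  apply: leeD; last by rewrite lee_wpmul2l.
  rewrite lee_wpmul2l// lee_wpmul2l ?lee_fin ?invr_ge0 ?(ltW c0)//.
  by apply: le_trans E2 _; rewrite leeD2l// lee_wpmul2l.
move: gy (csq_ge0 g); case: (csq g) => [r| |]// _ _.
rewrite -!EFinM -!EFinD lee_fin.
rewrite le_eqVlt; apply/orP; left; apply/eqP; field.
by rewrite !gt_eqF//= addr_gt0// mulr_gt0.
Unshelve. all: by end_near. Qed.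

(** Consistency of the two transforms: by Plancherel on h k - f, both g and [fourierL1 f] are L^2
    limits of the transforms of the approximants h k. *)
Lemma fourierL2_L1 f g : is_fourierL2 f g -> inL1 f -> {ae mu, forall xi, g xi = fourierL1 f xi}.
Proof.
move=> fg f1; have [f2 /inL2E[mg _] _] := fg.
have [h [h12 hf hg]] := is_fourierL2_csq fg.
have mff := cmeasurable_fourierL1 f1.
have mgf : cmeasurable (g \- fourierL1 f) by exact: cmeasurableB.
suff /(csq_eq0 mgf) : csq (g \- fourierL1 f) = 0%E.
  by apply: filterS => xi /= /subr0_eq.
apply/le_anti; rewrite csq_ge0 andbT; apply/lee_addgt0Pr => e e0; rewrite add0e.
have d0 : 0 < e / (2 * c + 2) by rewrite divr_gt0// addr_gt0// mulr_gt0.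
near \oo => k; have [h1 h2] := h12 k.
have hfk : (csq (h k \- f)%R <= (e / (2 * c + 2))%:E)%E by near: k; exact: hf.
have hgk : (csq (fourierL1 (h k) \- g)%R <= (e / (2 * c + 2))%:E)%E by near: k; exact: hg.
have mfh := cmeasurable_fourierL1 h1.
have E0 : csq (fourierL1 (h k) \- fourierL1 f) = (c%:E * csq (h k \- f)%R)%E.
  rewrite -plancherel_L1L2; [|exact: inL1B|exact: inL2B].
  by congr csq; apply/funext => xi; rewrite fourierL1B.
have : (csq (g \- fourierL1 f)%R <= 2%:E * csq (fourierL1 (h k) \- fourierL1 f)%R
    + 2%:E * csq (fourierL1 (h k) \- g)%R)%E.
  rewrite [X in (csq X <= _)%E](_ : _ = (fourierL1 (h k) \- fourierL1 f) \- (fourierL1 (h k) \- g)).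
    by apply: csqB; exact: cmeasurableB.
  by apply/funext => x /=; rewrite opprB [RHS]addrC addrA subrK.
move=> /le_trans; apply; rewrite E0.
apply: (@le_trans _ _ (2%:E * (c%:E * (e / (2 * c + 2))%:E) + 2%:E * (e / (2 * c + 2))%:E)%E).
  apply: leeD; last by rewrite lee_wpmul2l.
  by rewrite lee_wpmul2l// lee_wpmul2l// lee_fin (ltW c0).
rewrite -!EFinM -EFinD lee_fin le_eqVlt; apply/orP; left; apply/eqP; field.
by rewrite gt_eqF// addr_gt0// mulr_gt0.
Unshelve. all: by end_near. Qed.

(** Cut f off outside sets of finite measure that increase to the whole space. The cut function is
    integrable because |f| <= 1 + |f|^2. *)
Lemma inL2_truncation f : inL2 f -> exists h : nat -> V -> R[i],
  (forall k, inL1 (h k) /\ inL2 (h k)) /\ (csq (h k \- f)%R @[k --> \oo] --> 0)%E.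
Proof.
move=> /inL2E[mf fy]; have [mr mi] := mf.
have /sigma_finiteP[F [TF ndF Fy]] := sigma_finiteT mu.
have mF k : measurable (F k) by case: (Fy k).
pose h k x : R[i] := (\1_(F k) x * complex.Re (f x)) +i* (\1_(F k) x * complex.Im (f x)).
have mh k : cmeasurable (h k).
  by split; apply: measurable_funM => //; exact: measurable_indic.
have nh k x : normc (h k x) = \1_(F k) x * normc (f x).
  apply/eqP; rewrite -(@eqrXn2 _ 2) ?mulr_ge0 ?normc_nonneg//; apply/eqP.
  by rewrite exprMn !normc_sq /h /=; ring.
have i01 k x : (0 <= (\1_(F k) x : R) <= 1) by rewrite indicE; case: (_ \in _); rewrite ?lexx ?ler01.
have fi : mu.-integrable [set: V] (EFin \o (fun x => normc (f x) ^+ 2)).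
  apply: ge0_integrable; first by apply: measurable_funX; exact: measurable_normc.
    by move=> x; rewrite sqr_ge0.
  by rewrite -csqE.
exists h; split.
  move=> k; split.
    split=> //; apply/inL1P => //.
    have iF : mu.-integrable [set: V] (fun x => (\1_(F k) x)%:E).
      apply: (@ge0_integrable _ _ _ mu (\1_(F k))) => //.
      by rewrite integral_indic// setIT; case: (Fy k).
    apply: le_integrable (integrableD measurableT iF fi) => //.
      by apply/measurable_EFinP; exact: measurable_normc.
    move=> x _; change (`|normc (h k x)|%:E <= `|\1_(F k) x + normc (f x) ^+ 2|%:E)%E.
    rewrite nh lee_fin !ger0_norm ?addr_ge0 ?mulr_ge0 ?sqr_ge0 ?normc_nonneg//.
    rewrite indicE; case: (_ \in _); rewrite ?mul1r ?mul0r ?add0r ?sqr_ge0//.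
    rewrite (_ : true%:R = 1)//; move: (normc_nonneg (f x)) (sqr_ge0 (normc (f x) - 1)).
    by move: (normc _) => r; rewrite !expr2; nra.
  apply/inL2E; split=> //; apply: le_lt_trans fy; rewrite !csqE.
  apply: ge0_le_integral => //.
  - by move=> x _; rewrite lee_fin sqr_ge0.
  - exact: measurable_normc_sq.
  - exact: measurable_normc_sq.
  by move=> x _; rewrite lee_fin nh exprMn ler_piMl ?sqr_ge0// exprn_ile1//; case/andP: (i01 k x).
rewrite -[X in _ --> X](integral0 mu [set: V]).
under eq_fun do rewrite csqE.
have [|||||_ _] := @dominated_convergence _ _ _ mu _ measurableT
    (fun k x => (normc ((h k \- f) x) ^+ 2)%:E) (cst 0%E) (fun x => (normc (f x) ^+ 2)%:E).
- by move=> k; apply: (@measurable_normc_sq _ _ (h k \- f)); exact: cmeasurableB.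
- exact: measurable_cst.
- apply: aeW => x _; apply: cvg_near_cst.
  have [k0 _ Fx] : (\bigcup_k F k) x by rewrite -TF.
  exists k0 => // k /= k0k; congr EFin.
  have Fkx : F k x by move: x Fx; exact/subsetPset/ndF.
  rewrite /h indicE mem_set// !mul1r; case: (f x) => a b /=.
  by rewrite !subrr expr0n/= addr0 sqrtr0 expr0n.
- exact: fi.
- apply: aeW => x k _; rewrite gee0_abs ?lee_fin ?sqr_ge0//.
  rewrite !normc_sq /h /= indicE; case: (f x) => a b; case: (_ \in _) => /=.
    by rewrite !mul1r !subrr expr0n/= !addr0 addr_ge0 ?sqr_ge0.
  by rewrite !mul0r !sub0r !sqrrN.
by [].
Qed.

Lemma csq_complete (v : nat -> V -> R[i]) (C : R) : 0 <= C ->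
  (forall j, cmeasurable (v j)) ->
  (forall j, (csq (v j.+1 \- v j)%R <= (C / 8 ^+ j)%:E)%E) ->
  exists2 g, cmeasurable g & (csq (v j \- g)%R @[j --> \oo] --> 0)%E.
Proof.
move=> C0 mv vC.
have ReB z w : complex.Re (z - w : R[i]) = complex.Re z - complex.Re w by case: z; case: w.
have ImB z w : complex.Im (z - w : R[i]) = complex.Im z - complex.Im w by case: z; case: w.
have msq (u : V -> R) : measurable_fun [set: V] u -> measurable_fun [set: V] (fun x => (u x ^+ 2)%:E).
  by move=> mu_; apply/measurable_EFinP; exact: measurable_funX.
have mRe j : measurable_fun [set: V] (fun x => complex.Re (v j x)) by case: (mv j).
have mIm j : measurable_fun [set: V] (fun x => complex.Im (v j x)) by case: (mv j).
have ReC j : (\int[mu]_x ((complex.Re (v j.+1 x) - complex.Re (v j x)) ^+ 2)%:E <= (C / 8 ^+ j)%:E)%E.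
   apply: le_trans (vC j); apply: ge0_le_integral => //.
  - by move=> x _; rewrite lee_fin sqr_ge0.
  - by apply: msq; exact: measurable_funB.
  - by apply/measurable_EFinP; apply: measurable_sq2; have [] := cmeasurableB (mv j.+1) (mv j).
  - by move=> x _; rewrite lee_fin -ReB lerDl sqr_ge0.
have [a ma ca] := rapidly_cauchy_L2 C0 mRe ReC.
have ImC j : (\int[mu]_x ((complex.Im (v j.+1 x) - complex.Im (v j x)) ^+ 2)%:E <= (C / 8 ^+ j)%:E)%E.
   apply: le_trans (vC j); apply: ge0_le_integral => //.
  - by move=> x _; rewrite lee_fin sqr_ge0.
  - by apply: msq; exact: measurable_funB.
  - by apply/measurable_EFinP; apply: measurable_sq2; have [] := cmeasurableB (mv j.+1) (mv j).
  - by move=> x _; rewrite lee_fin -ImB lerDr sqr_ge0.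
have [b mb cb] := rapidly_cauchy_L2 C0 mIm ImC.
exists (fun x => a x +i* b x) => //.
rewrite (_ : (fun j => _) = (fun j => \int[mu]_x ((complex.Re (v j x) - a x) ^+ 2)%:E
   + \int[mu]_x ((complex.Im (v j x) - b x) ^+ 2)%:E)%E).
  by rewrite -[X in _ --> X](adde0 0%E); apply: cvgeD.
apply/funext => j; rewrite -ge0_integralD//.
- by apply: eq_integral => x _ /=; rewrite ReB ImB.
- by move=> x _; rewrite lee_fin sqr_ge0.
- by apply: msq; exact: measurable_funB.
- by move=> x _; rewrite lee_fin sqr_ge0.
- by apply: msq; exact: measurable_funB.
Qed.

(** By Plancherel on L^1 and L^2, transforms of approximants of f are as close to each other as the
    approximants. A subsequence at squared distance at most 8^-j from f therefore meets the
    hypothesis of [csq_complete]. *)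
Lemma fourierL2_exists f : inL2 f -> exists g, is_fourierL2 f g.
Proof.
move=> f2; have /inL2E[mf fy] := f2.
have [h [h12 hf]] := inL2_truncation f2.
have hP := (ge0_cvge0P (fun k => csq_ge0 (h k \- f))).1 hf.
have /choice[k kP] j : exists k, (csq (h k \- f)%R <= (8^-1 ^+ j)%:E)%E.
  have [|n _ /(_ n (leqnn n)) hn] := hP _ (8^-1 ^+ j); first by rewrite exprn_gt0.
  by exists n.
pose u j := h (k j).
have u1 j : inL1 (u j) by case: (h12 (k j)).
have u2 j : inL2 (u j) by case: (h12 (k j)).
have mfu j := cmeasurable_fourierL1 (u1 j).
have C0 : 0 <= 4 * c by rewrite mulr_ge0// ltW.
have fuB i j : csq (fourierL1 (u i) \- fourierL1 (u j)) = (c%:E * csq (u i \- u j)%R)%E.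
  rewrite -plancherel_L1L2; [|exact: inL1B|exact: inL2B].
  by congr csq; apply/funext => xi; rewrite fourierL1B.
have [|g mg cg] := csq_complete C0 mfu.
  move=> j; rewrite fuB.
  have : (csq (u j.+1 \- u j)%R <= 2%:E * csq (u j.+1 \- f)%R + 2%:E * csq (u j \- f)%R)%E.
    rewrite [X in (csq X <= _)%E](_ : _ = (u j.+1 \- f) \- (u j \- f)).
      by apply: csqB; apply: cmeasurableB => //; [case: (u1 j.+1)|case: (u1 j)].
    by apply/funext => x /=; rewrite opprB addrA subrK.
  move=> /(lee_wpmul2l (ltW c0 : (0 <= c%:E)%E)) /le_trans; apply.
  apply: (@le_trans _ _ (c%:E * (2%:E * (8^-1 ^+ j.+1)%:E + 2%:E * (8^-1 ^+ j)%:E))%E).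
    rewrite lee_wpmul2l ?lee_fin ?(ltW c0)//.
    by apply: leeD; rewrite lee_wpmul2l//; exact: kP.
  change ((c * (2 * 8^-1 ^+ j.+1 + 2 * 8^-1 ^+ j))%:E <= (4 * c / 8 ^+ j)%:E)%E.
  rewrite lee_fin exprS exprVn (mulrC 4) -!mulrA ler_wpM2l ?(ltW c0)//.
  have : 0 <= (8 ^+ j)^-1 :> R by rewrite invr_ge0 exprn_ge0.
  by lra.
have g2 : inL2 g.
  apply/inL2E; split=> //.
  have [n _ /(_ n (leqnn n)) gn] := (ge0_cvge0P (fun k => csq_ge0 (fourierL1 (u k) \- g))).1 cg 1 ltr01.
  have : (csq g <= 2%:E * csq (fourierL1 (u n)) + 2%:E * csq (fourierL1 (u n) \- g)%R)%E.
    rewrite -[X in (csq X <= _)%E](_ : fourierL1 (u n) \- (fourierL1 (u n) \- g) = g).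
      by apply: csqB => //; exact: cmeasurableB.
    by apply/funext => x /=; rewrite subKr.
  move=> /le_lt_trans; apply; rewrite plancherel_L1L2//.
  have /inL2E[_ uy] := u2 n.
  rewrite lte_add_pinfty// lte_mul_pinfty// ?lee_fin//.
    by rewrite lte_mul_pinfty// lee_fin ltW.
  by apply: le_lt_trans gn _; rewrite ltry.
exists g; split => //; exists u; split => [j|//|]; first exact: h12.
  apply/L2norm_cvg0/(ge0_cvge0P (fun j => csq_ge0 (u j \- f))) => e e0.
  near=> j; apply: le_trans (kP j) _; rewrite lee_fin.
  have je : 1 / 2 ^+ j < e by near: j; exact: (near_infty_natSinv_expn_lt (PosNum e0)).
  apply/ltW; apply: le_lt_trans je.
  by rewrite mul1r exprVn lef_pV2 ?posrE ?exprn_gt0// lerXn2r ?nnegrE ?ler_nat.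
exact/L2norm_cvg0.
Unshelve. all: by end_near. Qed.

End fourier_L2.

(** * The equation at a fixed frequency *)

Section damped_oscillator.
Context {R : realType}.

Lemma is_derive_0_pos_cst (f : R -> R) (s t : R) : 0 < s -> 0 < t ->
  (forall x : R, 0 < x -> is_derive x 1 f 0) -> f s = f t.
Proof.
move=> s0 t0 df; wlog st : s t s0 t0 / s <= t.
  by case: (leP s t) => [|/ltW] h H; [|symmetry]; exact: H.
have [x||x _] := @MVT_segment R f (fun=> 0) s t st.
- move=> /itvP xst; apply: df; apply: lt_trans s0 _; by rewrite xst.
- apply: derivable_within_continuous => x /itvP xst.
  by have [|? _] := df x; first by apply: lt_le_trans s0 _; rewrite xst.
by rewrite mul0r => /subr0_eq.
Qed.

(** The equation is given at positive times only. The limit of y(s) / s at 0 carries both initial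
    conditions, y(0) = 0 and y'(0) = y1. *)
Lemma damped_oscillator (a omega y1 : R) (y y' y'' : R -> R) : omega != 0 ->
  (forall t : R, 0 < t -> is_derive t 1 y (y' t)) ->
  (forall t : R, 0 < t -> is_derive t 1 y' (y'' t)) ->
  (forall t, 0 < t -> y'' t + 4^-1 * a ^+ 2 * y t + omega ^+ 2 * y t + a * y' t = 0) ->
  y s / s @[s --> 0^'+] --> y1 ->
  forall t, 0 < t -> y t = y1 / omega * (expR (- (a / 2 * t)) * sin (omega * t)).
Proof.
move=> w0 dy dy' ode ylim.
pose E (t : R) := expR (a / 2 * t).
pose S (t : R) := sin (omega * t).
pose C (t : R) := cos (omega * t).
have dlin (k x : R) : is_derive x 1 (fun x => k * x) k.
  by apply: is_derive_eq; rewrite /GRing.scale /= mulr1.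
have dE (x : R) : is_derive x 1 E (a / 2 * E x).
  have h := @is_derive1_comp R expR (fun x => a / 2 * x) x _ _ (is_derive_expR _) (dlin _ x).
  by apply: (is_derive_eq h); rewrite /E mulrC.
have dS (x : R) : is_derive x 1 S (omega * C x).
  have h := @is_derive1_comp R sin (fun x => omega * x) x _ _ (is_derive_sin _) (dlin _ x).
  by apply: (is_derive_eq h); rewrite /C mulrC.
have dC (x : R) : is_derive x 1 C (- (omega * S x)).
  have h := @is_derive1_comp R cos (fun x => omega * x) x _ _ (is_derive_cos _) (dlin _ x).
  by apply: (is_derive_eq h); rewrite /S mulrC mulrN.
(* With w = E y one has w'' = -omega^2 w. P and Q are the coefficients of cos and sin in w found by
   variation of constants, hence conserved. *)
pose P t := E t * (y t * C t) - omega^-1 * (E t * ((a / 2 * y t + y' t) * S t)).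
pose Q t := E t * (y t * S t) + omega^-1 * (E t * ((a / 2 * y t + y' t) * C t)).
have y''E x : 0 < x -> y'' x = - (4^-1 * a ^+ 2 * y x + omega ^+ 2 * y x + a * y' x).
  by move=> /ode /eqP; rewrite -!addrA addr_eq0 !addrA => /eqP.
have dP (x : R) : 0 < x -> is_derive x 1 P 0.
  move=> x0; have := dy x x0; have := dy' x x0 => d1 d2.
  rewrite /P; apply: is_derive_eq; rewrite /GRing.scale /= y''E//; field.
  exact: w0.
have dQ (x : R) : 0 < x -> is_derive x 1 Q 0.
  move=> x0; have := dy x x0; have := dy' x x0 => d1 d2.
  rewrite /Q; apply: is_derive_eq; rewrite /GRing.scale /= y''E//; field.
  exact: w0.
have yPQ t : 0 < t -> E t * y t = P 1 * C t + Q 1 * S t.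
  move=> t0; rewrite (is_derive_0_pos_cst ltr01 t0 dP) (is_derive_0_pos_cst ltr01 t0 dQ).
  rewrite -[LHS]mulr1 -(cos2Dsin2 (omega * t)) /P /Q -/(C t) -/(S t); ring.
have contr (f : R -> R) (d : R) : is_derive (0 : R) 1 f d -> f s @[s --> 0^'+] --> f 0.
  move=> [df _]; apply: cvg_at_right_filter.
  by apply: differentiable_continuous; exact/derivable1_diffP.
have idlim : (s : R) @[s --> 0^'+] --> (0 : R) by apply: cvg_at_right_filter; exact: cvg_id.
have E0 : E 0 = 1 by rewrite /E mulr0 expR0.
have S0 : S 0 = 0 by rewrite /S mulr0 sin0.
have C0 : C 0 = 1 by rewrite /C mulr0 cos0.
have Elim := contr _ _ (dE 0); have Slim := contr _ _ (dS 0); have Clim := contr _ _ (dC 0).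
rewrite E0 in Elim; rewrite S0 in Slim; rewrite C0 in Clim.
have wlim : E s * (y s / s) @[s --> 0^'+] --> y1.
  by rewrite -[X in _ --> X]mul1r; exact: cvgM.
(* P is the limit of E y at 0, and y(s) is s times a convergent quotient. *)
have P0 : P 1 = 0.
  have h1 : P 1 * C s + Q 1 * S s @[s --> 0^'+] --> P 1 * 1 + Q 1 * 0.
    by apply: cvgD; apply: cvgMr.
  have h2 : P 1 * C s + Q 1 * S s @[s --> 0^'+] --> 0 * y1.
    have h : s * (E s * (y s / s)) @[s --> 0^'+] --> 0 * y1 by exact: cvgM.
    apply: cvg_trans h; apply: near_eq_cvg; near=> s.
    have s0 : 0 < s by near: s; exact: nbhs_right_gt.
    by rewrite -yPQ//; field; rewrite gt_eqF.
  by have := cvg_lim (@Rhausdorff R) h1; rewrite (cvg_lim _ h2)// mulr1 mulr0 addr0 mul0r => <-.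
have Sder : S s / s @[s --> 0^'+] --> omega.
  have [d1 d2] := dS 0; rewrite C0 mulr1 in d2.
  have h : s^-1 *: (S (s *: 1 + 0) - S 0) @[s --> 0^'] --> omega.
    by rewrite -d2; exact: d1.
  have := cvg_dnbhs_at_right h; apply: cvg_trans; apply: near_eq_cvg; near=> s.
  by rewrite S0 subr0 addr0 /GRing.scale /= mulr1 mulrC.
(* Compare the limits at 0 of E y / s and of Q sin(omega s) / s. *)
have Q0 : Q 1 * omega = y1.
  rewrite -(cvg_lim (@Rhausdorff R) wlim); symmetry; apply: cvg_lim => //.
  have h : Q 1 * (S s / s) @[s --> 0^'+] --> Q 1 * omega by exact: cvgMr.
  apply: cvg_trans h; apply: near_eq_cvg; near=> s.
  have s0 : 0 < s by near: s; exact: nbhs_right_gt.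
  by rewrite !mulrA yPQ// P0 mul0r add0r.
move=> t t0; rewrite expRN -/(E t) -/(S t) -Q0 mulfK//.
have Et : E t != 0 by rewrite gt_eqF// expR_gt0.
by apply: (mulfI Et); rewrite yPQ// P0 mul0r add0r; field.
Unshelve. all: by end_near. Qed.

End damped_oscillator.

(** * From one-sided complex derivatives to the real oscillator *)

Section ode.
Context {R : realType}.
Let nrm (z : R[i]^o) := (normc z)%:E.

(* [p] is instantiated with the real and imaginary parts. *)
Variable p : R[i] -> R.
Hypothesis pB : forall z w, p (z - w) = p z - p w.
Hypothesis pZ : forall (r : R) z, p (r%:C * z) = r * p z.
Hypothesis p_le : forall z, `|p z| <= normc z.

Lemma halfline_quotient (f : R -> R[i]) (t : R) (d : R[i]) :
  has_deriv_halfline nrm (f : R -> R[i]^o) t d -> forall e : R, 0 < e ->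
  \forall s \near t, s != t -> 0 <= s -> `|(s - t)^-1 * (p (f s) - p (f t)) - p d| <= e.
Proof.
move=> fd e e0.
pose q s := nrm ((s - t)^-1%:C *: ((f : R -> R[i]^o) s - f t) - d).
have n0 s : (0 <= q s)%E.
  by rewrite lee_fin normc_nonneg.
have : \forall s \near t, s != t -> 0 <= s -> (q s <= e%:E)%E.
  exact: ((ge0_cvge0P n0).1 fd).
apply: filterS => s h st s0; have := h st s0; rewrite lee_fin; apply: le_trans.
by rewrite -!pB -pZ -pB; exact: p_le.
Qed.

Lemma halfline_is_derive (f : R -> R[i]) (t : R) (d : R[i]) : 0 < t ->
  has_deriv_halfline nrm (f : R -> R[i]^o) t d -> is_derive t 1 (p \o f) (p d).
Proof.
move=> t0 fd.
have c : h^-1 *: ((p \o f) (h *: 1 + t) - (p \o f) t) @[h --> 0^'] --> p d.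
  apply/cvgrPdist_le => e e0.
  have /nbhs_ballP[r /= r0 rP] := halfline_quotient fd e0.
  (* An increment smaller than t keeps t + h in the half-line, where the one-sided quotient is
     controlled. *)
  have m0 : 0 < Num.min r t by rewrite lt_min r0.
  exists (Num.min r t) => //= h; rewrite /= sub0r normrN lt_min => /andP[hr ht] h0.
  have hE : h *: (1 : R) + t = h + t by rewrite /GRing.scale /= mulr1.
  rewrite distrC hE; have := rP (h + t); rewrite addrK; apply.
  - by rewrite /ball /= opprD addrCA subrr addr0 normrN.
  - by rewrite -subr_eq0 addrK.
  - by move: ht; rewrite ltr_norml => /andP[]; lra.
by apply: DeriveDef; [apply/cvg_ex; exists (p d)|exact: cvg_lim].
Qed.

Lemma halfline_at0 (f : R -> R[i]) (d : R[i]) : p (f 0) = 0 ->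
  has_deriv_halfline nrm (f : R -> R[i]^o) 0 d -> p (f s) / s @[s --> 0^'+] --> p d.
Proof.
move=> f0 fd; apply/cvgrPdist_le => e e0.
have /nbhs_ballP[r /= r0 rP] := halfline_quotient fd e0.
exists r => //= s /= sr s0; have := rP s sr (lt0r_neq0 s0) (ltW s0).
by rewrite f0 !subr0 distrC mulrC.
Qed.

Lemma ode_part (a : R) (y1 : R[i]) (y : R -> R[i]) : ode_solution a 0 y1 y ->
  forall t, 0 < t ->
  p (y t) = p y1 / (pi / 2) * (expR (- (a / 2 * t)) * sin (pi / 2 * t)).
Proof.
move=> [y' [y'' [y00 y'0 dy ode]]].
have p0 : p 0 = 0 by rewrite -(subrr 0) pB subrr.
have pD z w : p (z + w) = p z + p w by have := pB (z + w) w; rewrite addrK => ->; rewrite subrK.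
(* The coefficient pi^2 / 4 is the square of the frequency omega = pi / 2. *)
apply: (@damped_oscillator R a (pi / 2) (p y1) (p \o y) (p \o y') (p \o y'')).
- by rewrite mulf_neq0 ?invr_eq0// gt_eqF// pi_gt0.
- by move=> t t0; apply: halfline_is_derive => //; exact: dy (ltW t0).
- by move=> t t0; apply: halfline_is_derive => //; case: (ode t t0).
- move=> t t0; have [_ /(congr1 p)] := ode t t0; rewrite !pD !pZ p0 => <- /=.
  by field.
- by apply: halfline_at0; [rewrite y00|rewrite -y'0; exact: dy].
Qed.

End ode.

(** Each component carries 1 / omega = 2 / pi; [normc_le_Re_Im] doubles it. *)
Lemma normc_ode_le (R : realType) (a : R) (y1 : R[i]) (y : R -> R[i]) :
  ode_solution a 0 y1 y -> forall t, 0 < t ->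
  normc (y t) <= 4 / pi * normc y1 * expR (- (a / 2 * t)).
Proof.
move=> sol t t0.
have part p (pB : forall z w, p (z - w) = p z - p w)
    (pZ : forall (r : R) z, p (r%:C * z) = r * p z) (p_le : forall z, `|p z| <= normc z) :
    `|p (y t)| <= 2 / pi * normc y1 * expR (- (a / 2 * t)).
  rewrite (ode_part pB pZ p_le sol t0) !normrM (_ : `|(pi / 2)^-1| = 2 / pi); last first.
    by rewrite ger0_norm ?invr_ge0 ?divr_ge0 ?pi_ge0// invf_div.
  rewrite mulrA (ger0_norm (expR_ge0 _)).
  rewrite (mulrC `|p y1|) -[leRHS]mulr1 ler_pM ?norm_sin_le1 ?mulr_ge0 ?invr_ge0 ?pi_ge0 ?expR_ge0//.
  by rewrite ler_wpM2r ?expR_ge0// ler_wpM2l ?divr_ge0 ?pi_ge0.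
apply: le_trans (normc_le_Re_Im _ _) _.
- by apply: part => [[? ?] [? ?]|r [? ?]|z] //=; [rewrite mul0r subr0|exact: normc_Re].
- by apply: part => [[? ?] [? ?]|r [? ?]|z] //=; [rewrite mul0r addr0|exact: normc_Im].
by rewrite le_eqVlt; apply/orP; left; apply/eqP; ring.
Qed.

(** * The decaying weight *)

Section decay.
Context {R : realType}.

(** Bernoulli's inequality 1 + s x <= (1 + x)^s in logarithmic form. By concavity of ln, with weight
    1 / s at 1 + s x and the remaining weight at 1, the barycentre is 1 + x. *)
Lemma ln_bernoulli (s x : R) : 1 <= s -> 0 <= x -> ln (1 + s * x) <= s * ln (1 + x).
Proof.
move=> s1 x0; have s0 : 0 < s by exact: lt_le_trans s1.
have is1 : s^-1 <= 1 by rewrite invf_le1.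
have y0 : 0 < 1 + s * x by rewrite ltr_pwDl// mulr_ge0// ltW.
have := @concave_ln R (Itv01 (eqbRL (invr_ge0 s) (ltW s0)) is1) _ _ y0 ltr01.
rewrite !convRE /= /unstable.onem ln1 mulr0 addr0 mulr1 mulrDr mulr1 mulKf ?gt_eqF//.
by rewrite (_ : s^-1 + x + (1 - s^-1) = 1 + x) ?ler_pdivrMl//; ring.
Qed.

(** The integrand is e / 2 times the Poisson kernel of parameter e = s^(-1/2). *)
Lemma integral_inv_1Dsq (s : R) : 0 < s ->
  (\int[lebesgue_measure]_x ((1 + s * x ^+ 2)^-1)%:E = (pi * Num.sqrt s^-1)%:E)%E.
Proof.
move=> s0; set e := Num.sqrt s^-1.
have e0 : 0 < e by rewrite sqrtr_gt0 invr_gt0.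
have e2 : e ^+ 2 = s^-1 by rewrite sqr_sqrtr// invr_ge0 ltW.
rewrite (_ : (fun x : R => _) = (fun x => (e / 2)%:E * (poisson e (0 - x))%:E)%E); last first.
  apply/funext => x; rewrite -EFinM sub0r poissonN /poisson e2; congr EFin.
  have half k : e / 2 * (2 * e / k) = e ^+ 2 / k by rewrite expr2 -mulrA 2!(mulrA 2^-1) mulVf// mul1r mulrA.
  by rewrite half e2 -invfM mulrDr divff// gt_eqF.
rewrite ge0_integralZl//.
- by rewrite integral_poisson// -EFinM; congr EFin; field.
- apply/measurable_EFinP; apply: continuous_measurable_fun => x.
  apply: (continuous_comp (f := fun x => 0 - x) (g := poisson e)).
    by apply: cvgB; [exact: cvg_cst|exact: cvg_id].
  exact: poisson_continuous.
- by move=> x _; rewrite lee_fin poisson_ge0// ltW.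
- by rewrite lee_fin divr_ge0// ltW.
Qed.

Lemma integral_leb_prod n (F : R -> R) (k : R) : measurable_fun [set: R] F ->
  (forall x, 0 <= F x) -> (\int[lebesgue_measure]_x (F x)%:E = k%:E)%E ->
  (\int[leb R n]_x (\prod_(i < n) F (tnth x i))%:E = (k ^+ n)%:E)%E.
Proof.
move=> mF F0 Fk.
have mprod m : measurable_fun [set: Rn R m] (fun x => (\prod_(i < m) F (tnth x i))).
  apply: measurable_prod => i _; apply: measurableT_comp => //; exact: measurable_tnth.
have prod0 m (x : Rn R m) : 0 <= \prod_(i < m) F (tnth x i) by apply: prodr_ge0.
elim: n => [|n IHn]; first by rewrite integral_leb0 big_ord0 expr0.
rewrite (@ge0_integral_image R _ _ _ _ (prodm lebesgue_measure (leb R n)) (leb R n.+1)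
  (@rn_cons R n) (@measurable_rn_cons R n))//; last 2 first.
- by apply/measurable_EFinP; exact: mprod.
- by move=> x; rewrite lee_fin.
have E p : \prod_(i < n.+1) F (tnth (rn_cons p) i) = F p.1 * \prod_(i < n) F (tnth p.2 i).
  by rewrite big_ord_recl; congr (_ * _); apply: eq_bigr => i _; rewrite /rn_cons tnthS.
under eq_integral do rewrite E.
rewrite /prodm fubini_tonelli1//; last 2 first.
- apply/measurable_EFinP; apply: measurable_funM; first exact: measurableT_comp.
  exact: (measurableT_comp (mprod n)).
- by move=> p; rewrite lee_fin mulr_ge0.
rewrite /fubini_F /=.
rewrite (_ : (fun x => _) = (fun x : R => (k ^+ n)%:E * (F x)%:E)%E); last first.
  apply/funext => x; under eq_integral do rewrite EFinM.
  rewrite ge0_integralZl//.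
  - by rewrite IHn muleC.
  - by apply/measurable_EFinP; exact: mprod.
  - by move=> y _; rewrite lee_fin; exact: prod0.
  - by rewrite lee_fin.
rewrite ge0_integralZl//.
- by rewrite Fk -EFinM exprSr.
- exact/measurable_EFinP.
- by move=> x _; rewrite lee_fin.
- rewrite lee_fin exprn_ge0// -lee_fin -Fk; apply: integral_ge0 => x _; exact: F0.
Qed.

Context {N : nat}.
Notation V := (Rn R N).

Lemma dotpxx_ge0 (x : V) : 0 <= dotp x x.
Proof. by apply: sumr_ge0 => i _; rewrite -expr2 sqr_ge0. Qed.

Lemma enorm_sq (x : V) : enorm x ^+ 2 = dotp x x.
Proof. by rewrite sqr_sqrtr// dotpxx_ge0. Qed.

Lemma measurable_enorm_sq : measurable_fun [set: V] (fun x => enorm x ^+ 2).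
Proof.
rewrite (_ : (fun x => _) = (fun x : V => dotp x x)); last by apply/funext => x; rewrite enorm_sq.
by apply: measurable_sum => i; apply: measurable_funM; exact: measurable_tnth.
Qed.

Lemma measurable_Lsymbol : measurable_fun [set: V] (@Lsymbol R N).
Proof.
apply: (measurableT_comp (@measurable_ln R)); apply: measurable_funD => //.
exact: measurable_enorm_sq.
Qed.

(** The weight (1 + |xi|^2)^(-t/2), made complex so that [csq] and [le_csq] apply to it. *)
Definition decay (t : R) (xi : V) : R[i] := (expR (- (Lsymbol xi / 2 * t)))%:C.

Lemma normc_decay t xi : normc (decay t xi) = expR (- (Lsymbol xi / 2 * t)).
Proof. by rewrite /decay /= expr0n/= addr0 sqrtr_sqr ger0_norm// expR_ge0. Qed.

Lemma cmeasurable_decay t : cmeasurable (decay t).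
Proof.
split; last exact: measurable_cst.
apply: (measurableT_comp (@measurable_expR R)); apply: measurable_funN.
by apply: measurable_funM => //; apply: measurable_funM => //; exact: measurable_Lsymbol.
Qed.

(** The exponent t is split into N shares t / N, each at least 1, and Bernoulli's inequality is used
    with xi_i^2 <= |xi|^2 in the i-th share. The product form reduces the integral over R^N to one
    dimension. *)
Lemma decay_le_prod t (xi : V) : (0 < N)%N -> N%:R <= t ->
  normc (decay t xi) ^+ 2 <= \prod_(i < N) (1 + t / N%:R * tnth xi i ^+ 2)^-1.
Proof.
move=> N0 Nt; have Nr : 0 < N%:R :> R by rewrite ltr0n.
have s1 : 1 <= t / N%:R by rewrite ler_pdivlMr// mul1r.
have y0 i : 0 < 1 + t / N%:R * tnth xi i ^+ 2.
  by rewrite ltr_pwDl// mulr_ge0 ?sqr_ge0// (le_trans ler01).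
rewrite (eq_bigr (fun i => expR (- ln (1 + t / N%:R * tnth xi i ^+ 2)))); last first.
  by move=> i _; rewrite expRN lnK// posrE.
rewrite normc_decay -expRM_natl -expR_sum ler_expR sumrN mulrN lerN2.
rewrite (_ : 2 * (Lsymbol xi / 2 * t) = \sum_(i < N) t / N%:R * Lsymbol xi); last first.
  by rewrite sumr_const card_ord -mulr_natl; field; rewrite gt_eqF.
apply: ler_sum => i _; apply: le_trans (ln_bernoulli s1 (sqr_ge0 _)) _.
rewrite ler_wpM2l ?(le_trans ler01)// ler_ln ?posrE ?ltr_pwDl ?sqr_ge0// lerD2l enorm_sq.
rewrite /dotp (bigD1 i)//= -expr2 lerDl; apply: sumr_ge0 => j _.
by rewrite -expr2 sqr_ge0.
Qed.

Lemma csq_decay_le t : (0 < N)%N -> N%:R <= t ->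
  (csq (decay t) <= ((pi * Num.sqrt (t / N%:R)^-1) ^+ N)%:E)%E.
Proof.
move=> N0 Nt; have Nr : 0 < N%:R :> R by rewrite ltr0n.
have s0 : 0 < t / N%:R by rewrite divr_gt0// (lt_le_trans Nr).
pose F (x : R) := (1 + t / N%:R * x ^+ 2)^-1.
have F0 x : 0 <= F x by rewrite invr_ge0 addr_ge0// mulr_ge0 ?sqr_ge0// ltW.
have mF : measurable_fun [set: R] F.
  apply: continuous_measurable_fun => x; apply: cvgV.
    by rewrite gt_eqF// ltr_pwDl// mulr_ge0 ?sqr_ge0// ltW.
  by apply: cvgD; [exact: cvg_cst|apply: cvgMr; exact: exprn_continuous].
rewrite csqE -(integral_leb_prod N mF F0 (integral_inv_1Dsq s0)).
apply: ge0_le_integral => //.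
- by move=> x _; rewrite lee_fin sqr_ge0.
- by apply: measurable_normc_sq; exact: cmeasurable_decay.
- apply/measurable_EFinP; apply: measurable_prod => i _.
  by apply: measurableT_comp => //; exact: measurable_tnth.
- by move=> x _; rewrite lee_fin; exact: decay_le_prod.
Qed.

End decay.

(** * The asymptotic profile *)

Section fourier_spec.
Context (R : realType) (N : nat).
Notation V := (Rn R N).
Notation mu := (leb R N).
Implicit Types (f g : V -> R[i]).

Lemma fourierP f : inL2 f -> is_fourierL2 f (fourier f).
Proof. by move=> f2; exact: xgetPex (fourierL2_exists f2). Qed.

(** If g is a transform, the chosen preimage obeys [fourierL2_csq_le]; otherwise the default 0 obeys
    the bound trivially. *)
Lemma fourier_invP g : cmeasurable (fourier_inv g) /\
  (csq (fourier_inv g) <= (4 / (2 * pi) ^+ N)%:E * csq g)%E.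
Proof.
have [[f fg]|nofg] := pselect (exists f, is_fourierL2 f g).
  have h : is_fourierL2 (fourier_inv g) g by exact: (@xgetPex _ _ [set f | is_fourierL2 f g] (ex_intro _ f fg)).
  by split; [have [/inL2E[]] := h|exact: fourierL2_csq_le].
have -> : fourier_inv g = cst 0 by apply: xgetPN => f fg; apply: nofg; exists f.
split; first by split; exact: measurable_cst.
rewrite csqE integral0_eq; last by move=> x _ /=; rewrite expr0n/= addr0 sqrtr0 expr0n.
by rewrite mule_ge0 ?csq_ge0// lee_fin divr_ge0// exprn_ge0// mulr_ge0// pi_ge0.
Qed.

Lemma ae_normc_fourier_le f : inL1 f -> inL2 f ->
  {ae mu, forall xi, normc (fourier f xi) <= 4 * fine (L1norm f)}.
Proof.
move=> f1 f2; have := fourierL2_L1 (fourierP f2) f1.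
by apply: filterS => xi ->; exact: normc_fourierL1_le.
Qed.

(** [fourier] chooses a representative, so the datum u0 = 0 gives a zero initial value at almost
    every frequency. *)
Lemma ae_fourier0 : {ae mu, forall xi, fourier (cst 0 : V -> R[i]) xi = 0}.
Proof.
have m0 : cmeasurable (cst 0 : V -> R[i]) by split; exact: measurable_cst.
have c0 : L1norm (cst 0 : V -> R[i]) = 0%E.
  by rewrite L1normE integral0_eq// => x _; rewrite /= expr0n/= addr0 sqrtr0.
have s0 : csq (cst 0 : V -> R[i]) = 0%E.
  by rewrite csqE integral0_eq// => x _; rewrite /= expr0n/= addr0 sqrtr0 expr0n.
have := @ae_normc_fourier_le (cst 0) _ _; rewrite c0 mulr0 => h.
have {}h : {ae mu, forall xi, normc (fourier (cst 0 : V -> R[i]) xi) <= 0}.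
  by apply: h; [split=> //; rewrite c0|apply/inL2E; split=> //; rewrite s0].
apply: filterS h => xi xi0; apply: eq0_normc; apply/le_anti.
by rewrite xi0 normc_nonneg.
Qed.

Lemma cmeasurableZ (c : R[i]) f : cmeasurable f -> cmeasurable (fun x => c * f x).
Proof.
move=> [mr mi]; split.
- rewrite (_ : (fun x => _) = (fun x => complex.Re c * complex.Re (f x) - complex.Im c * complex.Im (f x))).
    by apply: measurable_funB; apply: measurable_funM.
  by apply/funext => x; case: c; case: (f x).
- rewrite (_ : (fun x => _) = (fun x => complex.Re c * complex.Im (f x) + complex.Im c * complex.Re (f x))).
    by apply: measurable_funD; apply: measurable_funM.
  by apply/funext => x; case: c; case: (f x).
Qed.

Lemma measurable_sqrt : measurable_fun [set: R] (@Num.sqrt R).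
Proof. by apply: continuous_measurable_fun; exact: sqrt_continuous. Qed.

Lemma L1norm_le_L11norm f : cmeasurable f -> (L1norm f <= L11norm f)%E.
Proof.
move=> mf; rewrite L1normE; have mn := measurable_normc mf.
have menorm : measurable_fun [set: V] (@enorm R N).
  apply: (measurableT_comp measurable_sqrt).
  rewrite (_ : (fun x : V => dotp x x) = (fun x => enorm x ^+ 2)).
    exact: measurable_enorm_sq.
  by apply/funext => x; rewrite enorm_sq.
apply: ge0_le_integral => //.
- by move=> x _; rewrite lee_fin normc_nonneg.
- exact/measurable_EFinP.
- by apply/measurable_EFinP; apply: measurable_funM => //; exact: measurable_funD.
- move=> x _; rewrite lee_fin ler_peMl ?normc_nonneg// lerDl.
  by rewrite /enorm sqrtr_ge0.
Qed.

Lemma cmeasurable_profile (t : R) : cmeasurable (profile t : V -> R[i]).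
Proof.
split; last exact: measurable_cst.
have ml : measurable_fun [set: V] (fun x : V => ln (1 + enorm x ^+ 2)) by exact: measurable_Lsymbol.
apply: measurable_funM.
- apply: measurable_funM => //; apply: measurable_funM => //.
  apply: (measurableT_comp (@measurable_powR R _)).
  by apply: measurable_funD => //; exact: measurable_enorm_sq.
- apply: (measurableT_comp (f := sin)).
    by apply: continuous_measurable_fun; exact: continuous_sin.
  by apply: measurable_funM => //; exact: (measurableT_comp measurable_sqrt).
Qed.

Lemma normc_profile_le (t : R) (xi : V) : normc (profile t xi) <= 4 / pi * normc (decay t xi).
Proof.
have nr (r : R) : normc r%:C = `|r| by rewrite /= expr0n/= addr0 sqrtr_sqr.
rewrite normc_decay /profile nr.
have e0 : 0 < 1 + enorm xi ^+ 2 by rewrite ltr_pwDl// sqr_ge0.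
rewrite normrM -[leRHS]mulr1 ler_pM ?norm_sin_le1// /powR gt_eqF//.
rewrite ger0_norm ?divr_ge0 ?mulr_ge0 ?expR_ge0 ?pi_ge0//.
rewrite mulrAC le_eqVlt (_ : - (t / 2) * _ = - (Lsymbol xi / 2 * t)) ?eqxx//.
by rewrite /Lsymbol; ring.
Qed.

End fourier_spec.

(** The integrated weight decays like t^(-N/2), which is the square of the claimed rate times a
    spare t^-1. *)
Lemma sqrt_inv_exprE (R : realType) (N : nat) (t : R) : 0 < t ->
  Num.sqrt t^-1 ^+ N = t^-1 * (t `^ (- ((N%:R - 2) / 4))) ^+ 2.
Proof.
move=> t0.
have -> : Num.sqrt t^-1 = expR (- (ln t / 2)).
  rewrite -[RHS]ger0_norm ?expR_ge0// -sqrtr_sqr -expRM_natl; congr Num.sqrt.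
  by rewrite (_ : 2 * - (ln t / 2) = - ln t) ?expRN ?lnK//; field.
have -> : t^-1 = expR (- ln t) by rewrite expRN lnK.
rewrite /powR gt_eqF// -!expRM_natl -expRD; congr expR.
by field.
Qed.

Theorem theorem3p5 (R : realType) (N : nat) (hN : (3 <= N)%N) :
  exists t0 : R, 0 < t0 /\
    forall (u1 : Rn R N -> R[i]) (u : R -> Rn R N -> R[i]),
      inL2 u1 -> inL11 u1 -> is_solution (cst 0) u1 u ->
      forall t : R, t0 <= t ->
        (L2norm (fun x => (u t x - cintegral u1 * fourier_inv (profile t) x)%R)
          <= (L2norm u1 + L11norm u1) * (t `^ (- ((N%:R - 2) / 4)))%:E)%E.
Proof.
have N0 : (0 < N)%N by exact: leq_trans hN.
have Nr : 0 < N%:R :> R by rewrite ltr0n.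
have pi0 : 0 < pi :> R by exact: pi_gt0.
pose c : R := (2 * pi) ^+ N.
have c0 : 0 < c by rewrite exprn_gt0// mulr_gt0.
(* The two terms come from u and from the profile, each doubled by [csqB]. Here 16 / pi is the
   factor 4 / pi of the oscillator times the factor 4 of |u1^|, and 2^2 comes from |integral of u1|
   <= 2 m. *)
pose K0 : R := 2 * (4 / c * (16 / pi) ^+ 2) + 2 * (2 ^+ 2 * (4 / c * (4 / pi) ^+ 2)).
have K00 : 0 <= K0.
  have q (x : R) : 0 <= 4 / c * x ^+ 2 by rewrite mulr_ge0 ?sqr_ge0// divr_ge0// ltW.
  by apply: addr_ge0; apply: mulr_ge0 => //; apply: mulr_ge0 => //; exact: sqr_ge0.
(* The factor (pi sqrt N)^N is what remains of the integrated weight once t^(-N/2) is taken out. *)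
pose K : R := K0 * (pi * Num.sqrt N%:R) ^+ N.
have K_ge0 : 0 <= K by rewrite mulr_ge0// exprn_ge0// mulr_ge0 ?sqrtr_ge0// ltW.
(* N <= t is required by [csq_decay_le], and K <= t makes K t^-1 at most 1. *)
exists (N%:R + K); split; first by rewrite ltr_pwDl.
move=> u1 u u12 [u11 _] [[uDL _] _ [v [vu sol]]] t tK.
have Nt : N%:R <= t by apply: le_trans tK; rewrite lerDl.
have Kt : K <= t by apply: le_trans tK; rewrite lerDr ltW.
have t0 : 0 < t by exact: lt_le_trans Nt.
have [ut2 _] := uDL t (ltW t0).
have [mu1 u1y] := u11.
pose m := fine (L1norm u1).
have u1_ge0 : (0 <= L1norm u1)%E.
  by rewrite L1normE; apply: integral_ge0 => x _; rewrite lee_fin normc_nonneg.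
have m0 : 0 <= m by exact: fine_ge0.
have mE : m%:E = L1norm u1 by rewrite fineK// ge0_fin_numE.
pose M : R := (pi * Num.sqrt (t / N%:R)^-1) ^+ N.
have dM : (csq (decay t : Rn R N -> R[i]) <= M%:E)%E by exact: csq_decay_le.
have md : cmeasurable (decay t : Rn R N -> R[i]) by exact: cmeasurable_decay.
have [mut _] := (inL2E (u t)).1 ut2.
have fut := fourierP ut2; have [_ /inL2E[mfut _] _] := fut.
have csq_u : (csq (u t) <= (4 / c * (16 / pi) ^+ 2 * m ^+ 2 * M)%:E)%E.
  apply: le_trans (fourierL2_csq_le fut) _.
  have : (csq (fourier (u t)) <= ((16 / pi * m) ^+ 2)%:E * csq (decay t : Rn R N -> R[i]))%E.
    apply: le_csq => //; first by rewrite sqr_ge0.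
    (* Off four null sets one has the equation at xi, the representative [v t] of the transform of
       [u t], the bound on the transform of u1, and the zero initial value. *)
    apply: filterS2 (filterI sol (vu t (ltW t0)))
      (filterI (ae_normc_fourier_le u11 u12) (@ae_fourier0 R N)) => xi [ode <-] [hu1 f0].
    rewrite -exprMn ler_sqr ?nnegrE ?normc_nonneg ?mulr_ge0 ?normc_nonneg ?invr_ge0 ?(ltW pi0)//.
    rewrite f0 in ode; apply: le_trans (normc_ode_le ode t0) _.
    rewrite normc_decay ler_wpM2r ?expR_ge0//.
    rewrite (_ : 16 / pi * m = 4 / pi * (4 * m)); last by ring.
    by rewrite ler_wpM2l// divr_ge0// ltW.
  move=> /le_trans h.
  apply: (@le_trans _ _ ((4 / c)%:E * (((16 / pi * m) ^+ 2)%:E * M%:E))%E).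
    rewrite lee_wpmul2l ?lee_fin ?divr_ge0 ?(ltW c0)//; apply: h.
    by rewrite lee_wpmul2l// lee_fin sqr_ge0.
  by rewrite -!EFinM lee_fin exprMn !mulrA.
pose phi : Rn R N -> R[i] := fourier_inv (profile t).
have [mphi phi_le] : cmeasurable phi /\ (csq phi <= (4 / c)%:E * csq (profile t : Rn R N -> R[i]))%E.
  exact: fourier_invP.
have csq_phi : (csq phi <= (4 / c * (4 / pi) ^+ 2 * M)%:E)%E.
  apply: le_trans phi_le _.
  have : (csq (profile t : Rn R N -> R[i]) <= ((4 / pi) ^+ 2)%:E * csq (decay t : Rn R N -> R[i]))%E.
    apply: le_csq => //; [by rewrite sqr_ge0|exact: cmeasurable_profile|].
    apply: aeW => xi; rewrite -exprMn ler_sqr ?nnegrE ?normc_nonneg ?mulr_ge0 ?normc_nonneg ?invr_ge0 ?pi_ge0//.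
    exact: normc_profile_le.
  move=> /le_trans h.
  apply: (@le_trans _ _ ((4 / c)%:E * (((4 / pi) ^+ 2)%:E * M%:E))%E).
    rewrite lee_wpmul2l ?lee_fin ?divr_ge0 ?(ltW c0)//; apply: h.
    by rewrite lee_wpmul2l// lee_fin sqr_ge0.
  by rewrite -!EFinM lee_fin !mulrA.
pose psi x := cintegral u1 * phi x.
have mpsi : cmeasurable psi by exact: cmeasurableZ.
have csq_psi : (csq psi <= ((2 * m) ^+ 2 * (4 / c * (4 / pi) ^+ 2 * M))%:E)%E.
  apply: (@le_trans _ _ (((2 * m) ^+ 2)%:E * csq phi)%E).
    apply: le_csq => //; first by rewrite sqr_ge0.
    apply: aeW => x; rewrite /psi normcM exprMn ler_wpM2r ?sqr_ge0//.
    by rewrite ler_sqr ?nnegrE ?normc_nonneg ?mulr_ge0//; exact: normc_cintegral_le.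
  by rewrite [leRHS]EFinM lee_wpmul2l// lee_fin sqr_ge0.
set p := t `^ _; have p0 : 0 <= p by exact: powR_ge0.
(* The spare factor t^-1 is spent here against K. *)
have KM : K0 * M <= p ^+ 2.
  have -> : K0 * M = K * t^-1 * p ^+ 2.
    rewrite -mulrA -sqrt_inv_exprE// /M /K -!mulrA -exprMn -(mulrA pi) -sqrtrM ?(ltW Nr)//.
    by rewrite invf_div.
  by rewrite ler_piMl ?sqr_ge0// ler_pdivrMr// mul1r.
have key : (L2norm (u t \- psi)%R <= (m * p)%:E)%E.
  rewrite L2norm_le ?mulr_ge0//.
  apply: le_trans (csqB mut mpsi) _.
  apply: (@le_trans _ _ (2%:E * (4 / c * (16 / pi) ^+ 2 * m ^+ 2 * M)%:E
      + 2%:E * ((2 * m) ^+ 2 * (4 / c * (4 / pi) ^+ 2 * M))%:E)%E).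
    by apply: leeD; rewrite lee_wpmul2l.
  rewrite -!EFinM -EFinD lee_fin.
  rewrite [leLHS](_ : _ = m ^+ 2 * (K0 * M)); last by rewrite /K0; ring.
  by rewrite exprMn ler_wpM2l ?sqr_ge0.
apply: le_trans key _; rewrite EFinM mE lee_wpmul2r ?lee_fin//.
apply: le_trans (L1norm_le_L11norm mu1) _.
by rewrite leeDr// Lnorm_ge0.
Qed.
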